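(* The edge-splitting map $S:\mathcal H_V\to\mathcal H_V$ is a chain map, hence so is $e^S$, and $e^S$ maps the subcomplex $\mathcal{PG}$ of connected graphs without hairs into $(\mathcal H_V)^{Sp(V)}$. Consequently, dualizing gives an assembly map $$F[H_c^*(\mathcal{PH}_V)]\to F[H_c^*(\mathcal{PH}_V)]_{Sp(V)}\to H_c^*(\mathcal{PG}).$$ Explicitly: if $\zeta_1,\dots,\zeta_m$ are homogeneous cocycles on $\mathcal{PH}_V$, then the linear functional $\zeta$ on $\mathcal{PG}$ defined as follows is a cocycle. To evaluate $\zeta$ on a connected graph $G$ without hairs, expand $e^S(G)$ as a sum of hairy graphs; a term with exactly $m$ connected components, written as an ordered product $X_1\cdots X_m$, contributes (with its coefficient) $$\sum_{\sigma\in\mathfrak S_m}\epsilon(\sigma)\,\zeta_1(X_{\sigma(1)})\cdots\zeta_m(X_{\sigma(m)}),$$ where the Koszul sign $\epsilon(\sigma)$ is determined by $X_1\cdots X_m=\epsilon(\sigma)X_{\sigma(1)}\cdots X_{\sigma(m)}$, and all other terms contribute $0$.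
   Context: $F$ is a field of characteristic $0$; $V$ is a symplectic $F$-vector space of dimension $2n$ with symplectic basis $\mathcal B=\{p_1,\dots,p_n,q_1,\dots,q_n\}$ and duals $p_i^*=q_i$, $q_i^*=-p_i$. $\mathcal O=\bigoplus_{s\ge2}\mathcal O((s))$ is a cyclic operad of finite-dimensional $F$-vector spaces, $\mathcal O((s))$ being the $\mathfrak S_s$-module of elements with $s$ input/output slots, with $\mathcal O((2))\cong F$ spanned by the identity; any slot of one element can be composed with any slot of another. Hairy graph complex. An admissible graph is a finite, not necessarily connected, graph with no bivalent vertices; univalent vertices are leaves, the edge at a leaf is a hair, other vertices and edges are internal. An orientation is an ordering of internal vertices and a direction of each internal edge; transposing two vertices or reversing an edge changes the sign. $C_k\mathcal H_V$ is spanned by oriented admissible graphs with $k$ internal vertices, each internal vertex $v$ of valence $|v|$ decorated by an element of $\mathcal O((|v|))$ with slots identified with the half-edges at $v$, and leaves labeled by vectors in $V$, modulo isomorphism, multilinearity, and $(X,-or)=-(X,or)$. The boundary sums over contractions of non-loop internal edges, composing the two operad elements along the edge (if the orientation is represented so that the edge goes from the first vertex to the second, the merged vertex is put first with sign $+$). The degree of a graph is $\sum_v(|v|-2)$ over internal vertices $v$; it is preserved by $\partial$. $Sp(V)$ acts through the labels. $\mathcal{PH}_V$ is the subcomplex spanned by connected graphs; disjoint union (concatenating vertex orders) identifies $\mathcal H_V$ with $F[\mathcal{PH}_V]$, where $F[U]$ denotes the free graded commutative algebra on the graded space $U$, graphs being graded by the number of internal vertices. $\mathcal{PG}\subset\mathcal{PH}_V$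 is the subcomplex of connected graphs with no hairs. $S(X)=\frac1{\dim V}\sum_{e,x}X_{e,x}$, summed over internal edges $e$ of $X$ and $x\in\mathcal B$, where $X_{e,x}$ is obtained by cutting $e$ into two hairs, labeling the initial cut point by $x$ and the terminal one by $x^*$. $e^S=\sum_j S^j/j!$ (a finite sum on each graph). $H_c^*$ denotes cohomology of the degree-graded dual (direct sum over degrees of the duals of the degree $d$ parts); the subscript $Sp(V)$ denotes coinvariants. *)

(* Defs.v *)
From HB Require Import structures.
From mathcomp Require Import all_boot all_order all_algebra perm.
From mathcomp Require Import generic_quotient ring_quotient.
From mathcomp Require Import boolp functions freeg.

Set Implicit Arguments.
Unset Strict Implicit.
Unset Printing Implicit Defensive.

Import GRing.Theory.
Local Open Scope ring_scope.
Local Open Scope quotient_scope.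

Record linsub (F : fieldType) (M : lmodType F) := LinSub {
  linsub_pred :> {pred M};
  linsubP : submod_closed linsub_pred }.

HB.instance Definition _ (F : fieldType) (M : lmodType F) (S : linsub M) :=
  GRing.isSubmodClosed.Build F M (linsub_pred S) (linsubP S).

Section LinearSpan.
Variables (F : fieldType) (M : lmodType F) (G : M -> Prop).

Inductive in_span : M -> Prop :=
| in_span0 : in_span 0
| in_spanP c x y : G x -> in_span y -> in_span (c *: x + y).

Lemma in_span_closed : submod_closed (fun x => `[< in_span x >]).
Proof.
split; first by apply/asboolP; exact: in_span0.
move=> a x y /asboolP sx /asboolP sy; apply/asboolP.
elim: sx => [|c u v Gu _ IH]; first by rewrite scaler0 add0r.
by rewrite scalerDr scalerA -addrA; apply: in_spanP.
Qed.

Definition lspan : linsub M := LinSub in_span_closed.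

End LinearSpan.

Section Subspace.
Variables (F : fieldType) (M : lmodType F) (S : linsub M).

Record subspace : Type := Subspace { subval :> M; _ : subval \in S }.

HB.instance Definition _ := [isSub for subval].
HB.instance Definition _ := [Choice of subspace by <:].
HB.instance Definition _ := [SubChoice_isSubLmodule of subspace by <:].

End Subspace.

Section QuotientSpace.
Variables (F : fieldType) (M : lmodType F) (S : linsub M).

Definition quotspace : Type := Quotient.quot (linsub_pred S).

HB.instance Definition _ := GRing.Zmodule.on quotspace.
HB.instance Definition _ := Quotient.on quotspace.

Definition qproj (x : M) : quotspace := \pi x.
Definition qscale (a : F) (x : quotspace) : quotspace := qproj (a *: repr x).

Lemma qprojK (x : quotspace) : qproj (repr x) = x.
Proof. exact: reprK. Qed.

Lemma qproj_eq x y : (qproj x == qproj y) = (x - y \in S).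
Proof. by rewrite Quotient.idealrBE. Qed.

Lemma qprojD x y : qproj (x + y) = qproj x + qproj y.
Proof. exact: (raddfD \pi_(Quotient.quot (linsub_pred S))). Qed.

Lemma qprojZ a x : qproj (a *: x) = qscale a (qproj x).
Proof.
apply/eqP; rewrite qproj_eq -scalerBr rpredZ //.
by rewrite -qproj_eq qprojK.
Qed.

Lemma qscaleA a b x : qscale a (qscale b x) = qscale (a * b) x.
Proof. by rewrite -(qprojK x) -!qprojZ scalerA. Qed.

Lemma qscale1 : left_id 1 qscale.
Proof. by move=> x; rewrite -(qprojK x) -qprojZ scale1r. Qed.

Lemma qscaleDr : right_distributive qscale +%R.
Proof.
move=> a x y; rewrite -(qprojK x) -(qprojK y).
by rewrite -qprojD -!qprojZ scalerDr qprojD.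
Qed.

Lemma qscaleDl x : {morph qscale^~ x : a b / a + b}.
Proof. by move=> a b; rewrite -(qprojK x) -!qprojZ scalerDl qprojD. Qed.

HB.instance Definition _ :=
  GRing.Zmodule_isLmodule.Build F quotspace qscaleA qscale1 qscaleDr qscaleDl.

Lemma qproj_is_linear : linear qproj.
Proof. by move=> a x y; rewrite qprojD qprojZ. Qed.

HB.instance Definition _ :=
  GRing.isLinear.Build F M quotspace *:%R qproj qproj_is_linear.

(* If f is linear and maps S to S, then [qinduced f] is the linear map
   x mod S |-> f x mod S. *)
Definition descends (f : M -> M) : Prop := forall x, x \in S -> f x \in S.
Definition qinduced (f : M -> M) (x : quotspace) : quotspace :=
  qproj (f (repr x)).

End QuotientSpace.

(* [glues i j e]: e numbers the slots that remain when slot i of an s-slot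
   element is glued to slot j of a t-slot element. *)
Definition glues s t u (i : 'I_s) (j : 'I_t) (e : 'I_u -> 'I_s + 'I_t) : Prop :=
  injective e /\
  forall z, (z \in codom e) = (z != inl i) && (z != inr j).

Definition sum_map (A B C D : Type) (f : A -> C) (g : B -> D) (z : A + B) :
    C + D :=
  match z with inl a => inl (f a) | inr b => inr (g b) end.

Definition sum_swap (A B : Type) (z : A + B) : B + A :=
  match z with inl a => inr a | inr b => inl b end.

(* [oper O s] is O((s)), its slots being numbered by 'I_s.  [oact] is only
   meaningful on bijections, which force s = t: it is the action of the
   symmetric group, g moving slot a to slot g a; having two indices avoids
   casts.  [ocomp i j e x y] joins slot i of x to slot j of y and numbers the
   remaining slots by e. *)
Record cyclicOperad (F : fieldType) := CyclicOperad {
  oper :> nat -> vectType F;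
  oact : forall s t, ('I_s -> 'I_t) -> oper s -> oper t;
  ocomp : forall s t u, 'I_s -> 'I_t -> ('I_u -> 'I_s + 'I_t) ->
    oper s -> oper t -> oper u;
  oid : oper 2;
  oper_ge2 : forall s (x : oper s), (s < 2)%N -> x = 0;
  oact_linear : forall s t (f : 'I_s -> 'I_t), bijective f ->
    linear (oact f);
  oact_id : forall s (x : oper s), oact id x = x;
  oact_comp : forall s t u (f : 'I_s -> 'I_t) (g : 'I_t -> 'I_u) x,
    bijective f -> bijective g -> oact (g \o f) x = oact g (oact f x);
  ocomp_linearl : forall s t u (i : 'I_s) (j : 'I_t) (e : 'I_u -> _) y,
    glues i j e -> linear (fun x => ocomp i j e x y);
  ocomp_linearr : forall s t u (i : 'I_s) (j : 'I_t) (e : 'I_u -> _) x,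
    glues i j e -> linear (ocomp i j e x);
  ocomp_act : forall s t u s' t' u' (f : 'I_s -> 'I_s') (g : 'I_t -> 'I_t')
      (h : 'I_u -> 'I_u') (i : 'I_s) (j : 'I_t) e e' x y,
    bijective f -> bijective g -> bijective h -> glues i j e ->
    (forall c, e' (h c) = sum_map f g (e c)) ->
    oact h (ocomp i j e x y) = ocomp (f i) (g j) e' (oact f x) (oact g y);
  ocomp_sym : forall s t u (i : 'I_s) (j : 'I_t) (e : 'I_u -> _) x y,
    glues i j e -> ocomp j i (@sum_swap _ _ \o e) y x = ocomp i j e x y;
  (* Associativity for x -i-j- y -k-l- z, with j and k distinct slots of y:
     a is slot k of y seen in the composite of x and y, and b is slot j of y
     seen in the composite of y and z; the last hypothesis says that the two
     numberings of the slots of the triple composite agree. *)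
  ocomp_assoc : forall s t r u v w (i : 'I_s) (j k : 'I_t) (l : 'I_r)
      (a : 'I_u) (b : 'I_v) e1 e2 f1 f2 x y z,
    glues i j e1 -> e1 a = inr k -> glues a l e2 ->
    glues k l f1 -> f1 b = inl j -> glues i b f2 ->
    (forall c : 'I_w,
      match e2 c with inl d => inl (e1 d) | inr q => inr q end =
      match f2 c with
      | inl p => inl (inl p)
      | inr d => match f1 d with inl m => inl (inr m) | inr q => inr q end
      end) ->
    ocomp a l e2 (ocomp i j e1 x y) z = ocomp i b f2 x (ocomp k l f1 y z);
  oid_neq0 : oid != 0;
  oid_span : forall x : oper 2, exists c, x = c *: oid;
  ocomp_id : forall s (i : 'I_s) (j k : 'I_2) (x : oper s), j != k ->
    ocomp i j (fun a => if a == i then inr k else inl a) x oid = x }.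

Arguments oact {F} _ {s t}.
Arguments ocomp {F} _ {s t u}.

(* W indexes the internal vertices, and w : W has valence [ar w].  A half-edge
   is either one of the [ar w] slots at an internal vertex w, or the half-edge
   at a leaf l : L.  The edges are the orbits {z, opp z}; an edge is internal
   when neither half is at a leaf.  An internal edge is directed away from its
   half h such that [dir h]; [dir] carries no information on hairs.  Valence 0
   is excluded because O((0)) = 0, and an edge joining two leaves is allowed. *)
Record graph (W L : finType) := Graph {
  ar : W -> nat;
  opp : {w : W & 'I_(ar w)} + L -> {w : W & 'I_(ar w)} + L;
  dir : {w : W & 'I_(ar w)} -> bool;
  ar_ge3 : forall w, (3 <= ar w)%N;
  oppK : involutive opp;
  opp_neq : forall z, opp z != z;
  dir_opp : forall h h', opp (inl h) = inl h' -> dir h' = ~~ dir h }.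

Notation slot G := {w & 'I_(ar G w)}.

Section GraphOps.
Variables (W L : finType) (G : graph W L).

Definition vend (z : slot G + L) : W + L :=
  match z with inl h => inl (tag h) | inr l => inr l end.

Definition adj : rel (W + L) := fun u v =>
  [exists z, (vend z == u) && (vend (opp z) == v)].

Definition gconnected : bool := n_comp adj predT == 1%N.

Definition gdegree : nat := (\sum_w (ar G w - 2))%N.

(* Internal edges, as pairs (initial half, terminal half). *)
Definition iedge : finType :=
  {e : slot G * slot G | (opp (inl e.1) == inl e.2) && dir e.1}.
Definition ini (e : iedge) : slot G := (val e).1.
Definition ter (e : iedge) : slot G := (val e).2.
Definition nledge : finType := {e : iedge | tag (ini e) != tag (ter e)}.

Lemma opp_inj : injective (opp (g := G)).
Proof. exact: inv_inj (@oppK _ _ G). Qed.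

Lemma opp_ini e : opp (inl (ini e)) = inl (ter e).
Proof. by case/andP: (valP e) => /eqP. Qed.

Lemma opp_ter e : opp (inl (ter e)) = inl (ini e).
Proof. by rewrite -opp_ini oppK. Qed.

Lemma ini_neq_ter e : ini e != ter e.
Proof.
apply/eqP => E; have := opp_neq (inl (ini e) : slot G + L).
by rewrite opp_ini -E eqxx.
Qed.

(* Graph obtained by pulling back the half-edges of G along an injection phi
   whose image is stable under opp. *)
Section Pull.
Variables (W' L' : finType) (ar' : W' -> nat).
Variables (phi : {w : W' & 'I_(ar' w)} -> slot G) (psi : L' -> L).
Hypothesis ar'_ge3 : forall w, (3 <= ar' w)%N.
Hypothesis phi_inj : injective phi.
Hypothesis psi_inj : injective psi.
Let f := sum_map phi psi.
Hypothesis f_opp : forall z, exists z', f z' = opp (f z).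

Definition pull_opp z := odflt z [pick z' | f z' == opp (f z)].

Lemma pull_oppE z : f (pull_opp z) = opp (f z).
Proof.
rewrite /pull_opp; case: pickP => [z' /eqP //|no].
by have [z' E] := f_opp z; have := no z'; rewrite E eqxx.
Qed.

Lemma pull_inj : injective f.
Proof. by move=> [a|a] [b|b] //= [] => [/phi_inj|/psi_inj] ->. Qed.

Lemma pull_oppK : involutive pull_opp.
Proof. by move=> z; apply: pull_inj; rewrite !pull_oppE oppK. Qed.

Lemma pull_opp_neq z : pull_opp z != z.
Proof.
by apply/eqP => E; have /eqP := opp_neq (f z); rewrite -pull_oppE E.
Qed.

Lemma pull_dir h h' : pull_opp (inl h) = inl h' ->
  dir (phi h') = ~~ dir (phi h).
Proof. by move=> E; have := pull_oppE (inl h); rewrite E => /esym/dir_opp. Qed.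

Definition pull_graph : graph W' L' :=
  Graph ar'_ge3 pull_oppK pull_opp_neq pull_dir.

End Pull.

End GraphOps.

Section Standardize.
Variables (W L : finType) (G : graph W L).

Definition std_ar (i : 'I_#|W|) : nat := ar G (enum_val i).
Definition std_slot (h : {i : 'I_#|W| & 'I_(std_ar i)}) : slot G :=
  existT (fun w => 'I_(ar G w)) (enum_val (tag h)) (tagged h).
Definition std_leaf (l : 'I_#|L|) : L := enum_val l.

Lemma std_slot_inj : injective std_slot.
Proof.
move=> [i a] [j b] /eqP; rewrite -tag_eqE /tag_eq /= => /andP[/eqP E].
move: (enum_val_inj E) => {E} ij; case: j / ij b => b.
by rewrite tagged_asE => /eqP ->.
Qed.

Lemma std_slot_surj h : exists h', std_slot h' = h.
Proof.
case: h => w a.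
suff: forall i : 'I_#|W|, enum_val i = w ->
    exists h', std_slot h' = existT _ w a.
  by apply; apply: enum_rankK.
by move=> i E; case: w / E a => a; exists (existT _ i a).
Qed.

Lemma std_opp (z : {i : 'I_#|W| & 'I_(std_ar i)} + 'I_#|L|) :
  exists z', sum_map std_slot std_leaf z' = opp (sum_map std_slot std_leaf z).
Proof.
case: (opp _) => [h|l]; first by have [h' <-] := std_slot_surj h; exists (inl h').
by exists (inr (enum_rank l)); rewrite /= /std_leaf enum_rankK.
Qed.

Definition std_graph : graph 'I_#|W| 'I_#|L| :=
  pull_graph (fun i => ar_ge3 G (enum_val i)) std_slot_inj
    (@enum_val_inj _ L) std_opp.

End Standardize.

(* The numbering of the remaining slots: those of the first element, then those
   of the second one, in increasing order. *)
Definition glue_num s t (i : 'I_s) (j : 'I_t) (c : 'I_(s + t - 2)) :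
    'I_s + 'I_t :=
  nth (inl i) (enum [pred z | (z != inl i) && (z != inr j)]) c.

Lemma glue_numP s t (i : 'I_s) (j : 'I_t) : glues i j (glue_num i j).
Proof.
set P := [pred z : 'I_s + 'I_t | (z != inl i) && (z != inr j)].
have szP : size (enum P) = (s + t - 2)%N.
  rewrite -cardE; have := cardC P; rewrite card_sum !card_ord => <-.
  suff -> : #|[predC P]| = 2%N by rewrite addnK.
  rewrite -(card2 (inl i : 'I_s + 'I_t) (inr j)); apply: eq_card => z.
  by rewrite !inE negb_and !negbK.
split=> [a b /eqP|z].
  by rewrite nth_uniq ?enum_uniq ?szP // => /eqP/val_inj.
transitivity (z \in enum P); last by rewrite mem_enum inE.
apply/codomP/idP => [[c ->]|zP]; first by rewrite mem_nth ?szP.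
have lt : (index z (enum P) < s + t - 2)%N by rewrite -szP index_mem.
by exists (Ordinal lt); rewrite /glue_num nth_index.
Qed.

(* In [con_vert] the merged vertex is None, which comes first in the enumeration
   of an option type. *)
Section Contraction.
Variables (W L : finType) (G : graph W L) (e : nledge G).

Let h1 := ini (val e).
Let h2 := ter (val e).

Definition con_vert : finType :=
  option {w : W | (w != tag h1) && (w != tag h2)}.

Definition con_ar (w : con_vert) : nat :=
  if w is Some u then ar G (val u) else (ar G (tag h1) + ar G (tag h2) - 2)%N.

Definition con_slot (h : {w : con_vert & 'I_(con_ar w)}) : slot G :=
  let: existT w a := h in
  match w return 'I_(con_ar w) -> slot G with
  | Some u => fun a => existT (fun w => 'I_(ar G w)) (val u) a
  | None => fun a =>
    match glue_num (tagged h1) (tagged h2) a with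
    | inl b => existT (fun w => 'I_(ar G w)) (tag h1) b
    | inr b => existT (fun w => 'I_(ar G w)) (tag h2) b
    end
  end a.

Lemma con_vertP (u : {w : W | (w != tag h1) && (w != tag h2)}) w :
  val u = w -> w != tag h1 /\ w != tag h2.
Proof. by move=> <-; apply/andP; apply: (valP u). Qed.

Lemma con_ar_ge3 w : (3 <= con_ar w)%N.
Proof.
case: w => [u|] /=; first exact: ar_ge3.
by apply: leq_trans (leq_sub2r 2 (leq_add (ar_ge3 G _) (ar_ge3 G _))).
Qed.

Lemma slot_inj w : injective (fun a : 'I_(ar G w) => existT _ w a : slot G).
Proof. by move=> a b E; apply: eq_from_Tagged E. Qed.

Lemma con_slot_inj : injective con_slot.
Proof.
have [glue_inj _] := glue_numP (tagged h1) (tagged h2).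
have neq12 : tag h1 != tag h2 by exact: (valP e).
have tagE (x y : slot G) : x = y -> tag x = tag y by move->.
move=> [[u|] a] [[v|] b] /=.
- move=> E; have /val_inj uv := tagE _ _ E.
  by case: v / uv b E => b /slot_inj ->.
- by case: (glue_num _ _ b) => c /tagE/con_vertP[]; rewrite /= eqxx.
- by case: (glue_num _ _ a) => c /esym/tagE/con_vertP[]; rewrite /= eqxx.
- move=> E; congr existT; apply: glue_inj.
  case: (glue_num _ _ a) E => c; case: (glue_num _ _ b) => d E.
  + by rewrite (slot_inj E).
  + by have /eqP := tagE _ _ E; rewrite (negPf neq12).
  + by have /eqP := tagE _ _ E; rewrite eq_sym (negPf neq12).
  + by rewrite (slot_inj E).
Qed.

Lemma con_slot_codom h : h != h1 -> h != h2 -> exists h', con_slot h' = h.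
Proof.
have [_ gcod] := glue_numP (tagged h1) (tagged h2).
case: h => w a.
have [E | n1] := eqVneq w (tag h1).
  subst w => ah1 _.
  have : inl a \in codom (glue_num (tagged h1) (tagged h2)).
    rewrite gcod andbT; apply: contraNneq ah1 => -[->].
    by case: (h1).
  by case/codomP => c E; exists (existT _ None c); rewrite /= -E.
have [E | n2] := eqVneq w (tag h2).
  subst w => _ ah2.
  have : inr a \in codom (glue_num (tagged h1) (tagged h2)).
    rewrite gcod /=; apply: contraNneq ah2 => -[->].
    by case: (h2).
  by case/codomP => c E; exists (existT _ None c); rewrite /= -E.
move=> _ _; have wP : (w != tag h1) && (w != tag h2) by rewrite n1 n2.
by exists (existT _ (Some (exist _ w wP)) a).
Qed.

Lemma con_slot_avoid h : con_slot h != h1 /\ con_slot h != h2.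
Proof.
have neq12 : tag h1 != tag h2 by exact: (valP e).
have tagE (x y : slot G) : x = y -> tag x = tag y by move->.
have [_ gcod] := glue_numP (tagged h1) (tagged h2).
case: h => [[u|] a] /=.
  by split; apply/eqP => /tagE/con_vertP[]; rewrite /= eqxx.
have := codom_f (glue_num (tagged h1) (tagged h2)) a; rewrite gcod.
case: (glue_num _ _ a) => c /andP[c1 c2]; split; apply/eqP => E.
- by case/negP: c1; apply/eqP; congr inl; apply: slot_inj; rewrite E; case: (h1).
- by have /eqP := tagE _ _ E; rewrite (negPf neq12).
- by have /eqP := tagE _ _ E; rewrite eq_sym (negPf neq12).
- by case/negP: c2; apply/eqP; congr inr; apply: slot_inj; rewrite E; case: (h2).
Qed.

Lemma con_opp (z : {w : con_vert & 'I_(con_ar w)} + L) :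
  exists z', sum_map con_slot id z' = opp (sum_map con_slot id z).
Proof.
case E: (opp _) => [h|l]; last by exists (inr l).
suff [h' <-] : exists h', con_slot h' = h by exists (inl h').
apply: con_slot_codom; apply/eqP => hh; move: E; rewrite hh.
- rewrite /h1 -opp_ter => /opp_inj; case: z => //= k [kh].
  by have [_] := con_slot_avoid k; rewrite kh eqxx.
- rewrite /h2 -opp_ini => /opp_inj; case: z => //= k [kh].
  by have [] := con_slot_avoid k; rewrite kh eqxx.
Qed.

Definition con_graph : graph con_vert L :=
  pull_graph con_ar_ge3 con_slot_inj (@inj_id L) con_opp.

End Contraction.

(* The new leaf next to the initial vertex of e is
   [inr true], the one next to its terminal vertex is [inr false]. *)
Section Cutting.
Variables (W L : finType) (G : graph W L) (e : iedge G).

Definition cut_emb (z : slot G + L) : slot G + (L + bool) :=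
  match z with inl h => inl h | inr l => inr (inl l) end.

Definition cut_opp (z : slot G + (L + bool)) : slot G + (L + bool) :=
  match z with
  | inl h =>
    if h == ini e then inr (inr true)
    else if h == ter e then inr (inr false)
    else cut_emb (opp (inl h))
  | inr (inl l) => cut_emb (opp (inr l))
  | inr (inr b) => inl (if b then ini e else ter e)
  end.

Lemma cut_oppK : involutive cut_opp.
Proof.
have n21 : (ter e == ini e) = false by rewrite eq_sym (negPf (ini_neq_ter e)).
move=> [h|[l|[]]] /=; rewrite ?eqxx ?n21 ?eqxx //.
- case: eqP => [-> //|/eqP n1]; case: eqP => [-> //|/eqP n2].
  case E: (opp (inl h)) => [k|l] /=; last by rewrite -E oppK.
  have kE : opp (inl k) = inl h :> slot G + L by rewrite -E oppK.
  case: eqP => [kh|_]; first by case/eqP: n2; case: (kE); rewrite kh opp_ini => -[].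
  case: eqP => [kh|_]; first by case/eqP: n1; case: (kE); rewrite kh opp_ter => -[].
  by rewrite kE.
- case E: (opp (inr l)) => [k|m] /=; last by rewrite -E oppK.
  have kE : opp (inl k) = inr l :> slot G + L by rewrite -E oppK.
  case: eqP => [kh|_]; first by move: kE; rewrite kh opp_ini.
  case: eqP => [kh|_]; first by move: kE; rewrite kh opp_ter.
  by rewrite kE.
Qed.

Lemma cut_emb_inj : injective cut_emb.
Proof. by move=> [a|a] [b|b] //= [] ->. Qed.

Lemma cut_opp_neq z : cut_opp z != z.
Proof.
case: z => [h|[l|[]]] //=.
- case: ifP => // _; case: ifP => // _.
  by apply/eqP => /(@cut_emb_inj _ (inl h)) /eqP; apply/negP/opp_neq.
- by apply/eqP => /(@cut_emb_inj _ (inr l)) /eqP; apply/negP/opp_neq.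
Qed.

Lemma cut_dir h h' : cut_opp (inl h) = inl h' -> dir h' = ~~ dir h.
Proof.
move=> /=; case: ifP => // _; case: ifP => // _.
by case E: (opp _) => [k|l] //= [<-]; apply: dir_opp.
Qed.

Definition cut_graph : graph W (L + bool)%type :=
  Graph (ar_ge3 G) cut_oppK cut_opp_neq cut_dir.

End Cutting.

(* The enumeration of a sigma type being lexicographic, the vertices of G 0
   come first, then those of G 1, and so on. *)
Section DisjointUnion.
Variables (r : nat) (W L : 'I_r -> finType).
Variable G : forall i, graph (W i) (L i).

Definition dun_ar (w : {i & W i}) : nat := ar (G (tag w)) (tagged w).

Definition dun_emb i (z : slot (G i) + L i) :
    {w : {i & W i} & 'I_(dun_ar w)} + {i & L i} :=
  match z with
  | inl h =>
    inl (existT (fun w => 'I_(dun_ar w)) (existT W i (tag h)) (tagged h))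
  | inr l => inr (existT L i l)
  end.

Definition dun_opp (z : {w : {i & W i} & 'I_(dun_ar w)} + {i & L i}) :=
  match z with
  | inl (existT w a) => dun_emb (opp (g := G (tag w))
      (inl (existT (fun v => 'I_(ar (G (tag w)) v)) (tagged w) a)))
  | inr l => dun_emb (opp (g := G (tag l)) (inr (tagged l)))
  end.

Definition dun_dir (h : {w : {i & W i} & 'I_(dun_ar w)}) : bool :=
  let: existT w a := h in
  dir (g := G (tag w))
    (existT (fun v => 'I_(ar (G (tag w)) v)) (tagged w) a).

Lemma dun_oppE i (z : slot (G i) + L i) :
  dun_opp (dun_emb z) = dun_emb (opp z).
Proof. by case: z => [[w a]|l]. Qed.

Lemma dun_surj z : exists i (z' : slot (G i) + L i), z = dun_emb z'.
Proof.
case: z => [[[i w] a]|[i l]]; last by exists i, (inr l).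
by exists i, (inl (existT (fun v => 'I_(ar (G i) v)) w a)).
Qed.

Lemma dun_emb_inj i : injective (@dun_emb i).
Proof.
move=> [[w a]|l] [[v b]|m] //= E; last first.
  by congr inr; apply: (@eq_from_Tagged _ L i); apply: (inr_inj E).
have {}E := inl_inj E.
have wv : w = v by apply: (@eq_from_Tagged _ W i); apply: (congr1 tag E).
case: v / wv b E => b E; congr (inl (existT _ w _)).
exact: (@eq_from_Tagged _ (fun w => 'I_(dun_ar w)) (existT W i w)).
Qed.

Lemma dun_oppK : involutive dun_opp.
Proof. by move=> z; have [i [z' ->]] := dun_surj z; rewrite !dun_oppE oppK. Qed.

Lemma dun_opp_neq z : dun_opp z != z.
Proof.
have [i [z' ->]] := dun_surj z.
by rewrite dun_oppE (inj_eq (@dun_emb_inj i)) opp_neq.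
Qed.

Lemma dun_dir_opp h h' : dun_opp (inl h) = inl h' -> dun_dir h' = ~~ dun_dir h.
Proof.
case: h => [[i w] a] /=.
by case E: (opp _) => [[v b]|l] //= [<-] /=; apply: dir_opp.
Qed.

Definition dun_graph : graph {i & W i} {i & L i} :=
  Graph (fun w => ar_ge3 (G (tag w)) (tagged w)) dun_oppK dun_opp_neq
    dun_dir_opp.

End DisjointUnion.

Section HairyGraphComplex.
Variables (F : fieldType) (O : cyclicOperad F) (V : vectType F).

Record dgraph (W L : finType) := DGraph {
  dshape :> graph W L;
  deco : forall w, O (ar dshape w);
  lab : L -> V }.

(* The ordering of the internal vertices is that of 'I_nv. *)
Record hgraph := HGraph {
  nv : nat;
  nl : nat;
  hgr :> dgraph 'I_nv 'I_nl }.

HB.instance Definition _ := gen_eqMixin hgraph.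
HB.instance Definition _ := gen_choiceMixin hgraph.

Section Operations.
Variables (W L : finType) (X : dgraph W L).

Definition standard : hgraph :=
  HGraph (@DGraph 'I_#|W| 'I_#|L| (std_graph X)
    (fun i => deco X (enum_val i)) (fun l => lab X (enum_val l))).

Definition con_deco (e : nledge X) (w : con_vert e) : O (con_ar w) :=
  let h1 := ini (val e) in let h2 := ter (val e) in
  match w return O (con_ar w) with
  | Some u => deco X (val u)
  | None => ocomp O (tagged h1) (tagged h2)
      (glue_num (tagged h1) (tagged h2)) (deco X (tag h1)) (deco X (tag h2))
  end.

Definition contract (e : nledge X) : dgraph (con_vert e) L :=
  @DGraph _ _ (con_graph e) (con_deco (e := e)) (lab X).

Definition cut (e : iedge X) (x y : V) : dgraph W (L + bool)%type :=
  @DGraph _ _ (cut_graph e) (deco X)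
    (fun l => match l with inl l => lab X l | inr b => if b then x else y end).

Definition set_lab (l : L) (v : V) : dgraph W L :=
  DGraph (deco X) (fun l' => if l' == l then v else lab X l').

Definition set_deco (w : W) (x : O (ar X w)) : dgraph W L :=
  DGraph (dfwith (deco X) x) (lab X).

Definition map_lab (g : V -> V) : dgraph W L := DGraph (deco X) (g \o lab X).

End Operations.

Definition disjoint_union r (X : 'I_r -> hgraph) : hgraph :=
  standard (@DGraph _ _ (dun_graph (fun i => X i : graph _ _))
    (fun w => deco (X (tag w)) (tagged w))
    (fun l => lab (X (tag l)) (tagged l))).

(* Isomorphisms of decorated graphs, regardless of the orientations: fW on
   vertices, fL on leaves, fS on the slots of each vertex. *)
Section Isomorphism.
Variables (k l : nat) (X Y : dgraph 'I_k 'I_l).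
Variables (fW : 'S_k) (fL : 'S_l).
Variable fS : forall w, 'I_(ar X w) -> 'I_(ar Y (fW w)).

Definition iso_slot (h : slot X) : slot Y :=
  existT (fun w => 'I_(ar Y w)) (fW (tag h)) (fS (tagged h)).

Record is_iso : Prop := IsIso {
  iso_bij : forall w, bijective (fS (w := w));
  iso_opp : forall z,
    opp (sum_map iso_slot fL z) = sum_map iso_slot fL (opp z);
  iso_deco : forall w, deco Y (fW w) = oact O (fS (w := w)) (deco X w);
  iso_lab : forall i, lab Y (fL i) = lab X i }.

(* Sign comparing the two orientations: signature of the vertex reordering
   times -1 for each internal edge whose direction is reversed. *)
Definition iso_sign : F :=
  (-1) ^+ (odd_perm fW + #|[pred e : iedge X | ~~ dir (iso_slot (ini e))]|).

End Isomorphism.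

Notation formal := {freeg hgraph / F}.

(* [rel_iso] covers both isomorphism and (X, -or) = -(X, or). *)
Inductive hrel : formal -> Prop :=
| rel_iso k l (X Y : dgraph 'I_k 'I_l) fW fL fS :
    @is_iso k l X Y fW fL fS ->
    hrel (<< HGraph X >> - iso_sign fS *: << HGraph Y >>)
| rel_lab k l (X : dgraph 'I_k 'I_l) i a u v :
    hrel (<< HGraph (set_lab X i (a *: u + v)) >>
      - (a *: << HGraph (set_lab X i u) >> + << HGraph (set_lab X i v) >>))
| rel_deco k l (X : dgraph 'I_k 'I_l) w a (x y : O (ar X w)) :
    hrel (<< HGraph (set_deco (a *: x + y)) >>
      - (a *: << HGraph (set_deco x) >> + << HGraph (set_deco y) >>)).

Definition hrelations : linsub formal := lspan hrel.

Definition hairy := quotspace hrelations.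

Definition hclass (X : hgraph) : hairy := qproj hrelations << X >>.

(* [con_sign e] has the parity of the reordering of the vertices that puts the
   initial vertex of e first and its terminal vertex second. *)
Definition con_sign (X : hgraph) (e : nledge X) : nat :=
  let i := tag (ini (val e)) in let j := tag (ter (val e)) in
  (i + j + (i < j))%N.

Definition formal_bd : formal -> formal :=
  fglift (fun X : hgraph =>
    \sum_(e : nledge X) (-1) ^+ con_sign e *: << standard (contract e) >>).

Definition formal_act (g : V -> V) : formal -> formal :=
  fglift (fun X : hgraph => << HGraph (map_lab X g) >> : formal).

Section Splitting.
Variables (n : nat) (p q : 'I_n -> V).

(* Each pair (x, x^* ) for x in the symplectic basis: p_i^* = q_i and
   q_i^* = - p_i. *)
Definition formal_split : formal -> formal :=
  fglift (fun X : hgraph =>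
    (\dim {: V})%:R^-1 *: \sum_(e : iedge X) \sum_(i < n)
      (<< standard (cut e (p i) (q i)) >>
       + << standard (cut e (q i) (- p i)) >>)).

(* S^j kills a graph with fewer than j internal edges. *)
Definition formal_exp_split : formal -> formal :=
  fglift (fun X : hgraph =>
    \sum_(j < #|iedge X|.+1) (j`!)%:R^-1 *: iter j formal_split << X >>).

Definition split_map : hairy -> hairy := qinduced formal_split.
Definition exp_split : hairy -> hairy := qinduced formal_exp_split.

End Splitting.

Definition bd : hairy -> hairy := qinduced formal_bd.
Definition hact (g : V -> V) : hairy -> hairy := qinduced (formal_act g).

Definition connected_graph (X : hgraph) : bool := gconnected X.
Definition connected_hairless (X : hgraph) : bool :=
  gconnected X && (nl X == 0%N).

Section Cohomology.
Variable P : pred hgraph.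

Definition graph_span : linsub hairy :=
  lspan (fun h => exists2 X, P X & h = hclass X).

Definition subcomplex := subspace graph_span.

Definition sclass (X : hgraph) : subcomplex := insubd 0 (hclass X).

(* Only meaningful when f preserves the subspace; the default value 0 is then
   never used. *)
Definition subrestrict (f : hairy -> hairy) (x : subcomplex) : subcomplex :=
  insubd 0 (f (subval x)).

(* Elements of the degree-graded dual, i.e. linear functionals vanishing in all
   but finitely many degrees, that are supported on graphs whose number of
   internal vertices is in K. *)
Record is_cochain (K : pred nat) (f : subcomplex -> F^o) : Prop := IsCochain {
  cochain_linear : linear f;
  cochain_degree : exists d, forall X, P X -> (d <= gdegree X)%N ->
    f (sclass X) = 0;
  cochain_support : forall X, P X -> ~~ K (nv X) -> f (sclass X) = 0 }.

Definition is_cocycle (K : pred nat) (f : subcomplex -> F^o) : Prop :=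
  is_cochain K f /\ forall x, f (subrestrict bd x) = 0.

Lemma cocycle_closed K : submod_closed (fun f => `[< is_cocycle K f >]).
Proof.
split.
  apply/asboolP; split=> //; split=> //; last by exists 0%N.
  by move=> a x y; rewrite scaler0 addr0.
move=> a f g /asboolP[[fl [d fd] fs] fc] /asboolP[[gl [d' gd] gs] gc].
apply/asboolP; split; last by move=> x; rewrite !fctE fc gc scaler0 addr0.
split.
- move=> b x y; rewrite !fctE /= fl gl !scalerDr !scalerA (mulrC a).
  by rewrite addrACA.
- exists (maxn d d') => X PX; rewrite geq_max => /andP[dX d'X].
  by rewrite !fctE /= fd // gd // scaler0 addr0.
- by move=> X PX KX; rewrite !fctE /= fs // gs // scaler0 addr0.
Qed.

Definition cocycles (K : pred nat) := subspace (LinSub (@cocycle_closed K)).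

Definition is_coboundary K (z : cocycles K) : Prop :=
  exists2 g, is_cochain predT g & forall x, subval z x = g (subrestrict bd x).

Definition coboundaries K : linsub (cocycles K) := lspan (@is_coboundary K).

(* H_c^*: the part of cohomological degree k for K = pred1 k, everything for
   K = predT. *)
Definition cohomology K := quotspace (@coboundaries K).

Definition cohclass K (z : cocycles K) : cohomology K := qproj _ z.

End Cohomology.

End HairyGraphComplex.

(* The free graded commutative algebra F[U] of U = (U_k)_k, as a vector
   space: spanned by words in homogeneous elements, the product being the
   concatenation.  In characteristic 0 the squares of odd elements vanish. *)

Section FreeGradedCommutative.
Variables (F : fieldType) (U : nat -> lmodType F).

Definition letter k (u : U k) : {k : nat & U k} := existT _ k u.
Definition word : choiceType := seq {k : nat & U k}.

Inductive gcrel : {freeg word / F} -> Prop :=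
| gc_linear (s t : word) k a (u v : U k) :
    gcrel (<< (s ++ letter (a *: u + v) :: t : word) >>
      - (a *: << (s ++ letter u :: t : word) >>
         + << (s ++ letter v :: t : word) >>))
| gc_comm (s t : word) k l (u : U k) (v : U l) :
    gcrel (<< (s ++ [:: letter u, letter v & t] : word) >>
      - (-1) ^+ (k * l) *: << (s ++ [:: letter v, letter u & t] : word) >>).

Definition gcfree := quotspace (lspan gcrel).

Definition gcprod m (k : 'I_m -> nat) (u : forall i, U (k i)) : gcfree :=
  qproj _ << ([seq letter (u i) | i <- enum 'I_m] : word) >>.

End FreeGradedCommutative.

Section Assembly.
Variables (F : fieldType) (V : vectType F) (omega : {skew_symmetric V}).

Record symplectic_basis n (p q : 'I_n -> V) : Prop := SymplecticBasis {
  sb_basis : basis_of fullv (codom p ++ codom q);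
  sb_pq : forall i j, omega (p i) (q j) = (i == j)%:R;
  sb_pp : forall i j, omega (p i) (p j) = 0;
  sb_qq : forall i j, omega (q i) (q j) = 0 }.

(* Sp(V); invertibility follows from nondegeneracy. *)
Definition in_Sp (g : 'End(V)) : Prop :=
  forall u v, omega (g u) (g v) = omega u v.

Variable O : cyclicOperad F.

Notation PH := (@connected_graph F O V).
Notation PG := (@connected_hairless F O V).

Definition sp_invariant (h : hairy O V) : Prop :=
  forall g, in_Sp g -> hact g h = h.

(* F[H_c^*(PH_V)] and its coinvariants; the action on a product of classes is
   diagonal, with (g zeta)(g X) = zeta X. *)
Definition cohomology_algebra :=
  gcfree (fun k => cohomology PH (pred1 k) : lmodType F).

Definition classprod m (k : 'I_m -> nat)
    (z : forall i, cocycles PH (pred1 (k i))) : cohomology_algebra :=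
  gcprod (U := fun k => cohomology PH (pred1 k) : lmodType F)
    (fun i => cohclass (z i)).

Inductive coinv_rel : cohomology_algebra -> Prop :=
| CoinvRel g m (k : 'I_m -> nat) (z gz : forall i, cocycles PH (pred1 (k i))) :
    in_Sp g ->
    (forall i x, subval (gz i) (subrestrict (hact g) x) = subval (z i) x) ->
    coinv_rel (classprod gz - classprod z).

Definition coinvariants := quotspace (lspan coinv_rel).

(* The sign with X_0 ... X_(m-1) = koszul X s * X_(s 0) ... X_(s (m-1)): each
   inversion of s exchanges two graphs. *)
Definition koszul m (X : 'I_m -> hgraph O V) (s : 'S_m) : F :=
  (-1) ^+ (\sum_(i < m) \sum_(j < m | (i < j)%N && (s j < s i)%N)
             nv (X (s i)) * nv (X (s j)))%N.

(* The functional on H_V by which each term of e^S(G) contributes.  It is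
   determined by these conditions, since the disjoint unions of connected graphs
   span H_V. *)
Record is_contribution m (k : 'I_m -> nat)
    (z : forall i, cocycles PH (pred1 (k i))) (Z : hairy O V -> F) : Prop :=
  IsContribution {
  contribution_linear : scalar Z;
  contribution_prod : forall X : 'I_m -> hgraph O V,
    (forall i, PH (X i)) ->
    Z (hclass (disjoint_union X)) =
      \sum_(s : 'S_m) koszul X s * \prod_i subval (z i) (sclass PH (X (s i)));
  contribution_other : forall r (X : 'I_r -> hgraph O V),
    r != m -> (forall i, PH (X i)) -> Z (hclass (disjoint_union X)) = 0 }.

End Assembly.

(* Main.v *)
Require Import Defs.
From HB Require Import structures.
From mathcomp Require Import all_boot all_order all_algebra perm.
From mathcomp Require Import boolp functions freeg.
From mathcomp Require Import zify.

(* Cutting an edge and contracting another one commute, also on orientations, so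
   S commutes with the boundary, and hence so does e^S.  The tensor sum of
   x (x) x^* does not depend on the symplectic basis, so S commutes with Sp(V),
   which fixes the graphs without hairs.

   Functionals f_0, ..., f_(m-1) on graphs have a product: its value on X is the
   sum, over the colorings of X by m colors which are constant on the connected
   components, of the products of the values f_i (part of color i), signed by the
   shuffle that sorts the vertices by color.  It is compatible with the relations
   defining H_V and satisfies the Leibniz rule.  If the f_i vanish on disconnected
   graphs, only the bijective colorings of the components contribute to its value
   on a disjoint union of connected graphs, and the signs are the Koszul signs.
   So it is the contribution of f_0, ..., f_(m-1).  By the Leibniz rule it is a
   cocycle if the f_i are, and changing one f_i by a coboundary changes it by a
   coboundary.  It is also graded commutative and Sp(V)-invariant, which makes
   precomposition with e^S descend to the coinvariants of the algebra. *)

Set Implicit Arguments.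
Unset Strict Implicit.
Unset Printing Implicit Defensive.

Import GRing.Theory.

(** * Ranks in enumerations *)

(** The obstacle is the comparison of orientations of graphs whose vertices lie in different finite
    types: a contraction has an option type, a part of a graph a subtype, a disjoint union a sigma
    type, and the vertex order is just the enumeration. So every orientation sign is a parity of a
    set of pairs of vertices plus a parity of reversed edges, defined for any embedding of graphs.
    Such parities add up and restrict to subsets, and each sign identity becomes a boolean identity
    for single pairs. Graphs built in two ways are compared by embedding both in a third one.

    Colorings replace components because a contraction does not change them: the two ends of the
    edge have the same color anyway. No list of components is ever chosen, so compatibility with the
    relations and the Leibniz rule hold for functionals that need not vanish on disconnected graphs.

    The algebra map is defined on words through chosen representative cocycles. Linearity in a
    letter then holds only up to coboundaries, the commutation rule exactly. *)

Definition rank (T : finType) (x : T) : nat := index x (enum T).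

Lemma rank_inj (T : finType) : injective (@rank T).
Proof.
move=> x y E; rewrite -(nth_index x (mem_enum T x)).
by rewrite -[index x _]/(rank x) E nth_index ?mem_enum.
Qed.

Lemma rank_enum_rank (T : finType) (x : T) : enum_rank x = rank x :> nat.
Proof.
rewrite -{2}(nth_enum_rank x x) /rank index_uniq ?enum_uniq -?cardE //.
Qed.

Lemma rank_ord n (i : 'I_n) : rank i = i.
Proof. exact: index_enum_ord. Qed.

Lemma rank_enum_val (T : finType) (i : 'I_#|T|) : rank (enum_val i) = i.
Proof. by rewrite -rank_enum_rank enum_valK. Qed.

Lemma rank_Some (T : finType) (x : T) : rank (Some x) = (rank x).+1.
Proof.
rewrite /rank !enumT [in LHS]unlock /=.
by rewrite index_map //; exact: Some_inj.
Qed.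

Lemma rank_None (T : finType) : rank (None : option T) = 0.
Proof. by rewrite /rank enumT unlock. Qed.

Lemma index_filter_lt (T : eqType) (P : pred T) s x y :
  P x -> P y -> x \in s -> y \in s ->
  (index x (filter P s) < index y (filter P s)) = (index x s < index y s).
Proof.
move=> Px Py; elim: s => // z s IH /=; rewrite !inE.
have [Pz|nPz] /= := boolP (P z).
  rewrite (eq_sym x) (eq_sym y); case: (z =P x) => [_|_] /=.
    by case: (z =P y).
  by case: (z =P y) => //= _ xs ys; rewrite !ltnS IH.
have zx : z != x by apply: contraNneq nPz => ->.
have zy : z != y by apply: contraNneq nPz => ->.
by rewrite (eq_sym x) (eq_sym y) !(negPf zx, negPf zy) /= ltnS; exact: IH.
Qed.

(** The enumeration of a subtype is the filtered enumeration of the type. Hence the vertices of a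
    part of a graph, and those untouched by a contraction, keep their order. *)
Lemma rank_val (T : finType) (P : pred T) (x y : {x | P x}) :
  (rank x < rank y) = (rank (val x) < rank (val y)).
Proof.
have E : map val (enum {: {x | P x}}) = filter P (enum T).
  rewrite [enum {: {x | P x}}]enumT [in LHS]unlock /=.
  rewrite pmap_filter; last exact: insubK.
  by rewrite -enumT; apply: eq_filter => z; rewrite isSome_insub.
rewrite /rank -(index_map val_inj) -[in ltnRHS](index_map val_inj) E.
by rewrite index_filter_lt ?(valP x) ?(valP y) ?mem_enum.
Qed.

(** A sigma type is enumerated block by block, so the index decides between different blocks. This
    makes the vertex order of a disjoint union a concatenation. *)
Lemma rank_tag (I : finType) (T : I -> finType) (x y : {i & T i}) :
  tag x != tag y -> (rank x < rank y) = (rank (tag x) < rank (tag y)).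
Proof.
rewrite /rank enumT unlock /= /tag_enum -enumT.
have : tag x \in enum I by rewrite mem_enum.
have : tag y \in enum I by rewrite mem_enum.
elim: (enum I) => //= i s IH iy ix nxy; rewrite !index_cat !(eq_sym i).
have mT (z : {i & T i}) : (z \in [seq Tagged T x0 | x0 <- enum (T i)]) = (tag z == i).
  apply/mapP/eqP => [[t _ ->] //|E]; case: z E => j t /= E.
  by subst j; exists t; rewrite ?mem_enum.
rewrite -!enumT !mT; move: ix iy; rewrite !inE.
have [xi|xi] /= := eqVneq (tag x) i; have [yi|yi] /= := eqVneq (tag y) i.
- by rewrite xi yi eqxx in nxy.
- move=> _ ys; rewrite ltn_addr // size_map.
  by rewrite -(size_map (Tagged T)) index_mem mT xi.
- move=> xs _; rewrite ltn0 ltnNge ltnW //.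
  by rewrite ltn_addr // index_mem mT yi.
- by move=> xs ys; rewrite ltn_add2l ltnS IH.
Qed.

Lemma rank_tagged (I : finType) (T : I -> finType) i (x y : T i) :
  (rank (Tagged T x) < rank (Tagged T y)) = (rank x < rank y).
Proof.
rewrite /rank [enum {: {i & T i}}]enumT unlock /= /tag_enum -enumT.
have : i \in enum I by rewrite mem_enum.
elim: (enum I) => //= j s IH; rewrite !index_cat -!enumT.
have mT (z : {i & T i}) : (z \in [seq Tagged T x0 | x0 <- enum (T j)]) = (tag z == j).
  apply/mapP/eqP => [[t _ ->] //|E]; case: z E => k t /= E.
  by subst k; exists t; rewrite ?mem_enum.
rewrite inE !mT /=; have [E _|_ /=] := eqVneq i j; last first.
  by rewrite ltn_add2l.
subst j; rewrite !index_map //.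
  by move=> a b; apply: eq_from_Tagged.
by move=> a b; apply: eq_from_Tagged.
Qed.

(** * Parities of sets of pairs *)

(* For a symmetric D this is a parity of a set of unordered pairs, hence
   independent of the ordering used to represent each pair (pairpar_base). *)
Definition pairpar (T : finType) (D : rel T) : bool :=
  \big[addb/false]_(p : T * T | rank p.1 < rank p.2) D p.1 p.2.

Lemma eq_pairpar (T : finType) (D D' : rel T) : D =2 D' -> pairpar D = pairpar D'.
Proof. by move=> E; apply: eq_bigr => p _; apply: E. Qed.

Lemma eq_pairpar_neq (T : finType) (D D' : rel T) :
  (forall u v, u != v -> D u v = D' u v) -> pairpar D = pairpar D'.
Proof.
move=> E; apply: eq_bigr => p lt; apply: E.
by apply: contraTneq lt => ->; rewrite ltnn.
Qed.

Lemma pairpar0 (T : finType) : pairpar (fun _ _ : T => false) = false.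
Proof. by rewrite /pairpar big1. Qed.

Lemma pairparD (T : finType) (D D' : rel T) :
  pairpar (fun u v => D u v (+) D' u v) = pairpar D (+) pairpar D'.
Proof. exact: big_split. Qed.

Lemma pairpar_sum (T I : finType) (P : pred I) (D : I -> rel T) :
  pairpar (fun u v => \big[addb/false]_(i | P i) D i u v) =
  \big[addb/false]_(i | P i) pairpar (D i).
Proof. exact: exchange_big. Qed.

Lemma inj_ltnC (T : eqType) (r : T -> nat) (u v : T) :
  injective r -> u != v -> (r v < r u) = ~~ (r u < r v).
Proof. by move=> ri uv; rewrite -leqNgt [RHS]leq_eqVlt (inj_eq ri) eq_sym (negPf uv). Qed.

Lemma pairpar_base (T : finType) (D : rel T) (r : T -> nat) :
  symmetric D -> injective r ->
  pairpar D = \big[addb/false]_(p : T * T | r p.1 < r p.2) D p.1 p.2.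
Proof.
move=> symD injr; rewrite /pairpar.
rewrite (bigID (fun p : T * T => r p.1 < r p.2)).
rewrite [RHS](bigID (fun p : T * T => rank p.1 < rank p.2)) /=.
congr addb; first by apply: eq_bigl => p; rewrite andbC.
(* Pairs on which the two orderings agree are common to both sums; the others correspond by the
   swap, which [D] does not see. *)
pose s (p : T * T) := (p.2, p.1).
rewrite (reindex_inj (h := s)) /=; last by move=> [a b] [c d] [-> ->].
apply: eq_big => [[a b]|[a b] _] /=; last exact: symD.
have [->|ab] := eqVneq a b; first by rewrite !ltnn.
rewrite (inj_ltnC injr ab) (inj_ltnC (@rank_inj T) ab).
by rewrite !negbK andbC.
Qed.

(** Order [T] by the ranks of the images. Pairs of [T] are then the pairs inside the image of [f],
    and the support hypothesis discards all others. *)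
Lemma pairpar_image (T T' : finType) (f : T -> T') (D : rel T') :
  injective f -> symmetric D ->
  (forall u v, D u v -> (u \in codom f) && (v \in codom f)) ->
  pairpar D = pairpar (fun u v => D (f u) (f v)).
Proof.
move=> injf symD supp.
rewrite (@pairpar_base T _ (fun u => rank (f u))); last 2 first.
- by move=> u v; apply: symD.
- by move=> u v /rank_inj/injf.
pose g (p : T * T) := (f p.1, f p.2).
have injg : injective g by move=> [a b] [c d] [/injf-> /injf->].
pose A := [set p : T * T | rank (f p.1) < rank (f p.2)].
transitivity (\big[addb/false]_(p in g @: A) D p.1 p.2); last first.
  rewrite big_imset /=; last by move=> p p' _ _; apply: injg.
  by apply: eq_bigl => p; rewrite inE.
rewrite /pairpar big_mkcond [RHS]big_mkcond; apply: eq_bigr => -[u v] _ /=.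
case: imsetP => [[[a b]] | no]; first by rewrite inE => /= ab [-> ->]; rewrite ab.
case: ifP => // lt; apply/negbTE/negP => /supp/andP[/codomP[a Ea] /codomP[b Eb]].
by apply: no; exists (a, b); rewrite ?inE /g /= -?Ea -?Eb.
Qed.

Lemma pairpar_bij (T T' : finType) (f : T -> T') (D : rel T') :
  bijective f -> symmetric D -> pairpar D = pairpar (fun u v => D (f u) (f v)).
Proof.
move=> bijf symD; apply: pairpar_image => //; first exact: bij_inj.
by move=> u v _; case: bijf => g gK fK; rewrite -(fK u) -(fK v) !codom_f.
Qed.

Lemma pairpar_sub (T : finType) (P : pred T) (D : rel T) : symmetric D ->
  pairpar (fun u v => [&& P u, P v & D u v]) =
  pairpar (fun u v : {x | P x} => D (val u) (val v)).
Proof.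
move=> symD; rewrite (@pairpar_image _ _ (fun u : {x | P x} => val u)).
- by apply: eq_pairpar => u v /=; rewrite (valP u) (valP v).
- exact: val_inj.
- by move=> u v; rewrite symD andbCA.
- move=> u v /and3P[Pu Pv _]; apply/andP.
  by split; apply/codomP; [exists (exist _ u Pu) | exists (exist _ v Pv)].
Qed.

Lemma pairpar_split1 (T : finType) (D : rel T) (x : T) : symmetric D ->
  pairpar D = \big[addb/false]_(u | u != x) D x u (+)
              pairpar (fun u v => [&& u != x, v != x & D u v]).
Proof.
(* An ordering with [x] in front, so that every pair containing [x] is represented as [(x, u)]. *)
move=> symD; pose r u := if u == x then 0 else (rank u).+1.
have injr : injective r.
  by move=> u v; rewrite /r; case: eqP => [->|_]; case: eqP => [->|_] // [/rank_inj].
rewrite (pairpar_base symD injr) (pairpar_base _ injr); last first.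
  by move=> u v; rewrite symD andbCA.
rewrite (bigID (fun p : T * T => p.1 == x)) /=; congr addb.
  pose h u : T * T := (x, u).
  rewrite (reindex_onto h snd); last by case=> a b /= /andP[_ /eqP->].
  apply: eq_bigl => u; rewrite /h /= !eqxx !andbT /r eqxx.
  by case: (u == x).
rewrite [RHS](bigID (fun p : T * T => p.1 == x)) /= [X in addb X _]big1 ?addFb.
  apply: eq_bigr => -[a b] /= /andP[lt ax]; rewrite ax /=; case: eqP => // bx.
  by move: lt; rewrite bx /r eqxx.
by case=> a b /= /andP[_ ->].
Qed.

(** Made for contractions: [x] and [y] are the ends of the contracted edge, and the subtype is the
    one in [con_vert]. *)
Lemma pairpar_split2 (T : finType) (D : rel T) (x y : T) :
  symmetric D -> x != y ->
  pairpar D = D x y (+) \big[addb/false]_(u | (u != x) && (u != y)) (D x u (+) D y u)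
    (+) pairpar (fun u v : {w | (w != x) && (w != y)} => D (val u) (val v)).
Proof.
move=> symD xy; rewrite (pairpar_split1 x symD).
rewrite (bigD1 y) 1?eq_sym //= -!addbA; congr addb.
rewrite (pairpar_split1 y); last by move=> u v; rewrite symD andbCA.
rewrite big_split /= -addbA; congr addb; rewrite eq_sym xy /=.
congr addb.
  rewrite big_mkcond [RHS]big_mkcond; apply: eq_bigr => u _.
  by case: (u == x); case: (u == y).
rewrite -(pairpar_sub (fun w => (w != x) && (w != y)) symD).
apply: eq_pairpar => u v.
by case: (u == x); case: (u == y); case: (v == x); case: (v == y).
Qed.

Lemma pairpar_color (T I : finType) (c : T -> I) (D : rel T) : symmetric D ->
  pairpar D = pairpar (fun u v => (c u != c v) && D u v) (+)
    \big[addb/false]_i pairpar (fun u v : {w | c w == i} => D (val u) (val v)).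
Proof.
move=> symD.
rewrite (eq_bigr (fun i => pairpar (fun u v => [&& c u == i, c v == i & D u v]))).
  rewrite -(pairpar_sum xpredT (fun i u v => [&& c u == i, c v == i & D u v])) -pairparD;
    apply: eq_pairpar => u v.
  rewrite (bigD1 (c u)) //= eqxx big1 /= => [|i ni]; last by rewrite eq_sym (negPf ni).
  by rewrite addbF (eq_sym (c v)); case: (c u == c v) => /=; case: (D u v).
by move=> i _; rewrite pairpar_sub.
Qed.

(** * Disagreement of two orderings *)

Definition dis (T : eqType) (r s : T -> nat) (u v : T) : bool :=
  (r u < r v) (+) (s u < s v).

Lemma dis_sym (T : eqType) (r s : T -> nat) :
  injective r -> injective s -> symmetric (dis r s).
Proof.
move=> ri si u v; have [->//|uv] := eqVneq u v.
by rewrite /dis (inj_ltnC ri uv) (inj_ltnC si uv) addbN addNb negbK.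
Qed.

(** The parity of the number of inversions of [f]. It agrees with the signature for permutations
    ([ordpar_perm]), but makes sense for injections between different types. *)
Definition ordpar (T T' : finType) (f : T -> T') : bool :=
  pairpar (dis (@rank T) (@rank T' \o f)).

(** Disagreement is a cocycle: two orderings disagree on a pair exactly when one, not both, of them
    disagrees with a third ordering. *)
Lemma ordpar_comp (T T' T'' : finType) (f : T -> T') (g : T' -> T'') :
  bijective f -> injective g -> ordpar (g \o f) = ordpar f (+) ordpar g.
Proof.
move=> bf gi; rewrite /ordpar [pairpar (dis (@rank T') _)](pairpar_bij bf); last first.
  by apply: dis_sym; [exact: rank_inj | exact: inj_comp (@rank_inj _) gi].
rewrite -pairparD; apply: eq_pairpar => u v; rewrite /dis /=.
by rewrite -addbA addKb.
Qed.

Lemma ordpar_mono (T T' : finType) (f : T -> T') :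
  {mono f : u v / rank u < rank v} -> ordpar f = false.
Proof.
move=> mf; rewrite -(pairpar0 T); apply: eq_pairpar => u v.
by rewrite /dis /= mf addbb.
Qed.

(** The pair of [x] and [y] is inverted; for any third [u], the pairs with [x] and with [y]
    contribute the same and cancel; all other pairs are fixed. *)
Lemma ordpar_tperm n (x y : 'I_n) : ordpar (tperm x y) = (x != y).
Proof.
have [->|xy] := eqVneq x y.
  by rewrite ordpar_mono // => u v; rewrite tperm1 !perm1.
have symD : symmetric (dis (@rank 'I_n) (@rank 'I_n \o tperm x y)).
  by apply: dis_sym; [exact: rank_inj | exact: inj_comp (@rank_inj _) perm_inj].
rewrite /ordpar (pairpar_split2 symD xy).
rewrite (@eq_pairpar_neq _ _ (fun _ _ => false)) ?pairpar0 => [|u v _]; last first.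
  case: u v => [u /= /andP[ux uy]] [v /= /andP[vx vy]]; rewrite /dis /=.
  by rewrite !tpermD 1?eq_sym // addbb.
rewrite addbF big1 => [|u /andP[ux uy]].
  by rewrite /dis /= tpermL tpermR addbF (inj_ltnC (@rank_inj _) xy) addbN addbb.
rewrite /dis /= tpermL tpermR tpermD 1?eq_sym //.
by case: (rank x < _); case: (rank y < _).
Qed.

Lemma ordpar_perm n (s : 'S_n) : ordpar s = odd_perm s.
Proof.
have [ts -> dts] := prod_tpermP s; elim: ts dts => [|t ts IH] /=.
  by rewrite big_nil odd_perm1 ordpar_mono // => u v; rewrite !perm1.
case/andP=> dt dts; rewrite big_cons odd_permM -IH // odd_tperm.
rewrite -ordpar_tperm -ordpar_comp; [|exact: injF_bij perm_inj|exact: perm_inj].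
by apply: eq_pairpar => u v; rewrite /dis /= !permM.
Qed.

Local Open Scope ring_scope.

(* [all_algebra] also exports an [opp], that of fractions. *)
Local Notation opp := Defs.opp.

(** * Embeddings of decorated graphs *)

Section Embeddings.
Variables (F : fieldType) (O : cyclicOperad F) (V : vectType F).

(* An embedding of the underlying disjoint unions of decorated corollas. *)
Record cemb W L W' L' (X : dgraph O V W L) (Y : dgraph O V W' L') := Cemb {
  eW : W -> W';
  eS : forall w, 'I_(ar X w) -> 'I_(ar Y (eW w));
  eW_inj : injective eW;
  eS_bij : forall w, bijective (@eS w);
  eS_deco : forall w, deco Y (eW w) = oact O (@eS w) (deco X w) }.

Definition eslot W L W' L' (X : dgraph O V W L) (Y : dgraph O V W' L')
    (f : cemb X Y) (h : slot X) : slot Y :=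
  existT (fun w => 'I_(ar Y w)) (eW f (tag h)) (eS f (tagged h)).

(** Vertex orders and edge directions need not match; the discrepancy is measured by [sgn].
    Compatibility with [opp] forces the image to be a union of components, and the surjective
    embeddings are the isomorphisms. *)
Record emb W L W' L' (X : dgraph O V W L) (Y : dgraph O V W' L') := Emb {
  ec :> cemb X Y;
  eL : L -> L';
  eL_inj : injective eL;
  e_opp : forall z, opp (sum_map (eslot ec) eL z) = sum_map (eslot ec) eL (opp z);
  e_lab : forall l, lab Y (eL l) = lab X l }.

Definition surj_emb W L W' L' (X : dgraph O V W L) (Y : dgraph O V W' L')
    (f : emb X Y) : Prop :=
  (forall w', exists w, eW f w = w') /\ (forall l', exists l, eL f l = l').

Lemma slotP W L (X : dgraph O V W L) w (a b : 'I_(ar X w)) :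
  existT (fun w => 'I_(ar X w)) w a = existT _ w b -> a = b.
Proof. exact: eq_from_Tagged. Qed.

Section Slots.
Variables (W L W' L' : finType) (X : dgraph O V W L) (Y : dgraph O V W' L').

Lemma eslot_inj (f : cemb X Y) : injective (eslot f).
Proof.
move=> [w a] [v b] E.
have wv : w = v by apply: (@eW_inj _ _ _ _ _ _ f); exact: (congr1 tag E).
subst v; congr existT; apply: (bij_inj (eS_bij f w)); exact: slotP E.
Qed.

Lemma eslot_surj (f : cemb X Y) h' :
  (exists w, eW f w = tag h') -> exists h, eslot f h = h'.
Proof.
case: h' => w' a' [w /= E]; case: w' / E a' => a'.
by have [g _ gK] := eS_bij f w; exists (existT _ w (g a')); rewrite /eslot /= gK.
Qed.

(** Equations between slots of a whole graph avoid dependent types, so a slot map is easier to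
    produce than a family of bijections over the vertices. The family is recovered by choice, its
    bijectivity by counting. *)
Lemma cemb_of_slots (fW : W -> W') (phi : slot X -> slot Y) :
  injective fW -> injective phi -> (forall h, tag (phi h) = fW (tag h)) ->
  (forall h' w, fW w = tag h' -> exists h, phi h = h') ->
  (forall w (g : 'I_(ar X w) -> 'I_(ar Y (fW w))), bijective g ->
     (forall a, phi (existT _ w a) = existT (fun w => 'I_(ar Y w)) (fW w) (g a)) ->
     deco Y (fW w) = oact O g (deco X w)) ->
  exists f : cemb X Y, (forall w, eW f w = fW w) /\ (forall h, eslot f h = phi h).
Proof.
move=> fWi phii phit phis phid.
have ex w a : exists b, phi (existT _ w a) = existT (fun w => 'I_(ar Y w)) (fW w) b.
  by case E: (phi _) (phit (existT _ w a)) => [w' b] /= E'; subst w'; exists b.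
pose s w a := projT1 (cid (ex w a)).
have gP w a : phi (existT _ w a) = existT (fun w => 'I_(ar Y w)) (fW w) (s w a).
  exact: projT2 (cid (ex w a)).
have sb w : bijective (s w).
  have si : injective (s w).
    by move=> a b E; apply: slotP; apply: phii; rewrite !gP; congr existT.
  apply: inj_card_bij => //; rewrite -(card_image si) subset_leq_card //.
  apply/subsetP => b _; have [[w' a] E] := phis (existT _ (fW w) b) w erefl.
  have ww : w' = w by apply: fWi; rewrite -[fW w'](phit (existT _ w' a)) E.
  subst w'; apply/imageP; exists a => //; apply: slotP.
  by rewrite -E gP.
exists (@Cemb _ _ _ _ X Y fW s fWi sb (fun w => phid w (s w) (sb w) (gP w))).
by split=> // -[w a]; rewrite gP.
Qed.

End Slots.

Lemma oact_inj s t (f : 'I_s -> 'I_t) : bijective f -> injective (oact O f).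
Proof.
move=> bf x y; have [g fK gK] := bf.
have gf z : oact O g (oact O f z) = z.
  rewrite -oact_comp //; last by exists f.
  by rewrite (_ : g \o f = id) ?oact_id //; apply/funext.
by move/(congr1 (oact O g)); rewrite !gf.
Qed.

Section Lifting.
Variables (WA LA WB LB W L : finType).
Variables (A : dgraph O V WA LA) (B : dgraph O V WB LB) (Z : dgraph O V W L).

(** An embedding whose image lies in that of [be] factors through [be], by injectivity. The
    decorations match because the action of a bijection on the operad is injective and can be
    cancelled. *)
Lemma cemb_lift (al : cemb A Z) (be : cemb B Z) :
  (forall w, exists w', eW be w' = eW al w) ->
  exists ga : cemb A B, (forall w, eW be (eW ga w) = eW al w) /\
    forall h, eslot be (eslot ga h) = eslot al h.
Proof.
move=> /choice[fW fWP].
have /choice[phi phiP] : forall h, exists h', eslot be h' = eslot al h.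
  by move=> h; apply: eslot_surj; exists (fW (tag h)); rewrite fWP.
have phit h : tag (phi h) = fW (tag h).
  by apply: (@eW_inj _ _ _ _ _ _ be); rewrite fWP; exact: (congr1 tag (phiP h)).
have phii : injective phi.
  by move=> h h' E; apply: (@eslot_inj _ _ _ _ _ _ al); rewrite -!phiP E.
case: (@cemb_of_slots _ _ _ _ A B fW phi) => //.
- by move=> u v E; apply: (@eW_inj _ _ _ _ _ _ al); rewrite -!fWP E.
- move=> h' w E; have [h hE] : exists h, eslot al h = eslot be h'.
    by apply: eslot_surj; exists w; rewrite -fWP E.
  by exists h; apply: (@eslot_inj _ _ _ _ _ _ be); rewrite phiP.
- move=> w g gb gP.
  have E a : eslot be (existT _ (fW w) (g a)) = eslot al (existT _ w a).
    by rewrite -gP phiP.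
  have dA := eS_deco al w; have dB := eS_deco be (fW w).
  rewrite /eslot /= in E.
  move: (fWP w) (eS be (w := fW w)) (eS_bij be (fW w)) E dB.
  move: (eW be (fW w)) => z zE; subst z => s sb E dB.
  have {E} sE a : s (g a) = eS al a by exact: slotP (E a).
  have {sE} sE : eS al (w := w) = s \o g by apply/funext => a; rewrite /= sE.
  by move: dA; rewrite dB sE oact_comp // => /(oact_inj sb).
- by move=> ga [gaW gaS]; exists ga; split=> *; rewrite (gaW, gaS).
Qed.

Lemma emb_lift (al : emb A Z) (be : emb B Z) :
  (forall w, exists w', eW be w' = eW al w) ->
  (forall l, exists l', eL be l' = eL al l) ->
  exists ga : emb A B, [/\ forall w, eW be (eW ga w) = eW al w,
    forall h, eslot be (eslot ga h) = eslot al h &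
    forall l, eL be (eL ga l) = eL al l].
Proof.
move=> hW /choice[fL fLP]; have [ga [gaW gaS]] := cemb_lift hW.
have zi : injective (sum_map (eslot be) (eL be)).
  move=> [a|a] [b|b] //= E; congr (_ _).
    exact: eslot_inj (inl_inj E).
  exact: eL_inj (inr_inj E).
have zE z : sum_map (eslot be) (eL be) (sum_map (eslot ga) fL z)
          = sum_map (eslot al) (eL al) z.
  by case: z => [h|l] /=; rewrite ?gaS ?fLP.
have fLi : injective fL.
  by move=> l l' E; apply: (@eL_inj _ _ _ _ _ _ al); rewrite -!fLP E.
have gopp z : opp (sum_map (eslot ga) fL z) = sum_map (eslot ga) fL (opp z).
  by apply: zi; rewrite -e_opp !zE e_opp.
have glab l : lab B (fL l) = lab A l by rewrite -(e_lab be) fLP e_lab.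
by exists (Emb fLi gopp glab).
Qed.

End Lifting.

Section Composition.
Variables (WA LA WB LB W L : finType).
Variables (A : dgraph O V WA LA) (B : dgraph O V WB LB) (Z : dgraph O V W L).

Definition cemb_id : cemb A A :=
  @Cemb _ _ _ _ A A id (fun _ => id) (@inj_id _)
    (fun w => @Bijective _ _ id id (frefl _) (frefl _))
    (fun w => esym (oact_id _)).

Lemma sum_map_cemb_id (z : slot A + LA) : sum_map (eslot cemb_id) id z = z.
Proof. by case: z => [[w a]|l]. Qed.

Lemma emb_id_opp (z : slot A + LA) : opp (sum_map (eslot cemb_id) id z) =
  sum_map (eslot cemb_id) id (opp z).
Proof. by rewrite !sum_map_cemb_id. Qed.

Definition emb_id : emb A A := @Emb _ _ _ _ A A cemb_id id (@inj_id _) emb_id_opp (fun=> erefl).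

Definition cemb_comp (f : cemb A B) (g : cemb B Z) : cemb A Z.
Proof.
exists (eW g \o eW f) (fun w => eS g (w := eW f w) \o eS f (w := w)).
- exact: inj_comp (eW_inj (c := g)) (eW_inj (c := f)).
- by move=> w; apply: bij_comp (eS_bij g _) (eS_bij f _).
- by move=> w; rewrite /= !eS_deco (oact_comp _ (eS_bij f w) (eS_bij g _)).
Defined.

Lemma eslot_comp f g h : eslot (cemb_comp f g) h = eslot g (eslot f h).
Proof. by []. Qed.

Definition emb_comp (f : emb A B) (g : emb B Z) : emb A Z.
Proof.
exists (cemb_comp f g) (eL g \o eL f).
- exact: inj_comp (@eL_inj _ _ _ _ _ _ g) (@eL_inj _ _ _ _ _ _ f).
- move=> z; rewrite (_ : sum_map _ _ z =
    sum_map (eslot g) (eL g) (sum_map (eslot f) (eL f) z)); last by case: z.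
  by rewrite !e_opp; case: (opp z).
- by move=> l; rewrite /= !e_lab.
Defined.

Lemma surj_emb_comp f g : surj_emb f -> surj_emb g -> surj_emb (emb_comp f g).
Proof.
move=> [fW fL] [gW gL]; split=> [w|l].
  by have [v <-] := gW w; have [u <-] := fW v; exists u.
by have [v <-] := gL l; have [u <-] := fL v; exists u.
Qed.

End Composition.

Lemma emb_inv W L W' L' (X : dgraph O V W L) (Y : dgraph O V W' L') (f : emb X Y) :
  surj_emb f -> exists g : emb Y X, [/\ surj_emb g, cancel (eW f) (eW g),
    cancel (eW g) (eW f), cancel (eslot g) (eslot f) & cancel (eL g) (eL f)].
Proof.
move=> [sW sL]; have [g [gW gS gL]] := emb_lift (al := emb_id Y) (be := f) sW sL.
have gK : cancel (eW f) (eW g) by move=> w; apply: (@eW_inj _ _ _ _ _ _ f); rewrite gW.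
exists g; split=> //.
- split=> [w|l]; first by exists (eW f w).
  by exists (eL f l); apply: (@eL_inj _ _ _ _ _ _ f); rewrite gL.
- by case=> w a; rewrite gS.
Qed.

Lemma surj_emb_bij W L W' L' (X : dgraph O V W L) (Y : dgraph O V W' L') (f : emb X Y) :
  surj_emb f -> bijective (eW f).
Proof. by case/emb_inv => g [_ fK gK _ _]; exists (eW g). Qed.

(** * Signs of embeddings *)

Definition isint W L (G : graph W L) (h : slot G) : bool :=
  if opp (inl h) is inl _ then true else false.

(** The slot of a hair is sent to itself, so that this is an involution of all slots and can reindex
    sums. *)
Definition oph W L (G : graph W L) (h : slot G) : slot G :=
  if opp (inl h) is inl h' then h' else h.

Lemma ophK W L (G : graph W L) : involutive (@oph W L G).
Proof.
move=> h; rewrite /oph; case E: (opp (inl h)) => [h'|l]; last by rewrite E.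
by rewrite -E oppK.
Qed.

Lemma opp_oph W L (G : graph W L) (h : slot G) :
  isint h -> opp (inl h) = inl (oph h).
Proof. by rewrite /isint /oph; case: (opp _). Qed.

Lemma isint_oph W L (G : graph W L) (h : slot G) : isint (oph h) = isint h.
Proof.
rewrite /isint /oph; case E: (opp (inl h)) => [h'|l]; last by rewrite E.
by rewrite -E oppK.
Qed.

Lemma dir_oph W L (G : graph W L) (h : slot G) :
  isint h -> dir (oph h) = ~~ dir h.
Proof. by move=> /opp_oph/dir_opp. Qed.

(** The analogue of [pairpar_base] for edges: a quantity that agrees on both halves of an edge may
    be summed over either half, so the directions of [G] can be replaced by any others. *)
Lemma edgepar_base W L (G : graph W L) (d : slot G -> bool) (D : slot G -> bool) :
  (forall h, isint h -> d (oph h) = ~~ d h) ->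
  (forall h, isint h -> D (oph h) = D h) ->
  \big[addb/false]_(h : slot G | isint h && dir h) D h =
  \big[addb/false]_(h : slot G | isint h && d h) D h.
Proof.
move=> dP DP; rewrite (bigID d) [RHS](bigID (@dir _ _ G)) /=; congr addb.
  by apply: eq_bigl => h; rewrite andbAC.
rewrite (reindex_inj (inv_inj (@ophK W L G))); apply: eq_big => h; rewrite isint_oph.
  have [hi|//] := boolP (isint h) => /=; by rewrite dir_oph // dP // negbK andbC.
by move=> /andP[/andP[hi _] _]; rewrite DP.
Qed.

Section Sign.
Variables (W L W' L' : finType) (X : dgraph O V W L) (Y : dgraph O V W' L').
Implicit Type f : emb X Y.

Lemma isint_emb f h : isint (eslot f h) = isint h.
Proof.
have /= := e_opp f (inl h); rewrite /isint => ->.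
by case: (opp _).
Qed.

Lemma oph_emb f h : isint h -> oph (eslot f h) = eslot f (oph h).
Proof.
move=> hi; apply: (@inl_inj _ L'); rewrite -opp_oph ?isint_emb //.
by have /= -> := e_opp f (inl h); rewrite opp_oph.
Qed.

Definition dirpar f : bool :=
  \big[addb/false]_(h : slot X | isint h && dir h) ~~ dir (eslot f h).

Definition sgn f : bool := ordpar (eW f) (+) dirpar f.

Lemma dirparE f :
  dirpar f = \big[addb/false]_(h : slot X | isint h && dir h) (dir h (+) dir (eslot f h)).
Proof. by apply: eq_bigr => h /andP[_ ->]. Qed.

Definition mono_emb f : Prop :=
  {mono eW f : u v / (rank u < rank v)%N} /\
  forall h, isint h -> dir (eslot f h) = dir h.

Lemma mono_sgn f : mono_emb f -> sgn f = false.
Proof.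
case=> m d; rewrite /sgn ordpar_mono // dirparE big1 // => h /andP[hi _].
by rewrite d // addbb.
Qed.

End Sign.

(** By surjectivity of [f] the edges of [Y] are reindexed by those of [X], where they carry the
    directions of their images; [edgepar_base] returns to the directions of [X]. *)
Lemma sgn_comp W L W' L' W'' L'' (X : dgraph O V W L) (Y : dgraph O V W' L')
    (Z : dgraph O V W'' L'') (f : emb X Y) (g : emb Y Z) :
  surj_emb f -> sgn (emb_comp f g) = sgn f (+) sgn g.
Proof.
move=> sf; rewrite /sgn /= ordpar_comp; [|exact: surj_emb_bij|exact: eW_inj].
rewrite addbACA; congr addb; rewrite dirparE (dirparE f) (dirparE g).
have Dg (h : slot Y) : isint h ->
    dir (oph h) (+) dir (eslot g (oph h)) = dir h (+) dir (eslot g h).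
  by move=> hi; rewrite -oph_emb // !dir_oph ?isint_emb // addbN addNb negbK.
have [f' [_ fK f'K f'S _]] := emb_inv sf.
have f'S' : cancel (eslot f) (eslot f').
  by move=> h; apply: (@eslot_inj _ _ _ _ _ _ f); rewrite f'S.
rewrite [X in _ (+) X](_ : _ = \big[addb/false]_(h : slot X | isint h && dir (eslot f h))
    (dir (eslot f h) (+) dir (eslot g (eslot f h)))); last first.
  rewrite (reindex (eslot f)); last by exists (eslot f') => h _.
  by apply: eq_bigl => h; rewrite isint_emb.
rewrite -(@edgepar_base _ _ X (fun h => dir (eslot f h))).
- rewrite -big_split; apply: eq_bigr => h _ /=.
  by rewrite -addbA addKb.
- by move=> h hi; rewrite -oph_emb // dir_oph ?isint_emb.
- by move=> h hi; rewrite -oph_emb // Dg ?isint_emb.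
Qed.

End Embeddings.

(** * Linear extension *)

Section Lift.
Variables (F : fieldType) (K : choiceType).

Lemma freegU_scale (a k : F) (x : K) : a *: << k *g x >> = << (a * k) *g x >>.
Proof.
by apply/eqP/freeg_eqP => y; rewrite coeff_fgscale !coeffU mulrA.
Qed.

Variables (M : lmodType F) (f : K -> M).

Lemma fgliftD : {morph (fglift f : {freeg K / F} -> M) : x y / x + y}.
Proof.
move=> x y; have B := lift_is_additive f.
have f0 : fglift f 0 = 0 :> M by rewrite -[in LHS](subrr 0) B subrr.
have fN z : fglift f (- z) = - fglift f z by rewrite -[- z]sub0r B f0 sub0r.
by rewrite -[in LHS](opprK y) B fN opprK.
Qed.

Lemma fglift_linear : linear (fglift f : {freeg K / F} -> M).
Proof.
move=> a x y; rewrite fgliftD; congr (_ + _).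
have f0 : fglift f 0 = 0 :> M.
  by apply: (addrI (fglift f 0)); rewrite -fgliftD !addr0.
elim/freeg_ind_dom0: x => [|k x z _ _ IH]; first by rewrite scaler0 f0 scaler0.
by rewrite scalerDr !fgliftD scalerDr IH freegU_scale !liftU scalerA.
Qed.

HB.instance Definition _ :=
  GRing.isLinear.Build F {freeg K / F} M *:%R (fglift f) fglift_linear.

Lemma fgliftU x : fglift f << x >> = f x.
Proof. by rewrite liftU scale1r. Qed.

End Lift.

Section Span.
Variables (F : fieldType) (M N : lmodType F).

Lemma in_lspan (G : M -> Prop) x : G x -> x \in lspan G.
Proof.
move=> Gx; rewrite -[x]addr0 -[x]scale1r; apply/asboolP.
by apply: in_spanP => //; apply: in_span0.
Qed.

Lemma lspan_ind (G : M -> Prop) (S : {linear M -> N}) (T : linsub N) :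
  (forall x, G x -> S x \in T) -> forall x, x \in lspan G -> S x \in T.
Proof.
move=> GT x /asboolP; elim=> [|c u v Gu _ IH]; first by rewrite linear0 rpred0.
by rewrite linearP rpredD // rpredZ // GT.
Qed.

Lemma lspan_eq0 (G : M -> Prop) (S : {linear M -> N}) :
  (forall x, G x -> S x = 0) -> forall x, x \in lspan G -> S x = 0.
Proof.
move=> GT x /asboolP; elim=> [|c u v Gu _ IH]; first by rewrite linear0.
by rewrite linearP GT // IH scaler0 addr0.
Qed.

(** Defined for every [f] through a chosen representative; it is the induced map when [f] is linear
    and vanishes on [S]. *)
Definition qlift (S : linsub M) (f : M -> N) (x : quotspace S) : N := f (repr x).

Lemma qliftE (S : linsub M) (f : {linear M -> N}) :
  (forall x, x \in S -> f x = 0) -> forall x, qlift f (qproj S x) = f x.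
Proof.
move=> fS x; apply/eqP; rewrite -subr_eq0 -linearB; apply/eqP/fS.
by rewrite -qproj_eq qprojK.
Qed.

Lemma qlift_linear (S : linsub M) (f : {linear M -> N}) :
  (forall x, x \in S -> f x = 0) -> linear (qlift f : quotspace S -> N).
Proof.
move=> fS a x y; rewrite -(qprojK x) -(qprojK y) -linearP !qliftE //.
exact: linearP.
Qed.

Lemma qproj_eq0 (S : linsub M) x : (qproj S x == 0) = (x \in S).
Proof. by rewrite -(linear0 (qproj S)) qproj_eq subr0. Qed.

End Span.

Section Induced.
Variables (F : fieldType) (M : lmodType F) (S : linsub M).

Lemma qinducedE (f : {linear M -> M}) : descends S f ->
  forall x, qinduced f (qproj S x) = qproj S (f x).
Proof.
move=> fS x; apply/eqP; rewrite qproj_eq -linearB; apply: fS.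
by rewrite -qproj_eq qprojK.
Qed.

Lemma qinduced_linear (f : {linear M -> M}) : descends S f ->
  linear (qinduced f : quotspace S -> quotspace S).
Proof.
move=> fS a x y; rewrite -(qprojK x) -(qprojK y) -linearP !qinducedE //.
by rewrite !linearP.
Qed.

End Induced.

(** Reindexing along a bijection given only as a relation, such as two edges corresponding under an
    embedding, so that no inverse has to be written down. *)
Lemma sum_rel (I J : finType) (M : nmodType) (R : I -> J -> Prop) (P : I -> M) (Q : J -> M) :
  (forall i, exists j, R i j) -> (forall j, exists i, R i j) ->
  (forall i j j', R i j -> R i j' -> j = j') ->
  (forall i i' j, R i j -> R i' j -> i = i') ->
  (forall i j, R i j -> P i = Q j) ->
  (\sum_i P i = \sum_j Q j)%R.
Proof.
move=> /choice[f fP] /choice[g gP] Rf Ri PQ.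
rewrite (reindex f) /=; first by apply: eq_bigr => i _; apply: PQ.
by exists g => i _; [apply: Ri (fP _) | apply: Rf (fP _) _].
Qed.

Lemma sum_rel_dep (I K : finType) (J : I -> finType) (A : K -> finType)
    (B : forall k, A k -> finType) (M : nmodType)
    (R : forall i, J i -> forall k (a : A k), B k a -> Prop)
    (P : forall i, J i -> M) (Q : forall k (a : A k), B k a -> M) :
  (forall i j, exists k a b, R i j k a b) -> (forall k a b, exists i j, R i j k a b) ->
  (forall i j k a b k' a' b', R i j k a b -> R i j k' a' b' ->
    existT (fun k => {a : A k & B k a}) k (existT _ a b) = existT _ k' (existT _ a' b')) ->
  (forall i j i' j' k a b, R i j k a b -> R i' j' k a b ->
    existT (fun i => J i) i j = existT _ i' j') ->
  (forall i j k a b, R i j k a b -> P i j = Q k a b) ->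
  (\sum_i \sum_(j : J i) P i j = \sum_k \sum_(a : A k) \sum_(b : B k a) Q k a b)%R.
Proof.
move=> Rl Rr Rf Ri PQ.
under [RHS]eq_bigr do rewrite sig_big_dep.
rewrite [LHS]sig_big_dep [RHS]sig_big_dep /=.
apply: (@sum_rel _ _ _ (fun (x : {i : I & J i}) (y : {k : K & {a : A k & B k a}}) =>
  R (tag x) (tagged x) (tag y) (tag (tagged y)) (tagged (tagged y)))).
- by move=> [i j]; have [k [a [b H]]] := Rl i j; exists (existT _ k (existT _ a b)).
- by move=> [k [a b]]; have [i [j H]] := Rr k a b; exists (existT _ i j).
- by move=> [i j] [k [a b]] [k' [a' b']]; exact: Rf.
- by move=> [i j] [i' j'] [k [a b]]; exact: Ri.
- by move=> [i j] [k [a b]]; exact: PQ.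
Qed.

(** * Functions on graphs compatible with the relations *)

Section Respects.
Variables (F : fieldType) (O : cyclicOperad F) (V : vectType F).

Section Standard.
Variables (W L : finType) (X : dgraph O V W L).

Lemma std_cemb_bij (w : 'I_#|W|) : bijective (fun a : 'I_(ar (standard X) w) => a).
Proof. by exists id. Qed.

Definition std_cemb : cemb (standard X) X :=
  @Cemb _ _ _ _ _ _ _ (standard X) X (fun i => enum_val i) (fun _ a => a)
    (@enum_val_inj _ _) std_cemb_bij (fun w => esym (oact_id _)).

Lemma std_emb_opp (z : slot (standard X) + 'I_#|L|) :
  opp (sum_map (eslot std_cemb) (fun i => enum_val i) z) =
  sum_map (eslot std_cemb) (fun i => enum_val i) (opp z).
Proof. by apply/esym; apply: (@pull_oppE _ _ X _ _ _ (@std_slot _ _ X)); exact: std_opp. Qed.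

Definition std_emb : emb (standard X) X :=
  Emb (@enum_val_inj _ _) std_emb_opp (fun=> erefl).

Lemma surj_std : surj_emb std_emb.
Proof.
by split=> [w|l]; [exists (enum_rank w) | exists (enum_rank l)]; rewrite /= enum_rankK.
Qed.

Lemma mono_std : mono_emb std_emb.
Proof. by split=> [u v|//]; rewrite /= !rank_enum_val !rank_ord. Qed.

End Standard.

Lemma edge_big (R : Type) (idx : R) (op : Monoid.com_law idx) W L (G : graph W L)
    (D : slot G -> R) :
  \big[op/idx]_(e : iedge G) D (ini e) = \big[op/idx]_(h : slot G | isint h && dir h) D h.
Proof.
pose h' (h : slot G) : option (iedge G) := insub (h, oph h).
rewrite [RHS](reindex_omap (@ini _ _ G) h') => [|h /andP[hi hd]].
  apply: eq_bigl => e; apply/esym; have /andP[/eqP oe de] := valP e.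
  rewrite /isint [opp _]oe [dir _]de /= /h' /oph oe.
  by rewrite -surjective_pairing; apply/eqP; exact: valK.
by rewrite /h' insubT /= ?opp_oph ?eqxx.
Qed.

Lemma sgn_ext W L W' L' (X : dgraph O V W L) (Y : dgraph O V W' L') (f g : emb X Y) :
  eW f =1 eW g -> eslot f =1 eslot g -> sgn f = sgn g.
Proof.
move=> fgW fgS; rewrite /sgn /dirpar; congr addb; last first.
  by apply: eq_bigr => h _; rewrite fgS.
by apply: eq_pairpar => u v; rewrite /dis /= !fgW.
Qed.

Lemma lift_sgn W L W' L' W'' L'' (A : dgraph O V W L) (B : dgraph O V W' L')
    (Z : dgraph O V W'' L'') (al : emb A Z) (be : emb B Z) :
  surj_emb al -> surj_emb be ->
  exists ga : emb A B, surj_emb ga /\ sgn ga = sgn al (+) sgn be.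
Proof.
move=> [aW aL] [bW bL]; have [ga [gW gS gL]] := emb_lift (al := al) (be := be)
  (fun w => bW (eW al w)) (fun l => bL (eL al l)).
have sg : surj_emb ga.
  split=> [w|l].
    have [v E] := aW (eW be w); exists v.
    by apply: (@eW_inj _ _ _ _ _ _ _ _ _ be); rewrite gW.
  have [v E] := aL (eL be l); exists v.
  by apply: (@eL_inj _ _ _ _ _ _ _ _ _ be); rewrite gL.
exists ga; split=> //; rewrite (_ : sgn al = sgn (emb_comp ga be)).
  by rewrite sgn_comp // addbK.
congr addb; first by apply: eq_pairpar => u v; rewrite /dis /= !gW.
by apply: eq_bigr => h _; rewrite eslot_comp gS.
Qed.

Variable M : lmodType F.
Implicit Type f : hgraph O V -> M.

(** This contains the rule for opposite orientations, since a surjective embedding may permute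
    vertices and reverse edges at the price of [sgn]. *)
Definition natural f := forall (X Y : hgraph O V) (phi : emb X Y),
  surj_emb phi -> f X = (-1) ^+ sgn phi *: f Y.

(** Stated for labelings that agree away from [i] instead of [set_lab], because the labels of a cut
    or restricted graph are not literally of that form. *)
Definition lab_linear f := forall k l (G : graph 'I_k 'I_l) (d : forall w, O (ar G w))
    (i : 'I_l) a (b b1 b2 : 'I_l -> V),
  b i = a *: b1 i + b2 i -> (forall j, j != i -> b1 j = b j /\ b2 j = b j) ->
  f (HGraph (DGraph d b)) =
    a *: f (HGraph (DGraph d b1)) + f (HGraph (DGraph d b2)).

Definition deco_linear f := forall k l (G : graph 'I_k 'I_l) (b : 'I_l -> V)
    (i : 'I_k) a (d d1 d2 : forall w, O (ar G w)),
  d i = a *: d1 i + d2 i -> (forall j, j != i -> d1 j = d j /\ d2 j = d j) ->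
  f (HGraph (DGraph d b)) =
    a *: f (HGraph (DGraph d1 b)) + f (HGraph (DGraph d2 b)).

Record respects f : Prop := Respects {
  resp_nat : natural f; resp_lab : lab_linear f; resp_deco : deco_linear f }.

(** Extends naturality from graphs on ordinals to graphs on any finite types: standardizing costs no
    sign. *)
Lemma natural_std f W L W' L' (X : dgraph O V W L) (Y : dgraph O V W' L')
    (phi : emb X Y) : natural f -> surj_emb phi ->
  f (standard X) = (-1) ^+ sgn phi *: f (standard Y).
Proof.
move=> nf sphi.
have [ga [sg gE]] := lift_sgn (surj_emb_comp (@surj_std _ _ X) sphi) (@surj_std _ _ Y).
rewrite (nf _ _ _ sg) gE sgn_comp; last exact: surj_std.
by rewrite (mono_sgn (@mono_std _ _ X)) (mono_sgn (@mono_std _ _ Y)) addbF.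
Qed.

Lemma natural_hgr f (X : hgraph O V) : natural f -> f (standard X) = f X.
Proof.
move=> nf; rewrite (nf _ _ (std_emb X) (@surj_std _ _ X)).
by rewrite (mono_sgn (@mono_std _ _ X)) scale1r.
Qed.

Lemma standard_lab f W L (G : graph W L) (d : forall w, O (ar G w)) (i : L) a
    (b b1 b2 : L -> V) : lab_linear f ->
  b i = a *: b1 i + b2 i -> (forall j, j != i -> b1 j = b j /\ b2 j = b j) ->
  f (standard (DGraph d b)) =
    a *: f (standard (DGraph d b1)) + f (standard (DGraph d b2)).
Proof.
move=> lf bi bj; apply: (lf _ _ _ _ (enum_rank i)); first by rewrite enum_rankK.
by move=> j ji; apply: bj; apply: contraNneq ji => <-; rewrite enum_valK.
Qed.

Lemma standard_deco f W L (G : graph W L) (b : L -> V) (i : W) a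
    (d d1 d2 : forall w, O (ar G w)) : deco_linear f ->
  d i = a *: d1 i + d2 i -> (forall j, j != i -> d1 j = d j /\ d2 j = d j) ->
  f (standard (DGraph d b)) =
    a *: f (standard (DGraph d1 b)) + f (standard (DGraph d2 b)).
Proof.
move=> lf di dj; have di' v : v = i -> d v = a *: d1 v + d2 v by move->.
apply: (lf _ _ _ _ (enum_rank i)); first exact: di' (enum_rankK i).
by move=> j ji; apply: dj; apply: contraNneq ji => <-; rewrite enum_valK.
Qed.

Lemma iso_emb k l (X Y : dgraph O V 'I_k 'I_l) fW fL fS :
  @is_iso F O V k l X Y fW fL fS ->
  exists phi : emb X Y, [/\ surj_emb phi, eW phi =1 fW,
    forall h, eslot phi h = iso_slot fS h & iso_sign fS = (-1) ^+ sgn phi].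
Proof.
move=> [fSb fopp fdeco flab].
pose c := @Cemb _ _ _ _ _ _ _ X Y fW fS perm_inj fSb fdeco.
pose phi := @Emb _ _ _ _ _ _ _ X Y c fL perm_inj fopp flab.
exists phi; split=> //.
  by split=> w; [exists ((fW^-1)%g w)|exists ((fL^-1)%g w)]; rewrite /= permKV.
rewrite /iso_sign /sgn ordpar_perm exprD signr_addb; congr (_ * _).
rewrite -signr_odd; congr (_ ^+ nat_of_bool _).
rewrite /dirpar -(edge_big addb (fun h => ~~ dir (eslot phi h))) -sum1_card.
by rewrite (big_morph odd oddD erefl) big_mkcond; apply: eq_bigr => e _; rewrite /= inE; case: ifP.
Qed.

Lemma emb_iso k l (X Y : dgraph O V 'I_k 'I_l) (phi : emb X Y) :
  surj_emb phi -> exists fW fL fS,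
  @is_iso F O V k l X Y fW fL fS /\ iso_sign fS = (-1) ^+ sgn phi.
Proof.
move=> [sW sL]; case: phi sW sL => -[fW fS fWi fSb fd] fL fLi /= fo fl sW sL.
have [s sE] : exists s : 'S_k, fW = s.
  by exists (perm fWi); apply/funext => w; rewrite permE.
have [t tE] : exists s : 'S_l, fL = s.
  by exists (perm fLi); apply/funext => w; rewrite permE.
subst fW fL.
have I : @is_iso F O V k l X Y s t fS by split.
have [psi [_ pW pS E]] := iso_emb I.
exists s, t, fS; split=> //; rewrite E; congr (_ ^+ nat_of_bool _).
by apply: sgn_ext => [w|h]; rewrite ?pW ?pS.
Qed.

(** The three fields of [respects] correspond to the three kinds of generators in [hrel],
    isomorphisms being turned into embeddings by [iso_emb]. *)
Lemma respects_eq0 f : respects f ->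
  forall x, x \in hrelations O V -> fglift f x = 0.
Proof.
move=> [nf lf df]; apply: lspan_eq0 => _ [k l X Y fW fL fS I|k l X i a u v|k l X w a x y].
- rewrite linearB linearZ /= !fgliftU; have [phi [sp _ _ ->]] := iso_emb I.
  by rewrite -(nf (HGraph X) (HGraph Y) phi) ?subrr.
- rewrite linearB linearD linearZ /= !fgliftU.
  rewrite (lf _ _ _ _ i a _ (lab (set_lab X i u)) (lab (set_lab X i v))) ?subrr //=.
    by rewrite eqxx.
  by move=> j /negPf ->.
- rewrite linearB linearD linearZ /= !fgliftU.
  rewrite (df _ _ _ _ w a _ (deco (set_deco x)) (deco (set_deco y))) ?subrr //=.
    by rewrite !dfwith_in.
  by move=> j wj; rewrite !dfwith_out // eq_sym.
Qed.

Lemma hclass_eq0 x : x \in hrelations O V -> qproj (hrelations O V) x = 0.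
Proof. by move=> xr; apply/eqP; rewrite qproj_eq0. Qed.

End Respects.

(** * The universal compatible function and maps out of the hairy graph complex *)

Section Classes.
Variables (F : fieldType) (O : cyclicOperad F) (V : vectType F).

(** The converse of [respects_eq0]. Applying the constructions below to [hclass] yields the boundary
    and the splitting map; applying them to scalar functionals yields their duals. *)
Lemma hclass_respects : respects (@hclass F O V).
Proof.
split.
- move=> [k l X] [k' l' Y] phi sp.
  (* [is_iso] compares only graphs with the same numbers of vertices and of leaves; surjectivity
     provides both equalities. *)
  have kk : k = k' by have /bij_eq_card := surj_emb_bij sp; rewrite !card_ord.
  have ll : l = l'.
    have [psi [spsi _ _ _ psiK]] := emb_inv sp.
    have [phi' [_ _ _ _ phiK]] := emb_inv spsi.
    have /bij_eq_card : bijective (eL psi).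
      apply: inj_card_bij; first exact: eL_inj.
      rewrite -(card_codom (@eL_inj _ _ _ _ _ _ _ _ _ phi)).
      exact: max_card.
    by rewrite !card_ord.
  subst k' l'; have [fW [fL [fS [I E]]]] := emb_iso sp.
  apply/eqP; rewrite -subr_eq0 -linearZ -linearB -E; apply/eqP/hclass_eq0.
  by apply: in_lspan; exact: (rel_iso I).
- move=> k l G d i a b b1 b2 bi bj; apply/eqP; rewrite -subr_eq0 -linearZ -linearD -linearB.
  apply/eqP/hclass_eq0/in_lspan.
  have E u c : c i = u -> (forall j, j != i -> c j = b j) ->
      DGraph d c = set_lab (DGraph d b) i u.
    move=> ci cj; congr DGraph; apply/funext => j /=.
    by case: eqP => [->|/eqP/cj].
  rewrite (E (a *: b1 i + b2 i) b) // (E (b1 i) b1) // ?(E (b2 i) b2) //; last 2 first.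
  + by move=> j /bj[].
  + by move=> j /bj[].
  exact: rel_lab.
- move=> k l G b i a d d1 d2 di dj; apply/eqP; rewrite -subr_eq0 -linearZ -linearD -linearB.
  apply/eqP/hclass_eq0/in_lspan.
  have E (u : O (ar G i)) c : c i = u -> (forall j, j != i -> c j = d j) ->
      DGraph c b = set_deco (X := DGraph d b) (w := i) u.
    move=> ci cj; rewrite /set_deco; congr DGraph; apply/functional_extensionality_dep => j /=.
    have [ji|ji] := eqVneq j i; first by subst j; rewrite dfwith_in.
    by rewrite dfwith_out 1?eq_sym // cj.
  rewrite (E (a *: d1 i + d2 i) d) // (E (d1 i) d1) // ?(E (d2 i) d2) //; last 2 first.
  + by move=> j /dj[].
  + by move=> j /dj[].
  exact: rel_deco.
Qed.

Section HLift.
Variables (M : lmodType F) (f : hgraph O V -> M).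

Definition hlift : hairy O V -> M := qlift (fglift f).

Hypothesis rf : respects f.

Lemma hlift_linear : linear hlift.
Proof. exact: (qlift_linear (respects_eq0 rf)). Qed.

Lemma hliftE X : hlift (hclass X) = f X.
Proof. by rewrite /hlift qliftE; [exact: fgliftU|exact: respects_eq0]. Qed.

End HLift.

Lemma hairy_ind (P : hairy O V -> Prop) :
  P 0 -> (forall a X x, P x -> P (a *: hclass X + x)) -> forall x, P x.
Proof.
move=> P0 PS x; rewrite -(qprojK x).
elim/freeg_ind_dom0: (repr x) => [|k X z _ _ IH]; first by rewrite linear0.
rewrite -[k]mulr1 -freegU_scale linearP; exact: PS.
Qed.

Lemma linear_hairy_eq (M : lmodType F) (f g : hairy O V -> M) :
  linear f -> linear g -> (forall X, f (hclass X) = g (hclass X)) -> f =1 g.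
Proof.
move=> lf lg fg; elim/hairy_ind => [|a X x IH]; last by rewrite lf lg fg IH.
have l0 (h : hairy O V -> M) : linear h -> h 0 = 0.
  by move=> /(_ (-1) 0 0); rewrite scaler0 addr0 scaleN1r addNr.
by rewrite !l0.
Qed.

End Classes.

(** * Contractions of embedded graphs *)

Section Merge.
Variables (F : fieldType) (O : cyclicOperad F) (V : vectType F).

Definition slot_of W L (X : dgraph O V W L) (h1 h2 : slot X)
    (z : 'I_(ar X (tag h1)) + 'I_(ar X (tag h2))) : slot X :=
  match z with inl b => existT _ (tag h1) b | inr b => existT _ (tag h2) b end.

Definition merged W L (X : dgraph O V W L) (h1 h2 : slot X) :=
  ocomp O (tagged h1) (tagged h2) (glue_num (tagged h1) (tagged h2))
    (deco X (tag h1)) (deco X (tag h2)).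

Lemma slot_of_inj W L (X : dgraph O V W L) (h1 h2 : slot X) :
  tag h1 != tag h2 -> injective (@slot_of W L X h1 h2).
Proof.
move=> n12 [a|a] [b|b] /= E.
- by congr inl; exact: slotP E.
- by case/eqP: n12; exact: (congr1 tag E).
- by case/eqP: n12; exact: esym (congr1 tag E).
- by congr inr; exact: slotP E.
Qed.

Variables (W L W' L' : finType) (X : dgraph O V W L) (Y : dgraph O V W' L').
Variable f : cemb X Y.

(** Equivariance of the operad composition. If the embedding reverses the edge, the two factors are
    first exchanged by [ocomp_sym]. *)
Lemma merged_oact (h1 h2 : slot X) (k1 k2 : slot Y)
    (g : 'I_(ar X (tag h1) + ar X (tag h2) - 2) ->
         'I_(ar Y (tag k1) + ar Y (tag k2) - 2)) :
  tag h1 != tag h2 -> bijective g ->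
  eslot f h1 = k1 /\ eslot f h2 = k2 \/ eslot f h1 = k2 /\ eslot f h2 = k1 ->
  (forall c, eslot f (slot_of (glue_num (tagged h1) (tagged h2) c)) =
             slot_of (glue_num (tagged k1) (tagged k2) (g c))) ->
  merged k1 k2 = oact O g (merged h1 h2).
Proof.
move=> n12 gb [[E1 E2]|[E1 E2]] sE; subst k1 k2; rewrite /merged /=.
  have G := glue_numP (tagged h1) (tagged h2).
  have -> := ocomp_act (e' := glue_num (tagged (eslot f h1)) (tagged (eslot f h2)))
    (deco X (tag h1)) (deco X (tag h2)) (eS_bij f (tag h1)) (eS_bij f (tag h2)) gb G.
    by rewrite -!eS_deco.
  move=> c; apply: slot_of_inj; first by rewrite /= (inj_eq (@eW_inj _ _ _ _ _ _ _ _ _ f)).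
  by rewrite -sE; case: (glue_num _ _ c).
have [Gi Gc] := glue_numP (tagged h1) (tagged h2).
rewrite -[Z in oact O g Z]ocomp_sym; last exact: glue_numP.
have G : glues (tagged h2) (tagged h1) (@sum_swap _ _ \o glue_num (tagged h1) (tagged h2)).
  split=> [|z]; first by apply: inj_comp Gi => -[a|a] [b|b] // [->].
  have -> : (z \in codom (@sum_swap _ _ \o glue_num (tagged h1) (tagged h2))) =
            (sum_swap z \in codom (glue_num (tagged h1) (tagged h2))).
    apply/codomP/codomP => -[c E]; exists c.
      by rewrite E /=; case: (glue_num _ _ c).
    by move: E; case: z => a /= <-.
  by rewrite Gc; case: z => a /=; rewrite ?andbT ?andTb.
have -> := ocomp_act (e' := glue_num (tagged (eslot f h2)) (tagged (eslot f h1)))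
  (deco X (tag h2)) (deco X (tag h1)) (eS_bij f (tag h2)) (eS_bij f (tag h1)) gb G.
  by rewrite -!eS_deco.
move=> c; apply: slot_of_inj.
  by rewrite /= (inj_eq (@eW_inj _ _ _ _ _ _ _ _ _ f)) eq_sym.
by rewrite -sE /=; case: (glue_num _ _ c).
Qed.

Variables (e : nledge X) (e' : nledge Y).

Definition matches : Prop :=
  eslot f (ini (val e)) = ini (val e') /\ eslot f (ter (val e)) = ter (val e') \/
  eslot f (ini (val e)) = ter (val e') /\ eslot f (ter (val e)) = ini (val e').

End Merge.

Section ContractGraph.
Variables (F : fieldType) (O : cyclicOperad F) (V : vectType F).
Variables (W L : finType) (X : dgraph O V W L) (e : nledge X).

(** As [con_vert e] is an option over a subtype, [insub] is the quotient map on vertices: both ends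
    of [e] go to [None], the merged vertex. It is used in this role throughout. *)
Lemma con_tag (h : slot (contract e)) :
  insub (tag (con_slot h)) = tag h :> option _.
Proof.
case: h => [[u|] a] /=; first exact: valK.
by case: (glue_num _ _ a) => b /=; rewrite insubF //= eqxx ?andbF.
Qed.

Lemma con_oppE z :
  sum_map (con_slot (e := e)) id (opp (g := contract e) z) =
  opp (sum_map (con_slot (e := e)) id z).
Proof. by apply: (@pull_oppE _ _ X); exact: con_opp. Qed.

Lemma con_sum_inj : injective (sum_map (con_slot (e := e)) (@id L)).
Proof.
move=> [a|a] [b|b] //= E; congr (_ _); last exact: inr_inj E.
exact: con_slot_inj (inl_inj E).
Qed.

Lemma con_dir (h : slot (contract e)) : dir h = dir (con_slot h).
Proof. by []. Qed.

Lemma con_isint (h : slot (contract e)) : isint h = isint (con_slot h).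
Proof.
rewrite /isint -[inl (con_slot h)]/(sum_map (con_slot (e := e)) id (inl h)) -con_oppE.
by case: (opp (g := contract e) _).
Qed.

End ContractGraph.

Section ContractEmb.
Variables (F : fieldType) (O : cyclicOperad F) (V : vectType F).
Variables (W L W' L' : finType) (X : dgraph O V W L) (Y : dgraph O V W' L').

(** Through [con_slot] the slots of a contraction are those of the graph except the two halves of
    the edge, so the slot map is a restriction of that of [f]. The decoration of the merged vertex
    is handled by [merged_oact]. *)
Lemma contract_cemb (f : cemb X Y) (e : nledge X) (e' : nledge Y) :
  matches f e e' ->
  exists g : cemb (contract e) (contract e'),
    (forall w, eW g (insub w) = insub (eW f w)) /\
    forall h, con_slot (eslot g h) = eslot f (con_slot h).
Proof.
move=> m; pose fW (w : con_vert e) : con_vert e' :=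
  if w is Some u then insub (eW f (val u)) else None.
have mw w : ((eW f w != tag (ini (val e'))) && (eW f w != tag (ter (val e')))) =
            ((w != tag (ini (val e))) && (w != tag (ter (val e)))).
  by case: m => -[<- <-] /=; rewrite !(inj_eq (@eW_inj _ _ _ _ _ _ _ _ _ f)) // andbC.
have fWE w : fW (insub w) = insub (eW f w).
  case: insubP => [u uP /= ->//|]; rewrite -mw => n.
  by rewrite insubN.
have ms h : (eslot f h != ini (val e')) && (eslot f h != ter (val e')) =
            ((h != ini (val e)) && (h != ter (val e))).
  by case: m => -[<- <-] /=; rewrite !(inj_eq (@eslot_inj _ _ _ _ _ _ _ _ _ f)) // andbC.
have /choice[phi phiE] : forall h, exists h', con_slot (e := e') h' = eslot f (con_slot (e := e) h).
  move=> h; have [n1 n2] := con_slot_avoid h.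
  have /andP[] : (eslot f (con_slot h) != ini (val e')) && (eslot f (con_slot h) != ter (val e')).
    by rewrite ms n1.
  exact: con_slot_codom.
have fWi : injective fW.
  move=> [u|] [v|] //=; last by have := valP v; rewrite -mw => vP; rewrite insubT.
    have uP := valP u; have vP := valP v; rewrite -mw in uP; rewrite -mw in vP.
    rewrite !insubT => -[E]; congr Some; apply: val_inj.
    exact: (@eW_inj _ _ _ _ _ _ _ _ _ f).
  by have := valP u; rewrite -mw => uP; rewrite insubT.
have [] := @cemb_of_slots _ O V _ _ _ _ (contract e) (contract e') fW phi.
- exact: fWi.
- move=> h h' E; apply: con_slot_inj; apply: (@eslot_inj _ _ _ _ _ _ _ _ _ f).
  by rewrite -!phiE E.
- by move=> h; rewrite -con_tag phiE -(con_tag h) fWE.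
- move=> h' w wE; have [n1 n2] := con_slot_avoid h'.
  have [h0 h0E] : exists h0, eslot f h0 = con_slot h'.
    apply: eslot_surj; move: wE; rewrite -con_tag.
    case: insubP => [u _ <-|].
      case: w => [v|] //=; case: insubP => //= u' _ E [<-].
      by exists (val v); rewrite -E.
    rewrite negb_and !negbK => tP _.
    case: m => -[E1 E2]; case/orP: tP => /eqP ->;
      rewrite -?E1 -?E2; by [exists (tag (ini (val e)))|exists (tag (ter (val e)))].
  have /andP[m1 m2] : (h0 != ini (val e)) && (h0 != ter (val e)).
    by rewrite -ms h0E n1.
  have [h hE] := con_slot_codom m1 m2; exists h.
  by apply: con_slot_inj; rewrite phiE hE.
- case=> [u|] g gb gE.
    have uP := valP u; rewrite -mw in uP.
    move: g gb gE; rewrite /= insubT /= => g gb gE.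
    rewrite eS_deco; congr (oact O _ _); apply/funext => a.
    by have := phiE (existT _ (Some u) a); rewrite gE => /= /slotP.
  apply: (merged_oact (f := f) (h1 := ini (val e)) (h2 := ter (val e))
    (k1 := ini (val e')) (k2 := ter (val e')) (g := g)) => //.
    exact: (valP e).
  move=> c; have := phiE (existT _ None c); rewrite gE /= => E.
  by rewrite /slot_of E; case: (glue_num _ _ c).
- by move=> g [gW gS]; exists g; split=> [w|h]; rewrite ?gW ?fWE ?gS.
Qed.

Lemma contract_emb (f : emb X Y) (e : nledge X) (e' : nledge Y) :
  matches f e e' ->
  exists g : emb (contract e) (contract e'),
   [/\ forall w, eW g (insub w) = insub (eW f w),
    forall h, con_slot (eslot g h) = eslot f (con_slot h) & eL g = eL f].
Proof.
move=> /contract_cemb[g [gW gS]].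
have gopp z : opp (sum_map (eslot g) (eL f) z) = sum_map (eslot g) (eL f) (opp z).
  apply: con_sum_inj; rewrite con_oppE.
  have E y : sum_map (con_slot (e := e')) id (sum_map (eslot g) (eL f) y) =
    sum_map (eslot f) (eL f) (sum_map (con_slot (e := e)) id y).
    by case: y => [h|l]; rewrite /sum_map ?gS.
  by rewrite !E e_opp con_oppE.
by exists (@Emb _ _ _ _ _ _ _ (contract e) (contract e') g (eL f)
  (@eL_inj _ _ _ _ _ _ _ _ _ f) gopp (e_lab f)).
Qed.

Lemma contract_surj (f : emb X Y) (e : nledge X) (e' : nledge Y)
   (g : emb (contract e) (contract e')) : matches f e e' ->
  (forall w, eW g (insub w) = insub (eW f w)) -> eL g = eL f ->
  surj_emb f -> surj_emb g.
Proof.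
move=> m gW gL [sW sL]; split; last by rewrite gL.
case=> [u|]; first by have [w wE] := sW (val u); exists (insub w); rewrite gW wE valK.
exists (insub (tag (ini (val e)))); rewrite gW insubN // negb_and !negbK.
by case: m => -[<- _]; rewrite eqxx ?orbT.
Qed.

End ContractEmb.

(** * Sign of a contraction *)

(* Parity of the reordering that puts i first and j second. *)
Definition cpar (T : finType) (i j : T) : bool :=
  (rank j < rank i)%N (+) \big[addb/false]_(u | (u != i) && (u != j))
    ((rank u < rank i)%N (+) (rank u < rank j)%N).

Lemma cpar_sym (T : finType) (i j : T) : i != j -> cpar j i = ~~ cpar i j.
Proof.
move=> ij; rewrite /cpar (inj_ltnC (@rank_inj T) ij) -addNb negbK; congr addb.
by apply: eq_big => [u|u _]; rewrite (andbC, addbC).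
Qed.

Lemma odd_ord n (k : 'I_n) : odd k = \big[addb/false]_(u < n) (u < k)%N.
Proof.
rewrite (eq_bigr (fun u : 'I_n => if (u < k)%N then true else false)); last first.
  by move=> u _; case: ifP.
rewrite -big_mkcond (big_ord_narrow (ltnW (ltn_ord k))) big_const_ord.
by elim: (k : nat) => //= m ->; case: odd.
Qed.

(** An ordinal counts its predecessors. In the sum of the counts for [i] and [j], the term at
    [u = i] is cancelled by the correction [i < j], and the term at [u = j] is the first term of
    [cpar]. *)
Lemma odd_con_par n (i j : 'I_n) : i != j -> odd (i + j + (i < j))%N = cpar i j.
Proof.
move=> ij; rewrite !oddD !odd_ord oddb.
rewrite -big_split (bigD1 i) //= (bigD1 j) 1?eq_sym //= !ltnn addFb addbF.
rewrite /cpar !rank_ord.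
rewrite (eq_bigr (fun u : 'I_n => (rank u < i)%N (+) (rank u < j)%N)).
  by case: (i < j)%N; case: (j < i)%N; case: (\big[addb/false]_(_ | _) _).
by move=> u _; rewrite rank_ord.
Qed.

Lemma con_sign_cpar (F : fieldType) (O : cyclicOperad F) (V : vectType F)
    (X : hgraph O V) (e : nledge X) :
  odd (con_sign e) = cpar (tag (ini (val e))) (tag (ter (val e))).
Proof. by rewrite /con_sign odd_con_par //; exact: (valP e). Qed.

(** Split off the pairs that meet [i] or [j]. The others are the pairs of the contraction without
    its merged vertex, which comes first on both sides and so creates no inversion. The pairs split
    off account for the difference of the two [cpar]. *)
Lemma ordpar_contract (T T' : finType) (f : T -> T') (i j : T) (i' j' : T')
    (g : option {w | (w != i) && (w != j)} -> option {w | (w != i') && (w != j')}) :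
  bijective f -> i != j ->
  (f i = i' /\ f j = j') \/ (f i = j' /\ f j = i') ->
  (forall w, g (insub w) = insub (f w)) ->
  ordpar f = ordpar g (+) cpar i j (+) cpar i' j' (+) (f i != i').
Proof.
move=> bf ij fij gE; have fi := bij_inj bf.
have pf u : (f u != i') && (f u != j') = ((u != i) && (u != j)).
  by case: fij => -[<- <-]; rewrite !(inj_eq fi) // andbC.
have gN : g None = None.
  have -> : None = insub i :> option {w | (w != i) && (w != j)}.
    by rewrite insubN // eqxx.
  by rewrite gE insubN // pf eqxx.
have gS (u : {w | (w != i) && (w != j)}) : exists2 v, g (Some u) = Some v & val v = f (val u).
  have uP := valP u; rewrite -pf in uP.
  by rewrite -(valK u) gE insubT; exists (exist _ (f (val u)) uP).
have -> : ordpar g = pairpar (fun u v : {w | (w != i) && (w != j)} =>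
    dis (@rank T) (@rank T' \o f) (val u) (val v)).
  rewrite /ordpar (@pairpar_image _ _ Some); first last.
  - move=> [u|] [v|]; rewrite ?codom_f // /dis /= gN.
    + by rewrite !rank_None !ltn0.
    + by have [u' -> _] := gS v; rewrite !rank_None !rank_Some.
    + by rewrite !rank_None !ltn0.
  - apply: dis_sym; first exact: rank_inj.
    apply: inj_comp; first exact: rank_inj.
    move=> [u|] [v|] //; last by have [u' -> _] := gS v; rewrite gN.
      have [u' -> uE] := gS u; have [v' -> vE] := gS v.
      by case=> uv; congr Some; apply/val_inj/fi; rewrite -uE -vE uv.
    by have [u' -> _] := gS u; rewrite gN.
  - exact: Some_inj.
  apply: eq_pairpar => u v; rewrite /dis /=.
  have [u' -> uE] := gS u; have [v' -> vE] := gS v.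
  by rewrite !rank_Some !ltnS !rank_val uE vE.
have symf : symmetric (dis (@rank T) (@rank T' \o f)).
  by apply: dis_sym; [exact: rank_inj|exact: inj_comp (@rank_inj _) fi].
(* [cpar] changes when its arguments are exchanged, so the last term records whether [f] reverses
   the edge. *)
have -> : cpar i' j' = cpar (f i) (f j) (+) (f i != i').
  case: fij => -[<- <-]; rewrite ?eqxx ?addbF //.
  by rewrite (inj_eq fi) ij addbT cpar_sym // (inj_eq fi).
rewrite /ordpar (pairpar_split2 symf ij) !addbA addbK; set P := pairpar _.
rewrite addbC -!addbA; congr addb; rewrite /cpar.
rewrite [in RHS](reindex f) /=; last by apply: onW_bij.
rewrite [X in _ = _ (+) (_ (+) (_ (+) X))](eq_bigl (fun u => (u != i) && (u != j)));
  last by move=> u; rewrite !(inj_eq fi).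
set A := \big[addb/false]_(u | _) ((rank u < rank i)%N (+) _).
set B := \big[addb/false]_(u | _) ((rank (f u) < _)%N (+) _).
rewrite (_ : \big[addb/false]_(u | _) (dis _ _ i u (+) _) = A (+) B); last first.
  rewrite /A /B -big_split /=; apply: eq_bigr => u /andP[ui uj]; rewrite /dis /=.
  rewrite (inj_ltnC (@rank_inj _) ui) (inj_ltnC (@rank_inj _) uj).
  rewrite (@inj_ltnC _ _ (f u) (f i) (@rank_inj _)) ?(inj_eq fi) //.
  rewrite (@inj_ltnC _ _ (f u) (f j) (@rank_inj _)) ?(inj_eq fi) //.
  by do 4!case: (_ < _)%N.
rewrite (inj_ltnC (@rank_inj _) ij) /=.
rewrite (@inj_ltnC _ _ (f i) (f j) (@rank_inj _)) ?(inj_eq fi) //=.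
by case: A; case: B; do 2!case: (_ < _)%N.
Qed.

Section ContractSign.
Variables (F : fieldType) (O : cyclicOperad F) (V : vectType F).
Variables (W L W' L' : finType) (X : dgraph O V W L) (Y : dgraph O V W' L').
Variables (f : emb X Y) (e : nledge X) (e' : nledge Y).
Variable g : emb (contract e) (contract e').
Hypotheses (m : matches f e e') (gW : forall w, eW g (insub w) = insub (eW f w)).
Hypothesis gS : forall h, con_slot (eslot g h) = eslot f (con_slot h).

Definition econ W L (X : dgraph O V W L) (e : nledge X) : bool :=
  cpar (tag (ini (val e))) (tag (ter (val e))).

(** Exactly one internal edge, [e] itself, disappears in the contraction; it counts if [f] reverses
    it. *)
Lemma dirpar_contract : dirpar f = dirpar g (+) (eslot f (ini (val e)) != ini (val e')).
Proof.
have di (Z : iedge X) : isint (ini Z) && dir (ini Z).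
  by rewrite /isint opp_ini; case/andP: (valP Z).
have di' (Z : iedge Y) : dir (ini Z) /\ dir (ter Z) = false.
  have dZ : dir (ini Z) by case/andP: (valP Z).
  by split=> //; rewrite (dir_opp (opp_ini Z)) dZ.
rewrite /dirpar (bigD1 (ini (val e))) //= addbC; congr addb; last first.
  case: m => -[-> _]; have [d1 d2] := di' (val e'); rewrite ?eqxx ?d1 ?d2 //.
  by rewrite eq_sym ini_neq_ter.
have [inj_con cod_con] := (@con_slot_inj _ _ X e, @con_slot_codom _ _ X e).
pose P h := [&& isint h, dir (g := X) h & h != ini (val e)].
have Pe h : P h -> exists h', con_slot (e := e) h' = h.
  case/and3P=> _ dh h1; apply: con_slot_codom => //.
  apply: contraTneq dh => ->; rewrite (dir_opp (opp_ini (val e))) negbK.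
  by case/andP: (di (val e)).
pose r h : option (slot (contract e)) := [pick h' | con_slot h' == h].
rewrite (reindex_omap (@con_slot _ _ X e) r).
  apply: eq_big => [h|h _]; last by rewrite -gS.
  rewrite -con_isint; have [-> _] := con_slot_avoid h; rewrite andbT.
  rewrite /r; case: pickP => [h' /eqP/inj_con->|/(_ h)]; rewrite eqxx ?andbT //.
move=> h /andP[/andP[h1 h2] h3].
have [h' hE] : exists h', con_slot (e := e) h' = h by apply: Pe; rewrite /P h1 h2.
by rewrite /r; case: pickP => [h'' /eqP E|/(_ h')] /=; rewrite ?E // hE eqxx.
Qed.

(** If [f] reverses [e], it also exchanges the vertices to be put first and second; the two extra
    signs cancel. *)
Lemma sgn_contract : surj_emb f -> sgn g = sgn f (+) econ e (+) econ e'.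
Proof.
move=> sf; have bf := surj_emb_bij sf.
have ne : tag (ini (val e)) != tag (ter (val e)) by exact: (valP e).
have ne' : tag (ini (val e')) != tag (ter (val e')) by exact: (valP e').
have te : (eslot f (ini (val e)) != ini (val e')) =
          (eW f (tag (ini (val e))) != tag (ini (val e'))).
  case: m => -[E _]; first by have /= tE := congr1 tag E; rewrite E tE !eqxx.
  have /= tE := congr1 tag E; rewrite E tE eq_sym ini_neq_ter.
  by rewrite eq_sym ne'.
rewrite /sgn dirpar_contract te.
rewrite (ordpar_contract (i := tag (ini (val e))) (j := tag (ter (val e)))
  (i' := tag (ini (val e'))) (j' := tag (ter (val e'))) (g := eW g)) //; last first.
  by case: m => -[<- <-]; [left|right].
rewrite /econ; move: (eW f _ != _) (ordpar _) (dirpar _) (cpar _ _) (cpar _ _).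
by do 5!case.
Qed.

End ContractSign.

(** * The boundary map *)

Section Edges.
Variables (W L : finType) (G : graph W L).

Lemma isint_ini (e : iedge G) : isint (ini e).
Proof. by rewrite /isint opp_ini. Qed.

Lemma oph_ini (e : iedge G) : oph (ini e) = ter e.
Proof. by rewrite /oph opp_ini. Qed.

Lemma dir_ini (e : iedge G) : dir (ini e).
Proof. by case/andP: (valP e). Qed.

Lemma dir_ter (e : iedge G) : dir (ter e) = false.
Proof. by rewrite (dir_opp (opp_ini e)) dir_ini. Qed.

Lemma iedge_inj (e e' : iedge G) : ini e = ini e' -> e = e'.
Proof.
move=> E; apply: val_inj; rewrite [LHS]surjective_pairing [RHS]surjective_pairing.
by congr pair => //; rewrite -[LHS]/(ter e) -[RHS]/(ter e') -!oph_ini E.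
Qed.

Lemma ini_ter (e e' : iedge G) : ini e <> ter e'.
Proof. by move=> E; have := dir_ini e; rewrite E dir_ter. Qed.

Lemma iedge_of (h : slot G) : isint h -> dir h -> exists e : iedge G, ini e = h.
Proof.
move=> hi hd; have P : (opp (inl h) == inl (oph h)) && dir h.
  by rewrite opp_oph // eqxx.
by exists (exist _ (h, oph h) P).
Qed.

End Edges.

Section Matching.
Variables (F : fieldType) (O : cyclicOperad F) (V : vectType F).
Variables (W L W' L' : finType) (X : dgraph O V W L) (Y : dgraph O V W' L').

Definition imatches (f : cemb X Y) (e : iedge X) (e' : iedge Y) : Prop :=
  eslot f (ini e) = ini e' /\ eslot f (ter e) = ter e' \/
  eslot f (ini e) = ter e' /\ eslot f (ter e) = ini e'.

Lemma imatches_ex (f : emb X Y) (e : iedge X) : exists e', imatches f e e'.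
Proof.
have hi : isint (eslot f (ini e)) by rewrite isint_emb isint_ini.
have [hd|hd] := boolP (dir (eslot f (ini e))).
  by have [e' E] := iedge_of hi hd; exists e'; left; rewrite -!oph_ini E oph_emb ?isint_ini.
have [e' E] : exists e' : iedge Y, ini e' = oph (eslot f (ini e)).
  by apply: iedge_of; rewrite ?isint_oph // dir_oph.
exists e'; right; rewrite -!oph_ini E ophK oph_emb ?isint_ini //.
Qed.

Lemma imatches_surj (f : emb X Y) (e' : iedge Y) : surj_emb f -> exists e, imatches f e e'.
Proof.
move=> [sW _]; have [h hE] := eslot_surj (f := f) (sW (tag (ini e'))).
have hi : isint h by rewrite -(isint_emb f) hE isint_ini.
have hE' : eslot f (oph h) = ter e' by rewrite -oph_emb // hE oph_ini.
have [hd|hd] := boolP (dir h).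
  have [e E] := iedge_of hi hd; exists e; left.
  by rewrite -(oph_ini e) E.
have [e E] : exists e : iedge X, ini e = oph h.
  by apply: iedge_of; rewrite ?isint_oph // dir_oph.
by exists e; right; rewrite -(oph_ini e) E ophK.
Qed.

Lemma imatches_fun (f : emb X Y) (e : iedge X) (e' e'' : iedge Y) :
  imatches f e e' -> imatches f e e'' -> e' = e''.
Proof.
rewrite /imatches => -[[-> _]|[-> E]] [[E1 _]|[E1 E2]]; first exact: iedge_inj.
- by case: (ini_ter E1).
- by case: (ini_ter (esym E1)).
- by apply: iedge_inj; rewrite -E -E2.
Qed.

Lemma imatches_inj (f : emb X Y) (e1 e2 : iedge X) (e' : iedge Y) :
  imatches f e1 e' -> imatches f e2 e' -> e1 = e2.
Proof.
have I := @eslot_inj _ _ _ _ _ _ _ _ _ f.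
move=> [[E1 E2]|[E1 E2]] [[E3 E4]|[E3 E4]]; try by apply/iedge_inj/I; rewrite E1.
- by have /I/ini_ter : eslot f (ini e1) = eslot f (ter e2) by rewrite E1.
- by have /I/ini_ter : eslot f (ini e1) = eslot f (ter e2) by rewrite E1.
Qed.

Lemma imatches_loop (f : emb X Y) (e : iedge X) (e' : iedge Y) : imatches f e e' ->
  (tag (ini e) != tag (ter e)) = (tag (ini e') != tag (ter e')).
Proof.
by case=> -[<- <-] /=; rewrite (inj_eq (@eW_inj _ _ _ _ _ _ _ _ _ f)) // eq_sym.
Qed.

Lemma matches_ex (f : emb X Y) (e : nledge X) : exists e' : nledge Y, matches f e e'.
Proof.
have [e' m] := imatches_ex f (val e).
have P : tag (ini e') != tag (ter e') by rewrite -(imatches_loop m); exact: (valP e).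
by exists (exist _ e' P).
Qed.

Lemma matches_surj (f : emb X Y) (e' : nledge Y) : surj_emb f ->
  exists e : nledge X, matches f e e'.
Proof.
move=> sf; have [e m] := imatches_surj (val e') sf.
have P : tag (ini e) != tag (ter e) by rewrite (imatches_loop m); exact: (valP e').
by exists (exist _ e P).
Qed.

Lemma card_iedge_emb (f : emb X Y) : surj_emb f -> #|iedge X| = #|iedge Y|.
Proof.
move=> sf; rewrite -!sum1_card; apply: (@sum_rel _ _ _ (imatches f)) => //.
- exact: imatches_ex.
- by move=> e'; exact: imatches_surj sf.
- by move=> e e' e''; exact: imatches_fun.
- by move=> e e' e''; exact: imatches_inj.
Qed.

End Matching.

Section Boundary.
Variables (F : fieldType) (O : cyclicOperad F) (V : vectType F) (M : lmodType F).
Variable f : hgraph O V -> M.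

(** The composite of [f] with the boundary, on graphs over any finite types: for [hclass] it is the
    boundary of a graph, for a scalar functional its coboundary. *)
Definition gbd W L (X : dgraph O V W L) : M :=
  \sum_(e : nledge X) (-1) ^+ econ e *: f (standard (contract e)).

Lemma gbd_emb W L W' L' (X : dgraph O V W L) (Y : dgraph O V W' L') (phi : emb X Y) :
  natural f -> surj_emb phi -> gbd X = (-1) ^+ sgn phi *: gbd Y.
Proof.
move=> nf sphi; rewrite scaler_sumr.
apply: (@sum_rel _ _ _ (matches phi)).
- exact: matches_ex.
- by move=> e'; exact: matches_surj.
- by move=> e e' e'' m m'; apply/val_inj/(imatches_fun m m').
- by move=> e e' e'' m m'; apply/val_inj/(imatches_inj m m').
- move=> e e' m; have [g [gW gS gL]] := contract_emb m.
  rewrite (natural_std nf (contract_surj m gW gL sphi)) (sgn_contract m gW gS sphi).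
  rewrite !scalerA -!signr_addb; congr ((-1) ^+ nat_of_bool _ *: _).
  by case: (econ e); case: (econ e'); case: (sgn phi).
Qed.

Lemma gbd_lab W L (G : graph W L) (d : forall w, O (ar G w)) (i : L) a
    (b b1 b2 : L -> V) : lab_linear f ->
  b i = a *: b1 i + b2 i -> (forall j, j != i -> b1 j = b j /\ b2 j = b j) ->
  gbd (DGraph d b) = a *: gbd (DGraph d b1) + gbd (DGraph d b2).
Proof.
move=> lf bi bj; rewrite /gbd scaler_sumr -big_split; apply: eq_bigr => e _ /=.
rewrite scalerA mulrC -scalerA -scalerDr; congr (_ *: _).
exact: (standard_lab _ lf bi bj).
Qed.

(** The decoration at [i] ends up at [insub i]. If this is the merged vertex, linearity of the
    composition in one argument applies: the other argument is fixed since the edge is not a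
    loop. *)
Lemma gbd_deco W L (G : graph W L) (b : L -> V) (i : W) a
    (d d1 d2 : forall w, O (ar G w)) : deco_linear f ->
  d i = a *: d1 i + d2 i -> (forall j, j != i -> d1 j = d j /\ d2 j = d j) ->
  gbd (DGraph d b) = a *: gbd (DGraph d1 b) + gbd (DGraph d2 b).
Proof.
move=> lf di dj; rewrite /gbd scaler_sumr -big_split; apply: eq_bigr => e _ /=.
rewrite scalerA mulrC -scalerA -scalerDr; congr (_ *: _).
apply: (standard_deco (i := insub i) _ lf).
  case: insubP => [u _ /= uE|]; first by rewrite uE.
  have n12 : tag (ini (val e)) != tag (ter (val e)) by exact: (valP e).
  have di' v : v = i -> d v = a *: d1 v + d2 v by move->.
  have G12 := glue_numP (tagged (ini (val e))) (tagged (ter (val e))).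
  rewrite negb_and !negbK => /orP[] /eqP iE; rewrite /con_deco /=.
    have [-> ->] : d1 (tag (ter (val e))) = d (tag (ter (val e))) /\
                   d2 (tag (ter (val e))) = d (tag (ter (val e))).
      by apply: dj; rewrite iE eq_sym.
    by rewrite (di' _ (esym iE)); have := ocomp_linearl (d (tag (ter (val e)))) G12 a (d1 _)
      (d2 _); exact: id.
  have [-> ->] : d1 (tag (ini (val e))) = d (tag (ini (val e))) /\
                 d2 (tag (ini (val e))) = d (tag (ini (val e))).
    by apply: dj; rewrite iE.
  by rewrite (di' _ (esym iE)); have := ocomp_linearr (d (tag (ini (val e)))) G12 a (d1 _)
    (d2 _); exact: id.
case=> [u|] ui; rewrite /con_deco /=.
  by apply: dj; apply: contraNneq ui => <-; rewrite valK.
have n1 : tag (ini (val e)) != i.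
  by apply: contraNneq ui => <-; rewrite insubN ?eqxx.
have n2 : tag (ter (val e)) != i.
  by apply: contraNneq ui => <-; rewrite insubN ?eqxx ?andbF.
by have [-> ->] := dj _ n1; have [-> ->] := dj _ n2.
Qed.

Lemma gbd_respects : respects f -> respects (fun X : hgraph O V => gbd X).
Proof.
move=> [nf lf df]; split.
- by move=> X Y phi; exact: gbd_emb.
- by move=> k l G d i a b b1 b2; exact: gbd_lab.
- by move=> k l G b i a d d1 d2; exact: gbd_deco.
Qed.

Lemma gbd_sign (X : hgraph O V) :
  \sum_(e : nledge X) (-1) ^+ con_sign e *: f (standard (contract e)) = gbd X.
Proof. by apply: eq_bigr => e _; rewrite -signr_odd con_sign_cpar. Qed.

End Boundary.

Section Descent.
Variables (F : fieldType) (O : cyclicOperad F) (V : vectType F).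
Variables (a : hgraph O V -> {freeg (hgraph O V) / F}) (b : hgraph O V -> hairy O V).
Hypothesis ab : forall X, qproj (hrelations O V) (a X) = b X.
Hypothesis rb : respects b.

Lemma qproj_fglift x : qproj (hrelations O V) (fglift a x) = fglift b x.
Proof.
elim/freeg_ind_dom0: x => [|k X z _ _ IH]; first by rewrite !linear0.
by rewrite !linearD /= IH !liftU linearZ /= ab.
Qed.

Lemma fglift_descends : descends (hrelations O V) (fglift a).
Proof.
move=> x xr; rewrite -qproj_eq0 qproj_fglift; apply/eqP.
exact: respects_eq0 rb _ xr.
Qed.

Lemma qinduced_hclass X : qinduced (fglift a) (hclass X) = b X.
Proof. by rewrite /hclass (qinducedE fglift_descends) /= fgliftU ab. Qed.

Lemma qinduced_fglift_linear : linear (qinduced (fglift a) : hairy O V -> hairy O V).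
Proof. exact: qinduced_linear fglift_descends. Qed.

End Descent.

Section Bd.
Variables (F : fieldType) (O : cyclicOperad F) (V : vectType F).

Lemma bd_proj (X : hgraph O V) : qproj (hrelations O V)
  (\sum_(e : nledge X) (-1) ^+ con_sign e *: << standard (contract e) >>) =
  gbd (@hclass F O V) X.
Proof. by rewrite -gbd_sign linear_sum; apply: eq_bigr => e _; rewrite linearZ. Qed.

Lemma bd_descends : descends (hrelations O V) (@formal_bd F O V).
Proof. exact: fglift_descends bd_proj (gbd_respects (@hclass_respects F O V)). Qed.

Lemma bd_linear : linear (@bd F O V).
Proof. exact: qinduced_fglift_linear bd_proj (gbd_respects (@hclass_respects F O V)). Qed.

HB.instance Definition _ :=
  GRing.isLinear.Build F (hairy O V) (hairy O V) *:%R (@bd F O V) bd_linear.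

Lemma bd_hclass (X : hgraph O V) : bd (hclass X) = gbd (@hclass F O V) X.
Proof. exact: (qinduced_hclass bd_proj (gbd_respects (@hclass_respects F O V))). Qed.

Lemma bd_standard W L (X : dgraph O V W L) :
  bd (hclass (standard X)) = gbd (@hclass F O V) X.
Proof.
have [nh _ _] := @hclass_respects F O V.
rewrite bd_hclass (gbd_emb nh (@surj_std _ _ _ _ _ X)).
by rewrite (mono_sgn (@mono_std _ _ _ _ _ X)) scale1r.
Qed.

End Bd.

(** * Cutting edges *)

Section CutGraph.
Variables (F : fieldType) (O : cyclicOperad F) (V : vectType F).
Variables (W L : finType) (X : dgraph O V W L) (e : iedge X) (x y : V).

(** A cut changes leaves and [opp] but no corolla. Comparisons like this one are why [cemb] is kept
    apart from [emb]. *)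
Definition to_cut : cemb X (cut e x y) :=
  @Cemb _ _ _ _ _ _ _ X (cut e x y) id (fun _ => id) (@inj_id _)
    (fun w => @Bijective _ _ id id (frefl _) (frefl _))
    (fun w => esym (oact_id _)).

Definition of_cut : cemb (cut e x y) X :=
  @Cemb _ _ _ _ _ _ _ (cut e x y) X id (fun _ => id) (@inj_id _)
    (fun w => @Bijective _ _ id id (frefl _) (frefl _))
    (fun w => esym (oact_id _)).

Lemma to_cutE h : eslot to_cut h = h. Proof. by case: h. Qed.
Lemma of_cutE h : eslot of_cut h = h. Proof. by case: h. Qed.

Lemma isint_cut (h : slot X) : isint (G := cut e x y) h =
  [&& isint h, h != ini e & h != ter e].
Proof.
rewrite /isint /=; case: eqP => [_|_]; first by rewrite andbF.
case: eqP => [_|_]; first by rewrite !andbF.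
by rewrite !andbT; case: (opp _).
Qed.

Lemma oph_cut (h : slot X) : isint (G := cut e x y) h -> oph (G := cut e x y) h = oph h.
Proof.
rewrite isint_cut => /and3P[hi h1 h2].
by rewrite /oph /= (negPf h1) (negPf h2) opp_oph.
Qed.

End CutGraph.

Section CutEmb.
Variables (F : fieldType) (O : cyclicOperad F) (V : vectType F).
Variables (W L W' L' : finType) (X : dgraph O V W L) (Y : dgraph O V W' L').

(** The bit [b] tells whether [f] reverses [e]. Once cut, the edge is no longer internal, so [b]
    leaves the sign, and the two new labels are exchanged instead. *)
Lemma cut_emb_ex (f : emb X Y) (e : iedge X) (e' : iedge Y) (b : bool) (x y : V) :
  (if b then eslot f (ini e) = ter e' /\ eslot f (ter e) = ini e'
   else eslot f (ini e) = ini e' /\ eslot f (ter e) = ter e') ->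
  surj_emb f ->
  exists g : emb (cut e x y) (cut e' (if b then y else x) (if b then x else y)),
    surj_emb g /\ sgn g = sgn f (+) b.
Proof.
move=> m [sW sL]; set Y' := cut e' _ _.
pose c : cemb (cut e x y) Y' := @Cemb _ _ _ _ _ _ _ (cut e x y) Y' (eW f)
  (fun w => eS f (w := w)) (@eW_inj _ _ _ _ _ _ _ _ _ f) (eS_bij f) (eS_deco f).
pose fL : L + bool -> L' + bool := sum_map (eL f) (addb b).
have fLi : injective fL.
  move=> [l|a] [l'|a'] //= E; congr (_ _); first exact: (@eL_inj _ _ _ _ _ _ _ _ _ f) (inl_inj E).
  exact: addbI (inr_inj E).
have S := @eslot_inj _ _ _ _ _ _ _ _ _ f.
have n12 : (ini e == ter e) = false by apply/negbTE/ini_neq_ter.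
have n21 : (ter e == ini e) = false by rewrite eq_sym (negPf (ini_neq_ter e)).
have sini h : (eslot f h == ini e') = (h == (if b then ter e else ini e)).
  by rewrite -(inj_eq S); case: (b) m => -[E1 E2]; rewrite ?E1 ?E2.
have ster h : (eslot f h == ter e') = (h == (if b then ini e else ter e)).
  by rewrite -(inj_eq S); case: (b) m => -[E1 E2]; rewrite ?E1 ?E2.
have fopp z : opp (sum_map (eslot c) fL z) = sum_map (eslot c) fL (opp z).
  have cutE (z' : slot X + L) :
    cut_emb (sum_map (eslot f) (eL f) z') = sum_map (eslot c) fL (cut_emb z').
    by case: z'.
  case: z => [h|[l|a]] /=.
  - rewrite -[eslot c h]/(eslot f h) sini ster.
    have [->|h1] := eqVneq h (ini e).
      by rewrite /fL /=; case: (b); rewrite /= ?(n12, eqxx).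
    have [->|h2] := eqVneq h (ter e).
      by rewrite /fL /=; case: (b); rewrite /= ?(n21, eqxx).
    have -> : (h == (if b then ter e else ini e)) = false.
      by case: (b); apply: negPf.
    have -> : (h == (if b then ini e else ter e)) = false.
      by case: (b); apply: negPf.
    by rewrite -cutE -e_opp.
  - by rewrite -cutE -e_opp.
  - rewrite -[eslot c _]/(eslot f _); move: m.
    by case: a; case: (b) => -[E1 E2] /=; rewrite ?E1 ?E2.
have flab l : lab Y' (fL l) = lab (cut e x y) l.
  case: l => [l|a] /=; first exact: e_lab.
  by case: a; case: (b).
pose g := @Emb _ _ _ _ _ _ _ (cut e x y) Y' c fL fLi fopp flab.
exists g; split.
  split=> [//|[l|a]]; first by have [l' <-] := sL l; exists (inl l').
  by exists (inr (b (+) a)); rewrite /= addKb.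
rewrite /sgn -addbA; congr addb; rewrite /dirpar [in RHS](bigD1 (ini e)) /=; last first.
  by rewrite isint_ini dir_ini.
have -> : ~~ dir (eslot f (ini e)) = b.
  by case: (b) m => -[-> _]; rewrite ?dir_ini ?dir_ter.
rewrite addbC addKb; apply: eq_bigl => h; rewrite (@isint_cut _ _ _ _ _ X e x y h).
have [->|_] := eqVneq h (ter e); first by rewrite dir_ter !andbF.
by rewrite andbT andbAC.
Qed.

End CutEmb.

Section Splits.
Variables (F : fieldType) (O : cyclicOperad F) (V : vectType F) (M : lmodType F).
Variables (f : hgraph O V -> M) (n : nat) (p q : 'I_n -> V).

Definition gcut W L (X : dgraph O V W L) (x y : V) : M :=
  \sum_(e : iedge X) f (standard (cut e x y)).

Definition gsplit W L (X : dgraph O V W L) : M :=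
  (\dim {: V})%:R^-1 *: \sum_(i < n) (gcut X (p i) (q i) + gcut X (q i) (- p i)).

Lemma cut_linl W L (X : dgraph O V W L) (e : iedge X) a x x' y : lab_linear f ->
  f (standard (cut e (a *: x + x') y)) =
    a *: f (standard (cut e x y)) + f (standard (cut e x' y)).
Proof.
move=> lf; apply: (standard_lab (i := inr true) _ lf) => //.
by case=> [l|[]].
Qed.

Lemma cut_linr W L (X : dgraph O V W L) (e : iedge X) a x y y' : lab_linear f ->
  f (standard (cut e x (a *: y + y'))) =
    a *: f (standard (cut e x y)) + f (standard (cut e x y')).
Proof.
move=> lf; apply: (standard_lab (i := inr false) _ lf) => //.
by case=> [l|[]].
Qed.

Lemma linear_morphN (N N' : lmodType F) (h : N -> N') : linear h -> {morph h : x / - x}.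
Proof.
move=> lh x; have h0 : h 0 = 0 by have := lh (-1) 0 0; rewrite scaler0 addr0 scaleN1r addNr.
by have := lh (-1) x 0; rewrite h0 !addr0 !scaleN1r.
Qed.

(** The tensor built from the dual pairs is antisymmetric. Exchanging the labels at a reversed edge
    therefore restores the sign lost with that edge. *)
Lemma gsplit_emb W L W' L' (X : dgraph O V W L) (Y : dgraph O V W' L') (phi : emb X Y) :
  natural f -> lab_linear f -> surj_emb phi ->
  gsplit X = (-1) ^+ sgn phi *: gsplit Y.
Proof.
move=> nf lf sphi; rewrite scalerA mulrC -scalerA; congr (_ *: _).
rewrite scaler_sumr; apply: eq_bigr => i _; rewrite /gcut -!big_split scaler_sumr.
apply: (@sum_rel _ _ _ (imatches phi)).
- exact: imatches_ex.
- by move=> e'; exact: imatches_surj sphi.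
- by move=> e e' e''; exact: imatches_fun.
- by move=> e e' e''; exact: imatches_inj.
move=> e e' [] m.
  have [g1 [s1 E1]] := cut_emb_ex (b := false) (p i) (q i) m sphi.
  have [g2 [s2 E2]] := cut_emb_ex (b := false) (q i) (- p i) m sphi.
  by rewrite (natural_std nf s1) (natural_std nf s2) E1 E2 addbF scalerDr.
(* The reversed case: the summand with labels [p i], [q i] becomes minus the one with [q i],
   [- p i], and conversely. *)
have [g1 [s1 E1]] := cut_emb_ex (b := true) (p i) (q i) m sphi.
have [g2 [s2 E2]] := cut_emb_ex (b := true) (q i) (- p i) m sphi.
rewrite (natural_std nf s1) (natural_std nf s2) E1 E2 addbT signrN scalerDr addrC.
rewrite (linear_morphN (h := fun x => f (standard (cut e' x (q i))))) => [|a x x'];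
  last exact: cut_linl.
rewrite (linear_morphN (h := fun x => f (standard (cut e' (q i) x)))) => [|a x x'];
  last exact: cut_linr.
by rewrite !scaleNr !scalerN opprK.
Qed.

Lemma gsplit_lab W L (G : graph W L) (d : forall w, O (ar G w)) (i : L) a
    (b b1 b2 : L -> V) : lab_linear f ->
  b i = a *: b1 i + b2 i -> (forall j, j != i -> b1 j = b j /\ b2 j = b j) ->
  gsplit (DGraph d b) = a *: gsplit (DGraph d b1) + gsplit (DGraph d b2).
Proof.
move=> lf bi bj; rewrite /gsplit scalerA mulrC -scalerA -scalerDr; congr (_ *: _).
rewrite scaler_sumr -big_split; apply: eq_bigr => k _ /=.
have E x y : gcut (DGraph d b) x y = a *: gcut (DGraph d b1) x y + gcut (DGraph d b2) x y.
  rewrite /gcut scaler_sumr -big_split; apply: eq_bigr => e _ /=.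
  apply: (standard_lab (i := inl i) _ lf) => //.
  by case=> [l|//] /= li; apply: bj; apply: contraNneq li => ->.
by rewrite !E scalerDr addrACA.
Qed.

Lemma gsplit_deco W L (G : graph W L) (b : L -> V) (i : W) a
    (d d1 d2 : forall w, O (ar G w)) : deco_linear f ->
  d i = a *: d1 i + d2 i -> (forall j, j != i -> d1 j = d j /\ d2 j = d j) ->
  gsplit (DGraph d b) = a *: gsplit (DGraph d1 b) + gsplit (DGraph d2 b).
Proof.
move=> lf di dj; rewrite /gsplit scalerA mulrC -scalerA -scalerDr; congr (_ *: _).
rewrite scaler_sumr -big_split; apply: eq_bigr => k _ /=.
have E x y : gcut (DGraph d b) x y = a *: gcut (DGraph d1 b) x y + gcut (DGraph d2 b) x y.
  rewrite /gcut scaler_sumr -big_split; apply: eq_bigr => e _ /=.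
  exact: (standard_deco (i := i) _ lf).
by rewrite !E scalerDr addrACA.
Qed.

Lemma gsplit_respects : respects f -> respects (fun X : hgraph O V => gsplit X).
Proof.
move=> [nf lf df]; split.
- by move=> X Y phi; exact: gsplit_emb.
- by move=> k l G d i a b b1 b2; exact: gsplit_lab.
- by move=> k l G b i a d d1 d2; exact: gsplit_deco.
Qed.

End Splits.

Section SplitMap.
Variables (F : fieldType) (O : cyclicOperad F) (V : vectType F).
Variables (n : nat) (p q : 'I_n -> V).
Let hc := @hclass F O V.

Lemma split_proj (X : hgraph O V) : qproj (hrelations O V)
  ((\dim {: V})%:R^-1 *: \sum_(e : iedge X) \sum_(i < n)
      (<< standard (cut e (p i) (q i)) >> + << standard (cut e (q i) (- p i)) >>)) =
  gsplit hc p q X.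
Proof.
rewrite linearZ linear_sum /=; congr (_ *: _).
under eq_bigr do rewrite linear_sum.
rewrite exchange_big; apply: eq_bigr => i _; rewrite /gcut -big_split.
by apply: eq_bigr => e _; rewrite linearD.
Qed.

Let rs := gsplit_respects p q (@hclass_respects F O V).

Lemma split_descends : descends (hrelations O V) (formal_split p q).
Proof. exact: fglift_descends split_proj rs. Qed.

Lemma split_linear : linear (@split_map F O V n p q).
Proof. exact: qinduced_fglift_linear split_proj rs. Qed.

HB.instance Definition _ :=
  GRing.isLinear.Build F (hairy O V) (hairy O V) *:%R (@split_map F O V n p q) split_linear.

Lemma split_hclass (X : hgraph O V) : split_map p q (hclass X) = gsplit hc p q X.
Proof. exact: (qinduced_hclass split_proj rs). Qed.

Lemma split_standard W L (X : dgraph O V W L) :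
  split_map p q (hclass (standard X)) = gsplit hc p q X.
Proof.
have [nh lh _] := @hclass_respects F O V.
rewrite split_hclass (gsplit_emb p q nh lh (@surj_std _ _ _ _ _ X)).
by rewrite (mono_sgn (@mono_std _ _ _ _ _ X)) scale1r.
Qed.

End SplitMap.

(** * Cutting commutes with contracting *)

Section CutContract.
Variables (F : fieldType) (O : cyclicOperad F) (V : vectType F).
Variables (W L : finType) (X : dgraph O V W L) (x y : V).

(** An edge is determined by its initial half, and the slots of the contracted and of the cut graph
    are slots of [X]. Both orders of operation are thus matched by two equations in [X]. *)
Definition same_edges (a : {e : nledge X & iedge (contract e)})
    (b : {k : iedge X & nledge (cut k x y)}) : Prop :=
  con_slot (ini (tagged a)) = ini (tag b) /\
  ini (val (tag a)) = ini (val (tagged b)) :> slot X.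

Lemma con_ini_ter (e : nledge X) (k : iedge (contract e)) (k' : iedge X) :
  con_slot (ini k) = ini k' -> con_slot (ter k) = ter k'.
Proof.
move=> E; apply: (@inl_inj _ L); rewrite -opp_ini -E.
have /= := con_oppE (inl (ini k)); rewrite
  -[X in X = _]/(sum_map _ id (opp (g := contract e) (inl (ini k)))).
by rewrite opp_ini => <-.
Qed.

Lemma con_cut_opp (e : nledge X) (k : iedge (contract e)) (k' : iedge X)
    (z : slot (contract e) + (L + bool)) :
  con_slot (ini k) = ini k' ->
  sum_map (con_slot (e := e)) id (cut_opp k z) =
  cut_opp k' (sum_map (con_slot (e := e)) id z).
Proof.
move=> E; have E' := con_ini_ter E; have I := @con_slot_inj _ _ X e.
have embE (z' : slot (contract e) + L) :
  sum_map (con_slot (e := e)) id (cut_emb z') = cut_emb (sum_map (con_slot (e := e)) id z').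
  by case: z'.
case: z => [h|[l|b]] /=.
- rewrite -E -E' !(inj_eq I); case: eqP => // _; case: eqP => // _.
  by rewrite embE con_oppE.
- by rewrite embE con_oppE.
- by case: b; rewrite ?E ?E'.
Qed.

(** Seen inside [X], the isomorphism is the identity on slots. On both sides the merged vertex comes
    first and all else keeps its order and direction, so no sign arises. *)
Lemma cut_contract_emb (a : {e : nledge X & iedge (contract e)})
    (b : {k : iedge X & nledge (cut k x y)}) : same_edges a b ->
  exists2 g : emb (cut (tagged a) x y) (contract (tagged b)), surj_emb g &
    sgn g = false.
Proof.
case: a b => [e k] [k' e'] [/= E1 E2].
have E3 : ter (val e) = ter (val e') :> slot X.
  rewrite -!oph_ini -E2; apply/esym/oph_cut.
  by rewrite E2 isint_ini.
have m : matches (to_cut k' x y) e e' by left; rewrite !to_cutE -E2 -E3.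
have [g0 [g0W g0S]] := contract_cemb m.
pose c := cemb_comp (of_cut k x y) g0.
have cS h : con_slot (eslot c h) = con_slot h.
  by rewrite eslot_comp g0S to_cutE of_cutE.
have gopp z : opp (sum_map (eslot c) id z) = sum_map (eslot c) id (opp z).
  have zE z' : sum_map (con_slot (e := e')) id (sum_map (eslot c) id z') =
               sum_map (con_slot (e := e)) id z'.
    by case: z' => [h|l]; rewrite /sum_map ?cS.
  by apply: con_sum_inj; rewrite con_oppE !zE [RHS](con_cut_opp _ E1).
pose g := @Emb _ _ _ _ _ _ _ (cut k x y) (contract e') c id (@inj_id _) gopp (fun=> erefl).
have gW w : eW g (insub w) = insub w by rewrite -[LHS]/(eW g0 _) g0W.
exists g.
  split=> [[u|]|l]; last by exists l.
    by exists (insub (val u)); rewrite gW valK.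
  exists (insub (tag (ini (val e)))); rewrite gW insubN // negb_and !negbK.
  by rewrite -E2 eqxx.
apply: mono_sgn; split; last by move=> h _; rewrite -[RHS]/(dir (con_slot h)) -cS.
have gN : eW g None = None.
  have -> : None = insub (tag (ini (val e))) :> con_vert e by rewrite insubN ?eqxx.
  by rewrite gW insubN // negb_and !negbK -E2 eqxx.
have gS (u : {w | (w != tag (ini (val e))) && (w != tag (ter (val e)))}) :
    exists2 v, eW g (Some u) = Some v & val v = val u.
  have uP : (val u != tag (ini (val e'))) && (val u != tag (ter (val e'))).
    by rewrite -E2 -E3; exact: (valP u).
  by rewrite -(valK u) gW insubT; exists (exist _ (val u) uP).
move=> [u|] [v|]; rewrite ?gN.
- have [u' -> uE] := gS u; have [v' -> vE] := gS v.
  by rewrite !rank_Some !ltnS !rank_val uE vE.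
- by rewrite !rank_None !ltn0.
- by have [v' -> vE] := gS v; rewrite !rank_None !rank_Some.
- by rewrite !rank_None !ltn0.
Qed.

Lemma cut_contract (M : lmodType F) (f : hgraph O V -> M) : natural f ->
  \sum_(e : nledge X) (-1) ^+ econ e *: gcut f (contract e) x y =
  \sum_(k : iedge X) gbd f (cut k x y).
Proof.
move=> nf; rewrite /gcut /gbd.
under eq_bigr do rewrite scaler_sumr.
rewrite [LHS]sig_big_dep [RHS]sig_big_dep /=.
apply: (@sum_rel _ _ _ same_edges).
- move=> [e k]; have [n1 n2] := con_slot_avoid (ini k); have [n3 n4] := con_slot_avoid (ter k).
  have [k' kE] : exists k' : iedge X, ini k' = con_slot (ini k).
    by apply: iedge_of; rewrite -?con_isint ?isint_ini // -[dir _]/(dir (ini k)) dir_ini.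
  have kE' : con_slot (ter k) = ter k' by apply: con_ini_ter.
  have hi : isint (G := cut k' x y) (ini (val e)).
    rewrite isint_cut isint_ini kE -kE' /=.
    by rewrite eq_sym n1 eq_sym n3.
  have [e' eE] := iedge_of hi (dir_ini (val e)).
  have tE : ter e' = ter (val e) :> slot X by rewrite -!oph_ini eE oph_cut.
  have P : tag (ini e') != tag (ter e') by rewrite eE tE; exact: (valP e).
  by exists (existT _ k' (exist _ e' P)).
- move=> [k e']; have := isint_ini (val e'); rewrite isint_cut => /and3P[hi n1 n2].
  have [e eE] := iedge_of hi (dir_ini (val e')).
  have tE : ter e = ter (val e') :> slot X by rewrite -!oph_ini eE oph_cut ?isint_ini.
  have P : tag (ini e) != tag (ter e) by rewrite eE tE; exact: (valP e').
  pose e0 : nledge X := exist _ e P.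
  have [h hE] : exists h, con_slot (e := e0) h = ini k.
    apply: con_slot_codom; rewrite /= ?eE; first by rewrite eq_sym.
    rewrite tE; apply/eqP => E; have /ini_ter : ini k = ter e by rewrite E tE.
    by [].
  have [k0 k0E] : exists k0 : iedge (contract e0), ini k0 = h.
    apply: iedge_of; first by rewrite con_isint hE isint_ini.
    by rewrite con_dir hE dir_ini.
  by exists (existT _ e0 k0); split; rewrite /= ?k0E ?eE.
- move=> [e k] [k1 e1] [k2 e2] [E1 E2] [E3 E4].
  have kk : k1 = k2 by apply: iedge_inj; rewrite -E1 -E3.
  subst k2; congr existT; apply: val_inj; apply: (@iedge_inj _ _ (cut k1 x y) (val e1) (val e2)).
  by rewrite -E2 -E4.
- move=> [e1 k1] [e2 k2] [k e] [E1 E2] [E3 E4].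
  have ee : e1 = e2 by apply/val_inj/iedge_inj; rewrite E2 E4.
  subst e2; congr existT; apply: (@iedge_inj _ _ (contract e1) k1 k2).
  by apply: con_slot_inj; rewrite E1 E3.
- move=> [e k] [k' e'] R; have [g sg gE] := cut_contract_emb R.
  rewrite /= (natural_std nf sg) gE scale1r; congr ((-1) ^+ nat_of_bool _ *: _).
  case: R => /= _ E2; rewrite /econ -E2; congr (cpar _ (tag _)).
  by rewrite -!oph_ini -E2; apply/esym/oph_cut; rewrite E2 isint_ini.
Qed.

End CutContract.

Section Commutation.
Variables (F : fieldType) (O : cyclicOperad F) (V : vectType F).
Variables (n : nat) (p q : 'I_n -> V).

Lemma split_bd x : split_map p q (bd x) = bd (@split_map F O V n p q x).
Proof.
have [nh lh _] := @hclass_respects F O V.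
rewrite -[LHS]/((split_map p q \o @bd F O V) x) -[RHS]/((@bd F O V \o split_map p q) x).
apply: linear_hairy_eq => [||X]; try exact: linearP.
rewrite /= bd_hclass split_hclass /gbd /gsplit linear_sum linearZ linear_sum.
under eq_bigr => e _ do rewrite linearZ /= split_standard /gsplit scalerA mulrC
  -scalerA scaler_sumr.
rewrite -scaler_sumr exchange_big; congr (_ *: _); apply: eq_bigr => i _ /=.
under eq_bigr => e _ do rewrite scalerDr.
rewrite big_split /= !(cut_contract _ _ _ nh) linearD /gcut !linear_sum; congr (_ + _);
  by apply: eq_bigr => k _; rewrite /= bd_standard.
Qed.

End Commutation.

(** * The exponential of the edge-splitting map *)

Section CardEdges.
Variables (F : fieldType) (O : cyclicOperad F) (V : vectType F).
Variables (W L : finType) (X : dgraph O V W L).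

Lemma card_iedge : #|iedge X| = #|[pred h : slot X | isint h && dir h]|.
Proof. by rewrite -!sum1_card (edge_big addn (fun=> 1%N)). Qed.

Lemma card_iedge_std : #|iedge (standard X)| = #|iedge X|.
Proof. exact: card_iedge_emb (@surj_std _ _ _ _ _ X). Qed.

Lemma card_iedge_contract (e : nledge X) : (#|iedge (contract e)| <= #|iedge X|)%N.
Proof.
rewrite -(card_image (f := fun k : iedge (contract e) => con_slot (ini k))); last first.
  by move=> k k' /con_slot_inj E; apply: (@iedge_inj _ _ (contract e)).
rewrite card_iedge; apply: subset_leq_card; apply/subsetP => h /imageP[k _ ->].
by rewrite inE -con_isint isint_ini -[dir _]/(dir (ini k)) dir_ini.
Qed.

End CardEdges.

Lemma card_iedge_cut (F : fieldType) (O : cyclicOperad F) (V : vectType F)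
    (W L : finType) (X : dgraph O V W L) (e : iedge X) (x y : V) :
  (#|iedge (cut e x y)| < #|iedge X|)%N.
Proof.
rewrite !card_iedge; apply: proper_card; apply/properP; split.
  apply/subsetP => h; rewrite !inE (@isint_cut _ _ _ _ _ X e x y h).
  by case/andP=> /and3P[-> _ _].
exists (ini e); first by rewrite inE isint_ini dir_ini.
by rewrite inE (@isint_cut _ _ _ _ _ X e x y (ini e)) eqxx andbF.
Qed.

Section Exponential.
Variables (F : fieldType) (O : cyclicOperad F) (V : vectType F).
Variables (n : nat) (p q : 'I_n -> V).
Local Notation S := (@split_map F O V n p q).

Lemma iter_linear (M : lmodType F) (h : M -> M) j : linear h -> linear (iter j h).
Proof. by move=> lh; elim: j => // j IH a x y /=; rewrite IH lh. Qed.

Lemma iter_split_proj j x : qproj (hrelations O V) (iter j (formal_split p q) x) =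
  iter j S (qproj (hrelations O V) x).
Proof.
elim: j => //= j <-; rewrite /split_map (qinducedE (split_descends p q)) //.
Qed.

Lemma iter_split_linear j : linear (iter j S).
Proof. by apply: iter_linear; exact: linearP. Qed.

HB.instance Definition _ j := GRing.isLinear.Build F (hairy O V) (hairy O V) *:%R
  (iter j S) (iter_split_linear j).

Lemma iter_split_eq0 j W L (X : dgraph O V W L) :
  (#|iedge X| < j)%N -> iter j S (hclass (standard X)) = 0.
Proof.
elim: j W L X => // j IH W L X lt; rewrite iterSr split_standard /gsplit linearZ linear_sum.
rewrite big1 /= ?scaler0 // => i _; rewrite linearD /gcut /= !linear_sum !big1 ?addr0 // => e _ /=;
  by apply: IH; apply: leq_trans (card_iedge_cut e _ _) _.
Qed.

Definition gexp (X : hgraph O V) : hairy O V :=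
  \sum_(j < #|iedge X|.+1) (j`!)%:R^-1 *: iter j S (hclass X).

Lemma exp_proj (X : hgraph O V) : qproj (hrelations O V)
  (\sum_(j < #|iedge X|.+1) (j`!)%:R^-1 *: iter j (formal_split p q) << X >>) = gexp X.
Proof.
rewrite linear_sum; apply: eq_bigr => j _.
by rewrite linearZ /= iter_split_proj.
Qed.

Lemma gexp_respects : respects gexp.
Proof.
have [nh lh dh] := @hclass_respects F O V; split.
- move=> X Y phi sphi; rewrite /gexp (card_iedge_emb sphi) scaler_sumr.
  apply: eq_bigr => j _; rewrite (nh _ _ _ sphi) linearZ /=.
  by rewrite !scalerA mulrC.
- move=> k l G d i a b b1 b2 bi bj; rewrite /gexp scaler_sumr -big_split.
  apply: eq_bigr => j _ /=; rewrite (lh _ _ _ _ _ _ _ _ _ bi bj) linearP.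
  by rewrite scalerDr !scalerA mulrC.
- move=> k l G b i a d d1 d2 di dj; rewrite /gexp scaler_sumr -big_split.
  apply: eq_bigr => j _ /=; rewrite (dh _ _ _ _ _ _ _ _ _ di dj) linearP.
  by rewrite scalerDr !scalerA mulrC.
Qed.

Lemma exp_descends : descends (hrelations O V) (formal_exp_split p q).
Proof. exact: fglift_descends exp_proj gexp_respects. Qed.

Lemma exp_linear : linear (@exp_split F O V n p q).
Proof. exact: qinduced_fglift_linear exp_proj gexp_respects. Qed.

HB.instance Definition _ := GRing.isLinear.Build F (hairy O V) (hairy O V) *:%R
  (@exp_split F O V n p q) exp_linear.

Lemma exp_hclass X : exp_split p q (hclass X) = gexp X.
Proof. exact: (qinduced_hclass exp_proj gexp_respects). Qed.

(** The sum defining e^S is truncated at a bound depending on the graph. As higher powers of S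
    vanish, a graph and its contractions, which have no more edges, can share one bound. *)
Lemma exp_bound W L (X : dgraph O V W L) N : (#|iedge X| < N)%N ->
  exp_split p q (hclass (standard X)) =
  \sum_(j < N) (j`!)%:R^-1 *: iter j S (hclass (standard X)).
Proof.
move=> lt; rewrite exp_hclass /gexp card_iedge_std.
rewrite -(big_mkord xpredT (fun j => (j`!)%:R^-1 *: iter j S (hclass (standard X)))).
rewrite -[RHS](big_mkord xpredT (fun j => (j`!)%:R^-1 *: iter j S (hclass (standard X)))).
rewrite [RHS](big_cat_nat (leq0n _) lt) //= [X in _ + X]big1_seq ?addr0 // => j.
by rewrite mem_index_iota => /andP[_ /andP[le _]]; rewrite iter_split_eq0 ?scaler0.
Qed.

Lemma exp_bd x : exp_split p q (bd x) = bd (@exp_split F O V n p q x).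
Proof.
rewrite -[LHS]/((exp_split p q \o @bd F O V) x) -[RHS]/((@bd F O V \o exp_split p q) x).
apply: linear_hairy_eq => [||X]; try exact: linearP.
rewrite /= exp_hclass /gexp linear_sum bd_hclass /gbd linear_sum.
have E j : bd (iter j S (hclass X)) = iter j S (gbd (@hclass F O V) X).
  by rewrite -bd_hclass; elim: j => //= j <-; rewrite split_bd.
transitivity (\sum_(e : nledge X) \sum_(j < #|iedge X|.+1)
    (j`!)%:R^-1 *: ((-1) ^+ econ e *: iter j S (hclass (standard (contract e))))).
  apply: eq_bigr => e _; rewrite linearZ /= (@exp_bound _ _ _ #|iedge X|.+1); last first.
    by rewrite ltnS card_iedge_contract.
  by rewrite scaler_sumr; apply: eq_bigr => j _; rewrite !scalerA mulrC.
rewrite exchange_big; apply: eq_bigr => j _ /=.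
rewrite linearZ /= E /gbd linear_sum scaler_sumr; apply: eq_bigr => e _.
by rewrite [in RHS]linearZ /=.
Qed.

End Exponential.

(** * The action on labels *)

Section Action.
Variables (F : fieldType) (O : cyclicOperad F) (V : vectType F).
Implicit Type g : 'End(V).

Definition map_lab_emb g W L W' L' (X : dgraph O V W L) (Y : dgraph O V W' L')
    (f : emb X Y) : emb (map_lab X g) (map_lab Y g).
Proof.
pose c : cemb (map_lab X g) (map_lab Y g) := @Cemb _ _ _ _ _ _ _ (map_lab X g)
  (map_lab Y g) (eW f) (fun w => eS f (w := w)) (@eW_inj _ _ _ _ _ _ _ _ _ f)
  (eS_bij f) (eS_deco f).
refine (@Emb _ _ _ _ _ _ _ (map_lab X g) (map_lab Y g) c (eL f)
  (@eL_inj _ _ _ _ _ _ _ _ _ f) (e_opp f) _).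
by move=> l; rewrite /= e_lab.
Defined.

Lemma map_lab_respects (M : lmodType F) (f : hgraph O V -> M) g : respects f ->
  respects (fun X : hgraph O V => f (HGraph (map_lab X g))).
Proof.
move=> [nf lf df]; split.
- by move=> X Y phi [sW sL]; exact: (nf (HGraph _) (HGraph _) (map_lab_emb g phi)).
- move=> k l G d i a b b1 b2 bi bj; apply: (lf _ _ _ _ i).
    by rewrite /= bi linearP.
  by move=> j /bj[/= -> ->].
- by move=> k l G b i a d d1 d2 di dj; exact: (df _ _ _ _ i).
Qed.

Lemma act_proj g (X : hgraph O V) : qproj (hrelations O V)
  (<< HGraph (map_lab X g) >> : {freeg (hgraph O V) / F}) = hclass (HGraph (map_lab X g)).
Proof. by []. Qed.

Let ra g := map_lab_respects g (@hclass_respects F O V).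

Lemma act_descends g : descends (hrelations O V) (formal_act g).
Proof. exact: fglift_descends (act_proj g) (ra g). Qed.

Lemma act_linear g : linear (@hact F O V g).
Proof. exact: qinduced_fglift_linear (act_proj g) (ra g). Qed.

HB.instance Definition _ g := GRing.isLinear.Build F (hairy O V) (hairy O V) *:%R
  (@hact F O V g) (act_linear g).

Lemma act_hclass g (X : hgraph O V) : hact g (hclass X) = hclass (HGraph (map_lab X g)).
Proof. exact: (qinduced_hclass (act_proj g) (ra g)). Qed.

Lemma act_hairless g (X : hgraph O V) : nl X = 0%N -> hact g (hclass X) = hclass X.
Proof.
case: X => k l [G d b] /= l0; subst l; rewrite act_hclass; congr hclass.
rewrite /map_lab /=; congr (HGraph (DGraph _ _)); by apply/funext => -[].
Qed.

End Action.

(** * Independence of the splitting tensor from the symplectic basis *)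

Section Symplectic.
Variables (F : fieldType) (V : vectType F) (omega : {skew_symmetric V}).
Variables (n : nat).

(** The expansion with respect to the dual vectors. It is the only property of a symplectic basis
    that the invariance of S uses. *)
Definition expands (p q : 'I_n -> V) : Prop := forall v,
  v = \sum_j (omega v (q j) *: p j - omega v (p j) *: q j).

Lemma omegaC u v : omega u v = - omega v u.
Proof. by rewrite hermC expr1 mulN1r. Qed.

Lemma expansion_linear (p q : 'I_n -> V) :
  linear (fun v => \sum_j (omega v (q j) *: p j - omega v (p j) *: q j)).
Proof.
move=> a u v; rewrite scaler_sumr -big_split; apply: eq_bigr => j _ /=.
rewrite !linearPl /= !scalerDl scalerBr !scalerA opprD addrACA.
by [].
Qed.

Lemma symplectic_expands p q : symplectic_basis omega p q -> expands p q.
Proof.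
move=> [bpq pq pp qq] v.
pose T v := \sum_j (omega v (q j) *: p j - omega v (p j) *: q j).
have lT : linear T by exact: expansion_linear.
pose T' : {linear V -> V} := HB.pack T (GRing.isLinear.Build _ _ _ _ _ lT).
rewrite -[RHS]/(T' v).
have Tp k : T' (p k) = p k.
  rewrite -[LHS]/(T (p k)) /T (bigD1 k) //= big1 ?addr0 => [|j jk].
    by rewrite pq pp eqxx scale1r scale0r subr0.
  by rewrite pq pp eq_sym (negPf jk) !scale0r subr0.
have Tq k : T' (q k) = q k.
  have qp i j : omega (q i) (p j) = - (j == i)%:R by rewrite omegaC pq.
  rewrite -[LHS]/(T (q k)) /T (bigD1 k) //= big1 ?addr0 => [|j jk].
    by rewrite qp qq eqxx scale0r scaleN1r opprK add0r.
  by rewrite qp qq (negPf jk) oppr0 !scale0r subr0.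
have : v \in <<in_tuple (codom p ++ codom q)>>%VS by rewrite (span_basis bpq) memvf.
move=> /coord_span vE; rewrite {1 2}vE linear_sum; apply: eq_bigr => i _.
rewrite linearZ; congr (_ *: _).
have : (in_tuple (codom p ++ codom q))`_i \in codom p ++ codom q.
  by rewrite mem_nth.
by rewrite mem_cat => /orP[] /codomP[k ->].
Qed.

Lemma Sp_expands (p q : 'I_n -> V) (g : 'End(V)) : in_Sp omega g ->
  expands p q -> expands (g \o p) (g \o q).
Proof.
(* The coefficients of the expansion of [u] are values of [omega], hence determined by [g u]. So [g]
   is injective, and invertible by finite dimension. *)
move=> gS E v; have k0 : lker g == 0%VS.
  apply/lker0P => u w guw; rewrite (E u) (E w); apply: eq_bigr => j _.
  by rewrite -(gS u (q j)) -(gS u (p j)) guw !gS.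
have <- : g (g^-1%VF v) = v by rewrite lker0_lfunVK.
rewrite {1}(E (g^-1%VF v)) linear_sum; apply: eq_bigr => j _ /=.
by rewrite linearB !linearZ /= !gS.
Qed.

(* Both sides are the image under B of the tensor sum of x (x) x^* , which does
   not depend on the symplectic basis. *)
Lemma expands_invariant (M : lmodType F) (B : V -> V -> M) (p q p' q' : 'I_n -> V) :
  (forall y, linear (B^~ y)) -> (forall x, linear (B x)) ->
  expands p q -> expands p' q' ->
  \sum_i (B (p' i) (q' i) + B (q' i) (- p' i)) =
  \sum_i (B (p i) (q i) + B (q i) (- p i)).
Proof.
move=> Bl Br E E'.
pose Bl' y : {linear V -> M} := HB.pack (B^~ y) (GRing.isLinear.Build _ _ _ _ _ (Bl y)).
pose Br' x : {linear V -> M} := HB.pack (B x) (GRing.isLinear.Build _ _ _ _ _ (Br x)).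
have BlE x y : B x y = \sum_j (omega x (q j) *: B (p j) y - omega x (p j) *: B (q j) y).
  rewrite -[LHS]/(Bl' y x) {1}(E x) linear_sum; apply: eq_bigr => j _.
  by rewrite linearB !linearZ.
have BN x y : B x (- y) = - B x y by rewrite -[LHS]/(Br' x (- y)) linearN.
(* The first arguments are expanded in the basis [p], [q]. The sums over [i] in the second arguments
   are then the expansions of [q j] and [p j] in the basis [p'], [q']. *)
transitivity (\sum_i \sum_j (B (p j) (omega (p' i) (q j) *: q' i - omega (q' i) (q j) *: p' i)
   - B (q j) (omega (p' i) (p j) *: q' i - omega (q' i) (p j) *: p' i))).
  apply: eq_bigr => i _; rewrite BN (BlE (p' i)) (BlE (q' i)) -sumrB.
  apply: eq_bigr => j _; rewrite -![B _ (_ *: _ - _)]/(Br' _ _) !linearB !linearZ /=.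
  by rewrite addrACA.
rewrite exchange_big; apply: eq_bigr => j _ /=.
have sB w (h : 'I_n -> V) : \sum_i B w (h i) = B w (\sum_i h i).
  by rewrite -[RHS]/(Br' w _) linear_sum.
rewrite sumrB !sB.
have Eq : \sum_i (omega (p' i) (q j) *: q' i - omega (q' i) (q j) *: p' i) = q j.
  rewrite [RHS]E'; apply: eq_bigr => i _.
  by rewrite (omegaC (q j)) (omegaC (q j)) !scaleNr opprK addrC.
have Ep : \sum_i (omega (p' i) (p j) *: q' i - omega (q' i) (p j) *: p' i) = p j.
  rewrite [RHS]E'; apply: eq_bigr => i _.
  by rewrite (omegaC (p j)) (omegaC (p j)) !scaleNr opprK addrC.
by rewrite Eq Ep BN.
Qed.

End Symplectic.

Section Invariance.
Variables (F : fieldType) (V : vectType F) (omega : {skew_symmetric V}).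
Variables (n : nat) (p q : 'I_n -> V) (Hpq : symplectic_basis omega p q).
Variable O : cyclicOperad F.
Variable g : 'End(V).
Hypothesis gS : in_Sp omega g.
Let hc := @hclass F O V.

Lemma act_standard_cut W L (X : dgraph O V W L) (e : iedge X) (x y : V) :
  HGraph (map_lab (standard (cut e x y)) g) =
  standard (cut (X := map_lab X g) e (g x) (g y)).
Proof.
congr (HGraph (DGraph _ _)); apply/funext => l /=.
by case: (enum_val l) => [l'|[]].
Qed.

Lemma gcut_linear W L (X : dgraph O V W L) :
  (forall y, linear (fun x => gcut hc X x y)) /\ (forall x, linear (gcut hc X x)).
Proof.
have [_ lh _] := @hclass_respects F O V.
split=> z a x y; rewrite /gcut scaler_sumr -big_split; apply: eq_bigr => e _.
  exact: cut_linl.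
exact: cut_linr.
Qed.

(** Acting after the cut uses the transformed basis for the new labels; [expands_invariant] returns
    to the original one. *)
Lemma act_split x : hact g (split_map p q x) = split_map p q (@hact F O V g x).
Proof.
rewrite -[LHS]/((@hact F O V g \o split_map p q) x) -[RHS]/((split_map p q \o @hact F O V g) x).
apply: linear_hairy_eq => [||X]; try exact: linearP.
rewrite /= act_hclass !split_hclass /gsplit linearZ linear_sum; congr (_ *: _).
have [Bl Br] := gcut_linear (map_lab X g).
have E := symplectic_expands Hpq.
rewrite -(expands_invariant Bl Br E (Sp_expands gS E)); apply: eq_bigr => i _.
rewrite linearD /gcut !linear_sum; congr (_ + _); apply: eq_bigr => e _;
  by rewrite /= act_hclass act_standard_cut ?linearN.
Qed.

Lemma act_exp x : hact g (exp_split p q x) = exp_split p q (@hact F O V g x).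
Proof.
rewrite -[LHS]/((@hact F O V g \o exp_split p q) x) -[RHS]/((exp_split p q \o @hact F O V g) x).
apply: linear_hairy_eq => [||X]; try exact: linearP.
rewrite /= act_hclass !exp_hclass /gexp linear_sum; apply: eq_bigr => j _.
rewrite linearZ /= -act_hclass; congr (_ *: _).
by elim: (j : nat) => //= i IH; rewrite act_split IH.
Qed.

Lemma act_hairless_span x :
  x \in graph_span (@connected_hairless F O V) -> hact g x = x.
Proof.
move=> /asboolP; elim=> [|c u v [X /andP[_ /eqP X0] ->] _ IH]; first exact: linear0.
by rewrite linearP /= IH act_hairless.
Qed.

Lemma exp_invariant x : x \in graph_span (@connected_hairless F O V) ->
  hact g (exp_split p q x) = exp_split p q x.
Proof. by move=> xG; rewrite act_exp act_hairless_span. Qed.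

End Invariance.

(** * Connectedness *)

Section Closed.
Variables (W L : finType) (G : graph W L).

Definition closedp (a : pred (W + L)) : Prop :=
  forall z, a (vend (opp z)) = a (vend (G := G) z).

Lemma adj_sym : symmetric (adj G).
Proof.
have H u v : adj G u v -> adj G v u.
  case/existsP => z /andP[zu zv]; apply/existsP; exists (opp z).
  by rewrite zv oppK.
by move=> u v; apply/idP/idP; apply: H.
Qed.

Lemma adj_connect_sym : connect_sym (adj G).
Proof. exact: sym_connect_sym adj_sym. Qed.

Lemma closedp_adj (a : pred (W + L)) : closedp a <-> closed (adj G) a.
Proof.
split=> [ca u v /existsP[z /andP[/eqP<- /eqP<-]]|ca z].
  by rewrite !unfold_in ca.
symmetry; apply: ca; apply/existsP; exists z; by rewrite !eqxx.
Qed.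

(** Connectedness without paths, so that it is transported along embeddings and contractions by
    composing predicates. Nonemptiness is included: the empty graph has no component. *)
Lemma gconnectedP : reflect ((exists u : W + L, True) /\
    forall a, closedp a -> forall u v, a u = a v) (gconnected G).
Proof.
apply: (iffP idP) => [|[[x _] H]].
  move=> /eqP/mem_card1[x xE].
  have rE u : fingraph.root (adj G) u = x.
    apply/eqP; have := xE (fingraph.root (adj G) u).
    by rewrite !inE roots_root //; exact: adj_connect_sym.
  split; first by exists x.
  move=> a /closedp_adj ca u v; apply: (closed_connect ca).
  by rewrite -(root_connect adj_connect_sym) !rE.
have cx : closedp (connect (adj G) x).
  apply/closedp_adj => u v uv; rewrite !unfold_in.
  exact: (same_connect_r adj_connect_sym (connect1 uv)).
rewrite /gconnected -(n_comp_connect adj_connect_sym x); apply/eqP/eq_n_comp_r => u.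
by apply/esym; have := H _ cx u x; rewrite connect0.
Qed.

End Closed.

Section ConnectedEmb.
Variables (F : fieldType) (O : cyclicOperad F) (V : vectType F).

Lemma vend_emb W L W' L' (X : dgraph O V W L) (Y : dgraph O V W' L') (f : emb X Y) z :
  vend (sum_map (eslot f) (eL f) z) = sum_map (eW f) (eL f) (vend z).
Proof. by case: z. Qed.

Lemma closedp_emb W L W' L' (X : dgraph O V W L) (Y : dgraph O V W' L') (f : emb X Y)
    (a : pred (W' + L')) : closedp Y a -> closedp X (a \o sum_map (eW f) (eL f)).
Proof. by move=> ca z; rewrite /= -!vend_emb -e_opp ca. Qed.

Lemma gconnected_emb W L W' L' (X : dgraph O V W L) (Y : dgraph O V W' L') (f : emb X Y) :
  surj_emb f -> gconnected X = gconnected Y.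
Proof.
have H W1 L1 W2 L2 (X1 : dgraph O V W1 L1) (Y1 : dgraph O V W2 L2) (g : emb X1 Y1) :
    surj_emb g -> gconnected X1 -> gconnected Y1.
  move=> [sW sL] /gconnectedP[[x _] cX]; apply/gconnectedP.
  split=> [|a ca u v]; first by exists (sum_map (eW g) (eL g) x).
  have sg w : exists w', sum_map (eW g) (eL g) w' = w.
    case: w => w; first by have [w' <-] := sW w; exists (inl w').
    by have [w' <-] := sL w; exists (inr w').
  by have [u' <-] := sg u; have [v' <-] := sg v; exact: (cX _ (closedp_emb g ca)).
move=> sf; apply/idP/idP; first exact: H sf.
by have [g [sg _ _ _ _]] := emb_inv sf; exact: H sg.
Qed.

Lemma gconnected_std W L (X : dgraph O V W L) : gconnected (standard X) = gconnected X.
Proof. exact: gconnected_emb (@surj_std _ _ _ _ _ X). Qed.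

Section Contract.
Variables (W L : finType) (X : dgraph O V W L) (e : nledge X).

Definition con_proj : W + L -> con_vert e + L :=
  sum_map (fun w => insub w : con_vert e) id.

Lemma con_proj_ini : con_proj (inl (tag (ini (val e)))) = inl None.
Proof. by rewrite /con_proj /= insubN // eqxx. Qed.

Lemma con_proj_ter : con_proj (inl (tag (ter (val e)))) = inl None.
Proof. by rewrite /con_proj /= insubN // eqxx andbF. Qed.

Lemma vend_con z : con_proj (vend (sum_map (con_slot (e := e)) id z)) =
  vend (G := contract e) z.
Proof. by case: z => [h|l] //=; rewrite /con_proj /= con_tag. Qed.

Lemma con_proj_surj u : exists v, con_proj v = u.
Proof.
case: u => [[u|]|l]; last by exists (inr l).
  by exists (inl (val u)); rewrite /con_proj /= valK.
by exists (inl (tag (ini (val e)))); exact: con_proj_ini.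
Qed.

Lemma con_proj_eq (u v : W + L) : con_proj u = con_proj v -> u = v \/
  con_proj u = inl None /\ con_proj v = inl None.
Proof.
case: u v => [u|l] [v|l'] //=; last by case=> ->; left.
rewrite /con_proj /=; case: insubP => [u' _ <-|_]; case: insubP => [v' _ <-|_] //.
  by case=> ->; left.
by right.
Qed.

Lemma con_proj_None u : con_proj u = inl None ->
  u = inl (tag (ini (val e))) \/ u = inl (tag (ter (val e))).
Proof.
case: u => // w; rewrite /con_proj /=; case: insubP => // + _.
by rewrite negb_and !negbK => /orP[] /eqP ->; [left|right].
Qed.

(** The contraction has all edges of [X] but [e], and a function that factors through the
    contraction is constant on [e]. A general target [T] serves both predicates and colorings. *)
Lemma closedp_con (T : eqType) (c : W + L -> T) (c' : con_vert e + L -> T) :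
  (forall u, c u = c' (con_proj u)) ->
  (forall z, c (vend (opp z)) = c (vend (G := X) z)) <->
  (forall z, c' (vend (opp z)) = c' (vend (G := contract e) z)).
Proof.
move=> cE; split=> H z.
  by rewrite -!vend_con con_oppE -!cE H.
have nn u v : u = inl (ini (val e)) \/ u = inl (ter (val e)) ->
    v = inl (ini (val e)) \/ v = inl (ter (val e)) -> c (vend u) = c (vend v).
  have ct : c (inl (tag (ini (val e)))) = c (inl (tag (ter (val e)))).
    by rewrite !cE con_proj_ini con_proj_ter.
  by case=> ->; case=> -> /=; rewrite ?ct.
have [->|n1] := pselect (z = inl (ini (val e))); first by rewrite opp_ini; apply: nn; auto.
have [->|n2] := pselect (z = inl (ter (val e))); first by rewrite opp_ter; apply: nn; auto.
have [z' z'E] : exists z', sum_map (con_slot (e := e)) id z' = z.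
  case: z n1 n2 => [h|l] n1 n2; last by exists (inr l).
  have [||h' hE] := @con_slot_codom _ _ X e h; last by exists (inl h'); rewrite /= hE.
    by apply/eqP => E; apply: n1; rewrite E.
  by apply/eqP => E; apply: n2; rewrite E.
by rewrite -z'E -con_oppE !cE !vend_con H.
Qed.

Lemma con_color (T : Type) (c : W + L -> T) :
  c (inl (tag (ini (val e)))) = c (inl (tag (ter (val e)))) ->
  exists c' : con_vert e + L -> T, forall u, c u = c' (con_proj u).
Proof.
move=> E; exists (fun u => match u with
  | inl (Some v) => c (inl (val v)) | inl None => c (inl (tag (ini (val e))))
  | inr l => c (inr l) end).
case=> [w|l] //; have [n|] := boolP ((w != tag (ini (val e))) && (w != tag (ter (val e)))).
  by rewrite /con_proj /= insubT.
move=> n; rewrite /con_proj /= insubN //; move: n.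
by rewrite negb_and !negbK => /orP[]/eqP ->.
Qed.

Lemma gconnected_contract : gconnected (contract e) = gconnected X.
Proof.
apply/gconnectedP/gconnectedP => -[[x _] H].
  split=> [|a ca u v]; first by have [y _] := con_proj_surj x; exists y.
  have [|a' aE] := con_color (c := a).
    by have := ca (inl (ter (val e))); rewrite opp_ter.
  by rewrite !aE; apply: H; have [h _] := closedp_con aE; exact: h.
split=> [|a ca u v]; first by exists (con_proj x).
have [u' <-] := con_proj_surj u; have [v' <-] := con_proj_surj v.
apply: (H (a \o con_proj)).
by have [_ h] := closedp_con (c := a \o con_proj) (c' := a) (fun=> erefl); exact: h.
Qed.

End Contract.
End ConnectedEmb.

Section Subcomplexes.
Variables (F : fieldType) (O : cyclicOperad F) (V : vectType F).

Lemma graph_span_class (P : pred (hgraph O V)) X : P X -> hclass X \in graph_span P.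
Proof. by move=> PX; apply: in_lspan; exists X. Qed.

Lemma graph_span_homo (P : pred (hgraph O V)) (S : {linear hairy O V -> hairy O V}) :
  (forall X, P X -> S (hclass X) \in graph_span P) ->
  {homo S : x / x \in graph_span P}.
Proof. by move=> H; apply: lspan_ind => _ [X PX ->]; exact: H. Qed.

Lemma bd_span (P : pred (hgraph O V)) :
  (forall (X : hgraph O V) (e : nledge X), P X -> P (standard (contract e))) ->
  {homo @bd F O V : x / x \in graph_span P}.
Proof.
move=> PC; apply: graph_span_homo => X PX.
rewrite -[X in X \in _]/(bd (hclass X)) bd_hclass /gbd rpred_sum // => e _.
by rewrite rpredZ // graph_span_class // PC.
Qed.

Lemma bd_span_PH : {homo @bd F O V : x / x \in graph_span (@connected_graph F O V)}.
Proof.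
apply: bd_span => X e; rewrite /connected_graph gconnected_std.
by rewrite gconnected_contract.
Qed.

Lemma bd_span_PG : {homo @bd F O V : x / x \in graph_span (@connected_hairless F O V)}.
Proof.
apply: bd_span => X e; rewrite /connected_hairless gconnected_std gconnected_contract.
by rewrite /= card_ord.
Qed.

Lemma gconnected_map_lab (X : hgraph O V) (g : 'End(V)) :
  gconnected (map_lab X g) = gconnected X.
Proof. by []. Qed.

Lemma act_span_PH (g : 'End(V)) :
  {homo @hact F O V g : x / x \in graph_span (@connected_graph F O V)}.
Proof.
apply: graph_span_homo => X PX.
by rewrite -[X in X \in _]/(hact g (hclass X)) act_hclass graph_span_class.
Qed.

End Subcomplexes.

(** * Restriction to a union of components *)

Section RestrictGraph.
Variables (W L : finType) (X : graph W L) (a : pred (W + L)).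
Hypothesis ca : closedp X a.

Definition rslot (h : {w : {w | a (inl w)} & 'I_(ar X (val w))}) : slot X :=
  existT (fun w => 'I_(ar X w)) (val (tag h)) (tagged h).

Lemma rslot_inj : injective rslot.
Proof.
move=> [[w wa] s] [[v va] t] E; have wv : w = v by exact: (congr1 tag E).
subst v; rewrite (bool_irrelevance va wa) in t E *; congr existT.
exact: (slot_inj (w := w)) E.
Qed.

Definition rleaf (l : {l | a (inr l)}) : L := val l.

Lemma rleaf_inj : injective rleaf.
Proof. exact: val_inj. Qed.

Lemma rslot_codom h : a (inl (tag h)) -> exists h', rslot h' = h.
Proof. by case: h => w s /= wa; exists (existT _ (exist _ w wa) s). Qed.

Lemma ropp (z : {w : {w | a (inl w)} & 'I_(ar X (val w))} + {l | a (inr l)}) :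
  exists z', sum_map rslot rleaf z' = opp (sum_map rslot rleaf z).
Proof.
have : a (vend (opp (sum_map rslot rleaf z))).
  by rewrite ca; case: z => [[[w wa] s]|[l la]].
case: (opp _) => [h|l] /= al.
  by have [h' <-] := rslot_codom al; exists (inl h').
by exists (inr (exist _ l al)).
Qed.

Definition rgraph : graph {w | a (inl w)} {l | a (inr l)} :=
  pull_graph (fun w => ar_ge3 X (val w)) rslot_inj rleaf_inj ropp.

End RestrictGraph.

Section Restrict.
Variables (F : fieldType) (O : cyclicOperad F) (V : vectType F).
Variables (W L : finType) (X : dgraph O V W L) (a : pred (W + L)).
Hypothesis ca : closedp X a.

Definition restr : dgraph O V {w | a (inl w)} {l | a (inr l)} :=
  @DGraph F O V _ _ (rgraph ca)
    (fun w => deco X (val w)) (fun l => lab X (val l)).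

Definition restr_cemb : cemb restr X :=
  @Cemb _ _ _ _ _ _ _ restr X val (fun _ => id) val_inj
    (fun w => @Bijective _ _ id id (frefl _) (frefl _))
    (fun w => esym (oact_id _)).

Lemma restr_oppE z : opp (sum_map (eslot restr_cemb) (@rleaf _ _ a) z) =
  sum_map (eslot restr_cemb) (@rleaf _ _ a) (opp z).
Proof. by apply/esym; apply: (@pull_oppE _ _ X _ _ _ (@rslot _ _ X a)); exact: ropp. Qed.

Definition restr_emb : emb restr X := Emb (@rleaf_inj _ _ a) restr_oppE (fun=> erefl).

Lemma mono_restr : mono_emb restr_emb.
Proof. by split=> [u v|//]; rewrite rank_val. Qed.

Lemma restr_image w : a (inl w) -> exists w', eW restr_emb w' = w.
Proof. by move=> wa; exists (exist _ w wa). Qed.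

Lemma restr_imageL l : a (inr l) -> exists l', eL restr_emb l' = l.
Proof. by move=> la; exists (exist _ l la). Qed.

End Restrict.

(** * Products of functionals, as sums over colorings *)

(** Several components may share a color and a color may be missing. Such colorings are eliminated
    only later, by functionals vanishing on disconnected and on empty graphs. *)
Definition coloring (W L : finType) (G : graph W L) (m : nat) : finType :=
  {c : {ffun W + L -> 'I_m} | [forall z, c (vend (opp z)) == c (vend (G := G) z)]}.

Section Coloring.
Variables (W L : finType) (G : graph W L) (m : nat).

Lemma coloringP (c : coloring G m) (z : slot G + L) : val c (vend (opp z)) = val c (vend z).
Proof. by have /forallP/(_ z)/eqP := valP c. Qed.

Lemma coloring_of (c : W + L -> 'I_m) :
  (forall z, c (vend (opp z)) = c (vend (G := G) z)) ->
  exists c' : coloring G m, forall u, val c' u = c u.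
Proof.
move=> cP; have P : [forall z, finfun c (vend (opp z)) == finfun c (vend (G := G) z)].
  by apply/forallP => z; rewrite !ffunE cP.
by exists (exist _ (finfun c) P) => u; rewrite /= ffunE.
Qed.

Lemma coloring_eq (c c' : coloring G m) : (forall u, val c u = val c' u) -> c = c'.
Proof. by move=> E; apply: val_inj; apply/ffunP. Qed.

Lemma coloring_closed (c : coloring G m) (i : 'I_m) :
  closedp G (fun u => val c u == i).
Proof. by move=> z; rewrite coloringP. Qed.

(* Parity of the shuffle that sorts the vertices by colour. *)
Definition crosspar (c : coloring G m) : bool :=
  pairpar (fun u v : W => (val c (inl u) != val c (inl v)) &&
    ((rank u < rank v)%N (+) (val c (inl u) < val c (inl v))%N)).

Lemma cross_sym (c : W -> 'I_m) : symmetric (fun u v : W => (c u != c v) &&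
    ((rank u < rank v)%N (+) (c u < c v)%N)).
Proof.
move=> u v; rewrite eq_sym; case: (eqVneq (c u) (c v)) => //= n.
have uv : u != v by apply: contraNneq n => ->.
rewrite (inj_ltnC (@rank_inj _) uv) (@inj_ltnC _ (fun i : 'I_m => i : nat) _ _ val_inj n).
by rewrite addbN addNb negbK.
Qed.

End Coloring.

Section Phi.
Variables (F : fieldType) (O : cyclicOperad F) (V : vectType F) (m : nat).
Implicit Type f : nat -> hgraph O V -> F^o.

Definition piece W L (X : dgraph O V W L) (c : coloring X m) (i : 'I_m) :=
  restr (coloring_closed c i).

Definition piece_emb W L (X : dgraph O V W L) (c : coloring X m) (i : 'I_m) :
  emb (piece c i) X := restr_emb (coloring_closed c i).

(** For two factors this is convolution with respect to the coproduct that distributes the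
    components over two graphs. Families are indexed by [nat], though only the indices below [m]
    count, so that they do not depend on [m]. *)
Definition colorprod f W L (X : dgraph O V W L) : F^o :=
  \sum_(c : coloring X m) (-1) ^+ crosspar c * \prod_(i < m) f i (standard (piece c i)).

Lemma piece_color W L (X : dgraph O V W L) (c : coloring X m) (i : 'I_m)
  (w : {w | val c (inl w) == i}) : val c (inl (eW (piece_emb c i) w)) = i.
Proof. exact/eqP/(valP w). Qed.

Lemma piece_colorL W L (X : dgraph O V W L) (c : coloring X m) (i : 'I_m)
  (l : {l | val c (inr l) == i}) : val c (inr (eL (piece_emb c i) l)) = i.
Proof. exact/eqP/(valP l). Qed.

Lemma piece_image W L (X : dgraph O V W L) (c : coloring X m) (i : 'I_m) w :
  val c (inl w) = i -> exists w', eW (piece_emb c i) w' = w.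
Proof. by move/eqP=> E; exact: restr_image. Qed.

Lemma piece_imageL W L (X : dgraph O V W L) (c : coloring X m) (i : 'I_m) l :
  val c (inr l) = i -> exists l', eL (piece_emb c i) l' = l.
Proof. by move/eqP=> E; exact: restr_imageL. Qed.

(** For embeddings with the same image, which may be a proper part of [Z]: since [be] respects order
    and directions, the comparison map carries the whole sign of [al]. *)
Lemma sgn_lift_mono WA LA WB LB W L (A : dgraph O V WA LA) (B : dgraph O V WB LB)
    (Z : dgraph O V W L) (al : emb A Z) (be : emb B Z) :
  mono_emb be ->
  (forall w, exists w', eW be w' = eW al w) -> (forall w, exists w', eW al w' = eW be w) ->
  (forall l, exists l', eL be l' = eL al l) -> (forall l, exists l', eL al l' = eL be l) ->
  exists ga : emb A B, surj_emb ga /\ sgn ga = sgn al.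
Proof.
move=> [mW mD] h1 h2 h3 h4; have [ga [gW gS gL]] := emb_lift h1 h3.
exists ga; split.
  split=> [w|l].
    by have [w' E] := h2 w; exists w'; apply: (@eW_inj _ _ _ _ _ _ _ _ _ be); rewrite gW.
  by have [l' E] := h4 l; exists l'; apply: (@eL_inj _ _ _ _ _ _ _ _ _ be); rewrite gL.
congr addb; first by apply: eq_pairpar => u v; rewrite /dis /= -!gW !mW.
by apply: eq_bigr => h /andP[hi _]; rewrite -gS mD // isint_emb.
Qed.

Lemma prod_sign (P : pred 'I_m) (b : 'I_m -> bool) :
  \prod_(i < m | P i) (-1) ^+ b i = (-1) ^+ (\big[addb/false]_(i < m | P i) b i) :> F.
Proof.
apply/esym/(big_morph (fun x : bool => (-1) ^+ x)) => [x y|]; last by [].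
exact: signr_addb.
Qed.

(** Inversions of [phi] between vertices of one color appear in the signs of the pieces. Those
    between different colors are the difference of the shuffle parities, since the color comparison
    cancels. Each internal edge lies in one piece. *)
Lemma sgn_pieces W L W' L' (X : dgraph O V W L) (Y : dgraph O V W' L') (phi : emb X Y)
    (c : coloring X m) (c' : coloring Y m) : surj_emb phi ->
  (forall u, val c u = val c' (sum_map (eW phi) (eL phi) u)) ->
  crosspar c (+) \big[addb/false]_(i < m) sgn (emb_comp (piece_emb c i) phi) =
  sgn phi (+) crosspar c'.
Proof.
move=> sphi cE; have bphi := surj_emb_bij sphi.
rewrite /sgn big_split /=.
have -> : \big[addb/false]_(i < m) dirpar (emb_comp (piece_emb c i) phi) = dirpar phi.
  rewrite /dirpar [RHS](partition_big (fun h : slot X => val c (inl (tag h))) xpredT) //=.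
  apply: eq_bigr => i _; set pe := piece_emb c i.
  pose r (h : slot X) := [pick h' | eslot pe h' == h].
  rewrite [RHS](reindex_omap (eslot pe) r) => [|h /andP[_ /eqP hi]]; last first.
    have [h' h'E] := eslot_surj (f := pe) (piece_image hi).
    by rewrite /r; case: pickP => [h'' /eqP E|/(_ h')] /=; rewrite ?E // h'E eqxx.
  have aux (h : slot (piece c i)) :
      isint (eslot pe h) && dir (eslot pe h) = isint h && dir h.
    rewrite isint_emb; have [hi|//] := boolP (isint h).
    by have [_ ->] := mono_restr (coloring_closed c i).
  apply: eq_big => [h|h _ //]; rewrite aux piece_color eqxx andbT.
  rewrite /r; case: pickP => [h' /eqP/eslot_inj ->|/(_ h)]; rewrite eqxx ?andbT //.
rewrite addbA [in RHS]addbAC; congr addb.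
have symD : symmetric (dis (@rank W) (@rank W' \o eW phi)).
  by apply: dis_sym; [exact: rank_inj | exact: inj_comp (@rank_inj _)
    (@eW_inj _ _ _ _ _ _ _ _ _ phi)].
rewrite {2}/ordpar (pairpar_color (fun w => val c (inl w)) symD).
rewrite addbAC; congr addb; last first.
  apply: eq_bigr => i _; apply: eq_pairpar => u v.
  by rewrite /dis /= -rank_val.
rewrite /crosspar (pairpar_bij bphi (cross_sym (fun w => val c' (inl w)))) -pairparD.
apply: eq_pairpar => u v; rewrite !cE /= /dis /=.
by case: (val c' _ != val c' _) => //=; rewrite addbA; case: (_ < _)%N; case: (_ < _)%N;
  case: (_ < _)%N.
Qed.

Lemma colorprod_emb f W L W' L' (X : dgraph O V W L) (Y : dgraph O V W' L') (phi : emb X Y) :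
  (forall i, natural (f i)) -> surj_emb phi ->
  colorprod f X = (-1) ^+ sgn phi *: colorprod f Y.
Proof.
move=> nf sphi; have [psi [spsi psiK psiK' _ psiL]] := emb_inv sphi.
have phiL : cancel (eL phi) (eL psi).
  by move=> l; apply: (@eL_inj _ _ _ _ _ _ _ _ _ phi); rewrite psiL.
pose s := sum_map (eW phi) (eL phi); pose t := sum_map (eW psi) (eL psi).
have sK : cancel s t by case=> u; rewrite /s /t /= ?psiK ?phiL.
have tK : cancel t s by case=> u; rewrite /s /t /= ?psiK' ?psiL.
rewrite /colorprod scaler_sumr.
apply: (@sum_rel _ _ _ (fun (c : coloring X m) (c' : coloring Y m) =>
  forall u, val c u = val c' (s u))).
- move=> c; have [|c' c'E] := coloring_of (G := Y) (c := fun u => val c (t u)).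
    by move=> z; rewrite /t -!(vend_emb psi) -e_opp coloringP.
  by exists c' => u; rewrite c'E sK.
- move=> c'; have [|c cE] := coloring_of (G := X) (c := fun u => val c' (s u)).
    by move=> z; rewrite /s -!(vend_emb phi) -e_opp coloringP.
  by exists c.
- by move=> c c' c'' E E'; apply: coloring_eq => u; rewrite -(tK u) -E E'.
- by move=> c c' c'' E E'; apply: coloring_eq => u; rewrite E E'.
move=> c c' cE.
have [g gP] : exists g : 'I_m -> bool, forall i : 'I_m,
    f i (standard (piece c i)) = (-1) ^+ g i * f i (standard (piece c' i)) /\
    g i = sgn (emb_comp (piece_emb c i) phi).
  exists (fun i => sgn (emb_comp (piece_emb c i) phi)) => i; split=> //.
  have [] := @sgn_lift_mono _ _ _ _ _ _ _ _ _ (emb_comp (piece_emb c i) phi) (piece_emb c' i).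
  - exact: mono_restr.
  - move=> w /=; apply: piece_image.
    by rewrite -(cE (inl _)) piece_color.
  - move=> w; have [v vE] := sphi.1 (eW (piece_emb c' i) w).
    have [u uE] : exists u, eW (piece_emb c i) u = v.
      by apply: piece_image; rewrite (cE (inl v)) /= vE piece_color.
    by exists u; rewrite -vE -uE.
  - move=> w /=; apply: piece_imageL.
    by rewrite -(cE (inr _)) piece_colorL.
  - move=> w; have [v vE] := sphi.2 (eL (piece_emb c' i) w).
    have [u uE] : exists u, eL (piece_emb c i) u = v.
      by apply: piece_imageL; rewrite (cE (inr v)) /= vE piece_colorL.
    by exists u; rewrite -vE -uE.
  by move=> ga [sga <-]; exact: natural_std sga.
rewrite (eq_bigr (fun i : 'I_m => (-1) ^+ g i * f i (standard (piece c' i)))); last first.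
  by move=> i _; have [] := gP i.
rewrite big_split /= prod_sign [_ *: _]mulrA mulrA -!signr_addb.
congr ((-1) ^+ nat_of_bool _ * _); rewrite -(sgn_pieces sphi cE); congr addb.
by apply: eq_bigr => i _; have [] := gP i.
Qed.

(** For a given coloring only one factor sees the leaf [l], namely that of the color of [l]. *)
Lemma colorprod_lab f W L (G : graph W L) (d : forall w, O (ar G w)) (l : L) a
    (b b1 b2 : L -> V) : (forall i, lab_linear (f i)) ->
  b l = a *: b1 l + b2 l -> (forall j, j != l -> b1 j = b j /\ b2 j = b j) ->
  colorprod f (DGraph d b) = a *: colorprod f (DGraph d b1) + colorprod f (DGraph d b2).
Proof.
move=> lf bl bj; rewrite /colorprod scaler_sumr -big_split; apply: eq_bigr => c _ /=.
pose i := val c (inr l).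
have E (b' : L -> V) : (forall j, j != l -> b' j = b j) -> forall k, k != i ->
    f k (standard (piece (c : coloring (DGraph d b') m) k)) =
      f k (standard (piece (c : coloring (DGraph d b) m) k)).
  move=> b'E k ki; congr (f k (standard _)); rewrite /piece /restr /=.
  congr (@DGraph F O V _ _ _ _ _); apply/funext => -[j jk] /=.
  apply: b'E; apply: contraNneq ki => jl; rewrite /i -jl eq_sym; exact: jk.
have P (b' : L -> V) : (forall j, j != l -> b' j = b j) ->
    \prod_(k < m) f k (standard (piece (c : coloring (DGraph d b') m) k)) =
    f i (standard (piece (c : coloring (DGraph d b') m) i)) *
    \prod_(k < m | k != i) f k (standard (piece (c : coloring (DGraph d b) m) k)).
  by move=> b'E; rewrite (bigD1 i) //=; congr (_ * _); apply: eq_bigr => k ki; exact: E.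
rewrite (P b) // (P b1) => [|j /bj[]//]; rewrite (P b2) => [|j /bj[]//].
have -> : f i (standard (piece (c : coloring (DGraph d b) m) i)) =
    a *: f i (standard (piece (c : coloring (DGraph d b1) m) i)) +
    f i (standard (piece (c : coloring (DGraph d b2) m) i)).
  pose l' : {j | val c (inr j) == i} := exist _ l (eqxx _).
  apply: (standard_lab (i := l') _ (lf i)) => //.
  move=> [j jP] jl; apply: bj; apply: contraNneq jl => jl; apply/eqP/val_inj.
  exact: jl.
by rewrite mulrDl mulrDr; congr (_ + _); rewrite /GRing.scale /= -mulrA mulrCA.
Qed.

Lemma colorprod_deco f W L (G : graph W L) (b : L -> V) (w : W) a
    (d d1 d2 : forall w, O (ar G w)) : (forall i, deco_linear (f i)) ->
  d w = a *: d1 w + d2 w -> (forall j, j != w -> d1 j = d j /\ d2 j = d j) ->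
  colorprod f (DGraph d b) = a *: colorprod f (DGraph d1 b) + colorprod f (DGraph d2 b).
Proof.
move=> lf dl dj; rewrite /colorprod scaler_sumr -big_split; apply: eq_bigr => c _ /=.
pose i := val c (inl w).
have E (d' : forall w, O (ar G w)) : (forall j, j != w -> d' j = d j) -> forall k, k != i ->
    f k (standard (piece (c : coloring (DGraph d' b) m) k)) =
      f k (standard (piece (c : coloring (DGraph d b) m) k)).
  move=> d'E k ki; congr (f k (standard _)); rewrite /piece /restr /=.
  congr (@DGraph F O V _ _ _ _ _).
  apply/functional_extensionality_dep => -[j jk] /=.
  apply: d'E; apply: contraNneq ki => jl; rewrite /i -jl eq_sym; exact: jk.
have P (d' : forall w, O (ar G w)) : (forall j, j != w -> d' j = d j) ->
    \prod_(k < m) f k (standard (piece (c : coloring (DGraph d' b) m) k)) =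
    f i (standard (piece (c : coloring (DGraph d' b) m) i)) *
    \prod_(k < m | k != i) f k (standard (piece (c : coloring (DGraph d b) m) k)).
  by move=> d'E; rewrite (bigD1 i) //=; congr (_ * _); apply: eq_bigr => k ki; exact: E.
rewrite (P d) // (P d1) => [|j /dj[]//]; rewrite (P d2) => [|j /dj[]//].
have -> : f i (standard (piece (c : coloring (DGraph d b) m) i)) =
    a *: f i (standard (piece (c : coloring (DGraph d1 b) m) i)) +
    f i (standard (piece (c : coloring (DGraph d2 b) m) i)).
  pose w' : {j | val c (inl j) == i} := exist _ w (eqxx _).
  apply: (standard_deco (i := w') _ (lf i)) => //.
  move=> [j jP] jl; apply: dj; apply: contraNneq jl => jl; apply/eqP/val_inj.
  exact: jl.
by rewrite mulrDl mulrDr; congr (_ + _); rewrite /GRing.scale /= -mulrA mulrCA.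
Qed.

Lemma colorprod_respects f : (forall i, respects (f i)) ->
  respects (fun X : hgraph O V => colorprod f X).
Proof.
move=> rf; split.
- by move=> X Y phi; apply: colorprod_emb => i; case: (rf i).
- by move=> k l G d i a b b1 b2; apply: colorprod_lab => j; case: (rf j).
- by move=> k l G b i a d d1 d2; apply: colorprod_deco => j; case: (rf j).
Qed.

Lemma colorprod_standard f W L (X : dgraph O V W L) : (forall i, natural (f i)) ->
  colorprod f (standard X) = colorprod f X.
Proof.
move=> nf; rewrite (colorprod_emb nf (@surj_std _ _ _ _ _ X)).
by rewrite (mono_sgn (@mono_std _ _ _ _ _ X)) scale1r.
Qed.

End Phi.

(** * Boundary of a product *)

Section PieceOf.
Variables (F : fieldType) (O : cyclicOperad F) (V : vectType F).

(* Determines (P, pe) up to isomorphism, see piece_iso. *)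
Record is_piece (T : Type) W L (X : dgraph O V W L) (c : W + L -> T) (i : T)
    WP LP (P : dgraph O V WP LP) (pe : emb P X) : Prop := IsPiece {
  piece_mono : mono_emb pe;
  piece_col : forall w, c (inl (eW pe w)) = i;
  piece_colL : forall l, c (inr (eL pe l)) = i;
  piece_im : forall w, c (inl w) = i -> exists w', eW pe w' = w;
  piece_imL : forall l, c (inr l) = i -> exists l', eL pe l' = l }.

Lemma pieceP m W L (X : dgraph O V W L) (c : coloring X m) (i : 'I_m) :
  is_piece (val c) i (piece_emb c i).
Proof.
split; [exact: mono_restr|exact: piece_color|exact: piece_colorL|
  exact: piece_image|exact: piece_imageL].
Qed.

Lemma piece_iso (T : Type) W L (X : dgraph O V W L) (c : W + L -> T) (i : T)
    WP LP (P : dgraph O V WP LP) (pe : emb P X)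
    WQ LQ (Q : dgraph O V WQ LQ) (qe : emb Q X) :
  is_piece c i pe -> is_piece c i qe ->
  exists g : emb P Q, surj_emb g /\ sgn g = false.
Proof.
move=> [pm pc pcL pim pimL] [qm qc qcL qim qimL].
have [|||||h [sh hE]] := @sgn_lift_mono _ _ _ _ _ _ _ _ _ _ _ _ pe qe.
- exact: qm.
- by move=> w; apply: qim.
- by move=> w; apply: pim.
- by move=> w; apply: qimL.
- by move=> w; apply: pimL.
- by exists h; rewrite hE mono_sgn.
Qed.

Lemma mono_lt WA LA W L (A : dgraph O V WA LA) (X : dgraph O V W L) (f : emb A X) u v :
  mono_emb f -> (rank (eW f u) < rank (eW f v))%N = (rank u < rank v)%N.
Proof. by case. Qed.

Lemma mono_contract W L W' L' (X : dgraph O V W L) (Y : dgraph O V W' L')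
    (f : emb X Y) (e : nledge X) (e' : nledge Y) (g : emb (contract e) (contract e')) :
  eslot f (ini (val e)) = ini (val e') -> eslot f (ter (val e)) = ter (val e') ->
  (forall w, eW g (insub w) = insub (eW f w)) ->
  (forall h, con_slot (eslot g h) = eslot f (con_slot h)) ->
  mono_emb f -> mono_emb g.
Proof.
move=> E1 E2 gW gS [mf df]; split=> [|h hi]; last first.
  by rewrite con_dir gS df -?con_isint.
have T1 : eW f (tag (ini (val e))) = tag (ini (val e')) by rewrite -E1.
have T2 : eW f (tag (ter (val e))) = tag (ter (val e')) by rewrite -E2.
have gN : eW g None = None.
  have -> : None = insub (tag (ini (val e))) :> con_vert e by rewrite insubN ?eqxx.
  by rewrite gW T1 insubN // eqxx.
have gSm (u : {w | (w != tag (ini (val e))) && (w != tag (ter (val e)))}) :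
    exists2 v, eW g (Some u) = Some v & val v = eW f (val u).
  have uP : (eW f (val u) != tag (ini (val e'))) && (eW f (val u) != tag (ter (val e'))).
    by rewrite -T1 -T2 !(inj_eq (@eW_inj _ _ _ _ _ _ _ _ _ f)); exact: (valP u).
  by rewrite -(valK u) gW insubT; exists (exist _ (eW f (val u)) uP).
move=> [u|] [v|]; rewrite ?gN.
- have [u' -> uE] := gSm u; have [v' -> vE'] := gSm v.
  by rewrite !rank_Some !ltnS !rank_val uE vE'.
- by rewrite !rank_None !ltn0.
- by have [v' -> _] := gSm v; rewrite !rank_None !rank_Some.
- by rewrite !rank_None !ltn0.
Qed.

(** Stated with variables [z] and [w], so that their equations can be substituted in the dependent
    types of the decorations. *)
Lemma con_deco_lift W L (X : dgraph O V W L) (e : nledge X) (z : con_vert e) (w : W) u n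
    (s : 'I_n -> 'I_(ar (contract e) z)) (t : 'I_n -> 'I_(ar X w)) x :
  z = Some u -> w = val u ->
  (forall r, con_slot (existT _ z (s r)) = existT (fun w => 'I_(ar X w)) w (t r)) ->
  deco (contract e) z = oact O s x -> deco X w = oact O t x.
Proof.
move=> zE wE; subst z w => st /= ->; congr (oact O _ _); apply/funext => r.
exact: slotP (st r).
Qed.

End PieceOf.

Section OneEdge.
Variables (F : fieldType) (O : cyclicOperad F) (V : vectType F) (T : eqType).
Variables (W L : finType) (X : dgraph O V W L) (e : nledge X).
Variables (c : W + L -> T) (c' : con_vert e + L -> T).
Hypothesis cE : forall u, c u = c' (con_proj e u).
Variables (WP LP : finType) (P : dgraph O V WP LP) (pe : emb P X).
Variables (WQ LQ : finType) (Q : dgraph O V WQ LQ) (qe : emb Q (contract e)).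

(** The embedding of the piece containing [e] induces one of the contractions, whose image is the
    part of color [i] of the contracted graph; [piece_iso] concludes. *)
Lemma contract_piece i (ei : nledge P) : is_piece c i pe -> is_piece c' i qe ->
  eslot pe (ini (val ei)) = ini (val e) ->
  exists g : emb (contract ei) Q, surj_emb g /\ sgn g = false.
Proof.
move=> [pm pc pcL pim pimL] ipq eE.
have tE : eslot pe (ter (val ei)) = ter (val e).
  by rewrite -!oph_ini -oph_emb ?isint_ini // eE.
have [|g [gW gS gL]] := @contract_emb _ _ _ _ _ _ _ _ _ pe ei e; first by left.
apply: (piece_iso (c := c') (i := i) (pe := g) _ ipq); split.
- exact: (mono_contract eE tE gW gS pm).
- move=> w; have [u <-] : exists u, insub u = w.
    case: w => [u|]; first by exists (val u); rewrite valK.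
    by exists (tag (ini (val ei))); rewrite insubN // eqxx.
  by rewrite gW -[inl _]/(con_proj e (inl (eW pe u))) -cE.
- by move=> l; rewrite gL -[inr _]/(con_proj e (inr (eL pe l))) -cE.
- move=> w wi; have [u uE] : exists u : W, con_proj e (inl u) = inl w.
    by have [[u|l] //= uE] := con_proj_surj (inl w : con_vert e + L); exists u.
  have ui : c (inl u) = i by rewrite cE uE.
  have [v vE'] := pim _ ui; exists (insub v); rewrite gW vE'.
  exact: inl_inj uE.
- by move=> l li; rewrite gL; apply: pimL; rewrite cE.
Qed.

(** A part of another color does not meet the merged vertex, so its slots lift to [X] through
    [con_slot] and exhibit it as a piece of [X]. *)
Lemma other_piece i : c (inl (tag (ini (val e)))) != i ->
  is_piece c i pe -> is_piece c' i qe ->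
  exists g : emb Q P, surj_emb g /\ sgn g = false.
Proof.
move=> ei ip [qm qc qcL qim qimL]; set a := tag (ini (val e)) in ei.
have ec : c (inl (tag (ter (val e)))) = c (inl a).
  by rewrite !cE con_proj_ini con_proj_ter.
have wS (w : WQ) : exists u : {w | (w != a) && (w != tag (ter (val e)))}, eW qe w = Some u.
  case E : (eW qe w) => [u|]; first by exists u.
  by have := qc w; rewrite E -(con_proj_ini e) -cE => E'; rewrite E' eqxx in ei.
pose fW w := if eW qe w is Some u then val u else a.
have fWE w : con_proj e (inl (fW w)) = inl (eW qe w).
  by have [u uE] := wS w; rewrite /fW uE /con_proj /= valK.
have fWc w : c (inl (fW w)) = i by rewrite cE fWE.
pose phi (h : slot Q) : slot X := con_slot (eslot qe h).
have phit h : tag (phi h) = fW (tag h).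
  have := con_tag (eslot qe h); rewrite -/(phi h) /fW.
  have [u uE] := wS (tag h); rewrite -[tag (eslot qe h)]/(eW qe (tag h)) uE.
  by case: insubP => [u' _ <- [->]|].
have phii : injective phi.
  by move=> h h' /(@con_slot_inj _ _ X e); exact: (@eslot_inj _ _ _ _ _ _ _ _ _ qe h h').
have fWi : injective fW.
  move=> w w' E; apply: (@eW_inj _ _ _ _ _ _ _ _ _ qe).
  by apply: (@inl_inj _ L); rewrite -!fWE E.
have [|||||f0 [f0W f0S]] := @cemb_of_slots _ O V _ _ _ _ Q X fW phi.
- exact: fWi.
- exact: phii.
- exact: phit.
- move=> h0 w hw; have hj : c (inl (tag h0)) = i by rewrite -hw fWc.
  have [|| h1 h1E] := @con_slot_codom _ _ X e h0.
  + by apply: contraNneq ei => E; rewrite -hj E.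
  + by apply: contraNneq ei => E; rewrite -hj E -ec.
  have [h2 h2E] : exists h2, eslot qe h2 = h1.
    apply: eslot_surj; apply: qim.
    have := con_tag h1; rewrite h1E => <-.
    by rewrite -[inl _]/(con_proj e (inl (tag h0))) -cE.
  by exists h2; rewrite /phi h2E h1E.
- move=> w s sb sE; have [u uE] := wS w.
  apply: (con_deco_lift (e := e) (s := eS qe (w := w)) uE _ sE (eS_deco qe w)).
  by rewrite /fW uE.
have f0opp z : opp (sum_map (eslot f0) (eL qe) z) = sum_map (eslot f0) (eL qe) (opp z).
  have zE y : sum_map (eslot f0) (eL qe) y =
      sum_map (con_slot (e := e)) id (sum_map (eslot qe) (eL qe) y).
    by case: y => [h|l] //; rewrite /sum_map f0S.
  by rewrite !zE -con_oppE e_opp.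
pose f := @Emb _ _ _ _ _ _ _ Q X f0 (eL qe) (@eL_inj _ _ _ _ _ _ _ _ _ qe) f0opp (e_lab qe).
apply: (piece_iso (c := c) (i := i) (pe := f) _ ip); split.
- split=> [u v|h hi].
    rewrite -(mono_lt _ _ qm) -[eW f]/(eW f0) !f0W.
    have [u' uE] := wS u; have [v' vE] := wS v.
    by rewrite /fW uE vE !rank_Some !ltnS !rank_val.
  by rewrite -[eslot f h]/(eslot f0 h) f0S -con_dir qm.2.
- by move=> w; rewrite -[eW f]/(eW f0) f0W fWc.
- by move=> l; rewrite cE -[eL f]/(eL qe) [con_proj e _]/=; exact: qcL.
- move=> w wi; have := wi; rewrite cE.
  case wE : (con_proj e (inl w)) => [w'|] // /qim[w'' w''E].
  exists w''; rewrite -[eW f]/(eW f0) f0W.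
  have := fWE w''; rewrite w''E -wE => /con_proj_eq[[//]|[_ N]].
  have := con_proj_None N => -[[E]|[E]]; move: ei; rewrite -wi E ?ec eqxx //.
- by move=> l li; apply: qimL; rewrite -li cE.
Qed.

End OneEdge.

(** * The sign in the Leibniz rule *)

Section CrossSign.
Variables (W : finType) (m : nat) (c : W -> 'I_m) (i : 'I_m) (a b : W).
Hypotheses (ab : a != b) (ca : c a = i) (cb : c b = i).

Definition cross (T : finType) (k : T -> 'I_m) : bool :=
  pairpar (fun u v => (k u != k v) && ((rank u < rank v)%N (+) (k u < k v)%N)).

Lemma cpar_sub (T : finType) (f : T -> W) (P : pred W) (a' b' : T) :
  {mono f : u v / (rank u < rank v)%N} -> injective f ->
  (forall t, P (f t)) -> (forall u, P u -> exists t, f t = u) ->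
  f a' = a -> f b' = b ->
  cpar a' b' = (rank b < rank a)%N (+) \big[addb/false]_(u | (u != a) && (u != b))
    (P u && ((rank u < rank a)%N (+) (rank u < rank b)%N)).
Proof.
move=> fm fi fP Pf aE bE; rewrite /cpar -fm aE bE; congr addb.
rewrite [RHS]big_mkcond (bigID P) /= [X in _ = _ (+) X]big1 ?addbF => [|u /negPf->]; last first.
  by case: ifP.
pose r u := [pick t | f t == u].
rewrite [RHS](reindex_omap f r) => [|u Pu]; last first.
  have [t tE] := Pf _ Pu; rewrite /r; case: pickP => [t' /eqP /= ->//|/(_ t)].
  by rewrite tE eqxx.
rewrite [LHS]big_mkcond [RHS]big_mkcond; apply: eq_bigr => u _.
have -> : r (f u) == Some u.
  by rewrite /r; case: pickP => [t /eqP/fi ->//|/(_ u)]; rewrite eqxx.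
rewrite fP /= -!fm aE bE -aE -bE !(inj_eq fi).
by case: (_ && _).
Qed.

(** Vertices of color [i] give the contraction sign inside the piece. For a vertex of another color,
    its pairs with [a] and [b] give the same in [cpar a b] and in [cross c], as the color
    comparisons cancel. What remains is the merged vertex, which starts in front and must pass all
    vertices of smaller color. *)
Lemma cross_contract (c' : option {w | (w != a) && (w != b)} -> 'I_m)
    (T : finType) (f : T -> W) (a' b' : T) :
  {mono f : u v / (rank u < rank v)%N} -> injective f ->
  (forall t, c (f t) == i) -> (forall u, c u == i -> exists t, f t = u) ->
  f a' = a -> f b' = b ->
  c' None = i -> (forall u, c' (Some u) = c (val u)) ->
  cpar a b (+) cross c' =
  cross c (+) cpar a' b' (+) \big[addb/false]_w (c w < i)%N.
Proof.
move=> fm fi fc cf aE bE cN cS.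
rewrite (cpar_sub (P := fun w => c w == i) fm fi fc cf aE bE) /cross.
rewrite (pairpar_split2 (cross_sym c) ab) ca cb eqxx addFb.
rewrite (pairpar_split1 None (cross_sym c')).
have -> : pairpar (fun u v => [&& u != None, v != None &
    (c' u != c' v) && ((rank u < rank v)%N (+) (c' u < c' v)%N)]) =
  pairpar (fun u v : {w | (w != a) && (w != b)} => (c (val u) != c (val v)) &&
    ((rank (val u) < rank (val v))%N (+) (c (val u) < c (val v))%N)).
  rewrite (@pairpar_image _ _ Some); first last.
  - by move=> [u|] [v|] //; rewrite !codom_f.
  - by move=> u v; rewrite cross_sym andbCA.
  - exact: Some_inj.
  by apply: eq_pairpar => u v; rewrite /= !cS !rank_Some ltnS rank_val.
(* [None] has the least rank, so sorting moves it past [u] exactly when the color of [u] is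
   smaller. *)
have -> : \big[addb/false]_(u | u != None) ((c' None != c' u) &&
      ((rank (None : option {w | (w != a) && (w != b)}) < rank u)%N (+) (c' None < c' u)%N)) =
    \big[addb/false]_w (c w < i)%N.
  rewrite (reindex_omap Some id) => [|[u|]] //=.
  rewrite [RHS](bigD1 a) //= ca ltnn addFb (bigD1 b) 1?eq_sym //= cb ltnn addFb.
  rewrite [RHS](reindex_omap (fun u : {w | (w != a) && (w != b)} => val u) insub) => [|u Pu];
    last first.
    by rewrite insubT.
  apply: eq_big => u; first by rewrite eqxx valK eqxx andbT (valP u).
  move=> _; rewrite cN cS rank_None rank_Some /=.
  by case: ltngtP => [||/val_inj ->]; rewrite ?eqxx // => lt; rewrite andbF || (rewrite andbT;
    apply/eqP => E; move: lt; rewrite E ltnn).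
rewrite /cpar; set B := \big[addb/false]_w _; set R := pairpar _.
set A1 := \big[addb/false]_(u | _) ((rank u < rank a)%N (+) _).
set A2 := \big[addb/false]_(u | _) (_ (+) _).
set A3 := \big[addb/false]_(u | _) (_ && _).
have -> : A1 = A2 (+) A3.
  rewrite /A1 /A2 /A3 -big_split; apply: eq_bigr => u /andP[ua ub] /=.
  rewrite (inj_ltnC (@rank_inj _) ua) (inj_ltnC (@rank_inj _) ub) (eq_sym (c u)).
  by case: (i == c u); case: (_ < _)%N; case: (_ < _)%N; case: (_ < _)%N.
by case: (_ < _)%N; case: A2; case: A3; case: B; case: R.
Qed.

End CrossSign.

Lemma tag_eslot (F : fieldType) (O : cyclicOperad F) (V : vectType F) W L W' L'
    (X : dgraph O V W L) (Y : dgraph O V W' L') (f : cemb X Y) h :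
  tag (eslot f h) = eW f (tag h).
Proof. by []. Qed.

Section Leibniz.
Variables (F : fieldType) (O : cyclicOperad F) (V : vectType F) (m : nat).
Variables (W L : finType) (X : dgraph O V W L).
Local Notation CX := (coloring X m).
Local Notation CE e := (coloring (contract e) m).
Variables (WP LP : CX -> 'I_m -> finType).
Variables (P : forall c i, dgraph O V (WP c i) (LP c i)) (pe : forall c i, emb (P c i) X).
Hypothesis HP : forall (c : CX) (i : 'I_m), is_piece (val c) i (pe c i).
Variables (WQ LQ : forall e : nledge X, CE e -> 'I_m -> finType).
Variables (Q : forall e (c' : CE e) i, dgraph O V (WQ c' i) (LQ c' i)).
Variable (qe : forall e (c' : CE e) i, emb (Q c' i) (contract e)).
Hypothesis HQ : forall e (c' : CE e) (i : 'I_m), is_piece (val c') i (qe c' i).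
Variables (f : nat -> hgraph O V -> F^o).
Hypothesis nf : forall i, natural (f i).

(** The sign exponent for moving the boundary, an operator of odd degree, past the factors before
    the [i]-th. *)
Definition below (W L : finType) (G : graph W L) (c : coloring G m) (i : 'I_m) : bool :=
  \big[addb/false]_(w : W) (val c (inl w) < i)%N.

Definition edge_piece (e : nledge X) (c' : CE e) (c : CX) (i : 'I_m)
    (k : nledge (P c i)) : Prop :=
  (forall u, val c u = val c' (con_proj e u)) /\
  eslot (pe c i) (ini (val k)) = ini (val e).

Lemma edge_piece_ter e (c' : CE e) (c : CX) (i : 'I_m) (k : nledge (P c i)) :
  edge_piece c' k -> eslot (pe c i) (ter (val k)) = ter (val e).
Proof. by case=> _ eE; rewrite -!oph_ini -oph_emb ?isint_ini // eE. Qed.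

Lemma edge_piece_term e (c' : CE e) (c : CX) (i : 'I_m) (k : nledge (P c i)) :
  edge_piece c' k ->
  (-1) ^+ econ e * ((-1) ^+ crosspar c' * \prod_(j < m) f j (standard (Q c' j))) =
  (-1) ^+ crosspar c * ((-1) ^+ below c i *
   ((-1) ^+ econ k * f i (standard (contract k)) *
      \prod_(j < m | j != i) f j (standard (P c j)))) :> F.
Proof.
move=> H; have tE := edge_piece_ter H; have [cE eE] := H.
have ci : val c (inl (tag (ini (val e)))) = i by rewrite -eE tag_eslot (piece_col (HP c i)).
have ct : val c (inl (tag (ter (val e)))) = i by rewrite -tE tag_eslot (piece_col (HP c i)).
have -> : \prod_(j < m) f j (standard (Q c' j)) =
    f i (standard (contract k)) * \prod_(j < m | j != i) f j (standard (P c j)) :> F.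
  rewrite (bigD1 i) //=; congr (_ * _).
    have [g [sg gE]] := contract_piece cE (HP c i) (HQ c' i) eE.
    by rewrite (natural_std (nf i) sg) gE scale1r.
  apply: eq_bigr => j ji.
  have cj : val c (inl (tag (ini (val e)))) != j by rewrite ci eq_sym.
  have [g [sg gE]] := other_piece cE cj (HP c j) (HQ c' j).
  by rewrite (natural_std (nf j) sg) gE scale1r.
rewrite !mulrA -!signr_addb; do 2!congr (_ * _).
congr ((-1) ^+ nat_of_bool _).
have ne : tag (ini (val e)) != tag (ter (val e)) by exact: (valP e).
have tiE : eW (pe c i) (tag (ini (val k))) = tag (ini (val e)) by rewrite -eE.
have ttE : eW (pe c i) (tag (ter (val k))) = tag (ter (val e)) by rewrite -tE.
have cN : val c' (inl None) = i by rewrite -(con_proj_ini e) -cE.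
have cS u : val c' (inl (Some u)) = val c (inl (val u)).
  by rewrite cE /con_proj /= valK.
have [[pm _] pc _ pim _] := HP c i.
have pc' w : val c (inl (eW (pe c i) w)) == i by apply/eqP.
have pim' w : val c (inl w) == i -> exists w', eW (pe c i) w' = w by move/eqP; apply: pim.
have := cross_contract (c := fun w => val c (inl w)) (c' := fun u => val c' (inl u))
  ne ci ct pm (@eW_inj _ _ _ _ _ _ _ _ _ (pe c i)) pc' pim' tiE ttE cN cS.
rewrite /econ /crosspar /cross => ->.
by rewrite addbAC.
Qed.

Lemma edge_piece_ex e (c' : CE e) :
  exists (c : CX) (i : 'I_m) (k : nledge (P c i)), edge_piece c' k.
Proof.
have [|c cE] := coloring_of (G := X) (c := fun u => val c' (con_proj e u)).
  have [_ h] := closedp_con (e := e) (c := fun u => val c' (con_proj e u))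
    (c' := val c') (fun=> erefl).
  by apply: h => z; exact: coloringP.
pose i := val c (inl (tag (ini (val e)))).
have [[_ pd] _ _ pim _] := HP c i.
have [h hE] : exists h, eslot (pe c i) h = ini (val e).
  by apply: eslot_surj; exact: pim.
have hi : isint h by rewrite -(isint_emb (pe c i)) hE isint_ini.
have hd : dir h by rewrite -pd // hE dir_ini.
have [k kE] := iedge_of hi hd.
have tE : eslot (pe c i) (ter k) = ter (val e).
  by rewrite -!oph_ini -oph_emb ?isint_ini // kE hE.
have Pk : tag (ini k) != tag (ter k).
  have ne : tag (ini (val e)) != tag (ter (val e)) by exact: (valP e).
  by move: ne; rewrite -tE -hE -kE !tag_eslot; apply: contraNneq => ->.
by exists c, i, (exist _ k Pk); split; rewrite //= kE.
Qed.

Lemma edge_piece_surj (c : CX) (i : 'I_m) (k : nledge (P c i)) :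
  exists e (c' : CE e), edge_piece c' k.
Proof.
have [[_ pd] pc _ _ _] := HP c i.
have [e me] := matches_ex (pe c i) k.
have eE : eslot (pe c i) (ini (val k)) = ini (val e).
  by case: me => -[// E _]; have := pd _ (isint_ini (val k)); rewrite E dir_ini dir_ter.
have tE : eslot (pe c i) (ter (val k)) = ter (val e).
  by rewrite -!oph_ini -oph_emb ?isint_ini // eE.
have [|c0 c0E] := con_color (e := e) (c := val c).
  by rewrite -eE -tE !tag_eslot !pc.
have [|c' c'E] := coloring_of (G := contract e) (c := c0).
  by have [h _] := closedp_con c0E; apply: h => z; exact: coloringP.
by exists e, c'; split=> // u; rewrite c0E c'E.
Qed.

Lemma edge_piece_fun e (c' : CE e) (c1 c2 : CX) (i1 i2 : 'I_m)
    (k1 : nledge (P c1 i1)) (k2 : nledge (P c2 i2)) :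
  edge_piece c' k1 -> edge_piece c' k2 ->
  existT (fun c => {i : 'I_m & nledge (P c i)}) c1 (existT _ i1 k1) =
  existT _ c2 (existT _ i2 k2).
Proof.
move=> [cE1 eE1] [cE2 eE2].
have cc : c1 = c2 by apply: coloring_eq => u; rewrite cE1 cE2.
subst c2; have ii : i1 = i2.
  rewrite -(piece_col (HP c1 i1) (tag (ini (val k1)))).
  by rewrite -(piece_col (HP c1 i2) (tag (ini (val k2)))) -!tag_eslot eE1 -eE2.
subst i2; congr existT; congr existT; apply/val_inj.
apply: (@iedge_inj _ _ (P c1 i1)); apply: (@eslot_inj _ _ _ _ _ _ _ _ _ (pe c1 i1)).
by rewrite eE1 eE2.
Qed.

Lemma edge_piece_inj e1 e2 (c1 : CE e1) (c2 : CE e2) (c : CX) (i : 'I_m)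
    (k : nledge (P c i)) : edge_piece c1 k -> edge_piece c2 k ->
  existT (fun e => CE e) e1 c1 = existT _ e2 c2.
Proof.
move=> [cE1 eE1] [cE2 eE2].
have ee : e1 = e2 by apply/val_inj/(@iedge_inj _ _ X); rewrite -eE1 eE2.
subst e2; congr existT; apply: coloring_eq => u.
by have [v <-] := con_proj_surj u; rewrite -cE1 -cE2.
Qed.

(** The Leibniz rule: a coloring of a contraction is a coloring of [X], and the contracted edge lies
    in the piece of one color, by which the sum is sorted. The pieces are arbitrary graphs
    satisfying [is_piece], which hides the subtypes of [piece]. *)
Lemma pieces_bd :
  \sum_(e : nledge X) \sum_(c' : CE e)
    (-1) ^+ econ e * ((-1) ^+ crosspar c' * \prod_(j < m) f j (standard (Q c' j))) =
  \sum_(c : CX) (-1) ^+ crosspar c * \sum_(i < m) ((-1) ^+ below c i *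
    (gbd (f i) (P c i) * \prod_(j < m | j != i) f j (standard (P c j)))) :> F.
Proof.
transitivity (\sum_(c : CX) \sum_(i < m) \sum_(k : nledge (P c i))
  (-1) ^+ crosspar c * ((-1) ^+ below c i *
   ((-1) ^+ econ k * f i (standard (contract k)) *
      \prod_(j < m | j != i) f j (standard (P c j)))) : F); last first.
  apply: eq_bigr => c _; rewrite mulr_sumr; apply: eq_bigr => i _.
  by rewrite /gbd mulr_suml !mulr_sumr.
apply: (@sum_rel_dep _ _ _ _ _ _ (fun e c' c i k => @edge_piece e c' c i k)).
- exact: edge_piece_ex.
- exact: edge_piece_surj.
- by move=> e c' c1 i1 k1 c2 i2 k2; exact: edge_piece_fun.
- by move=> e1 c1 e2 c2 c i k; exact: edge_piece_inj.
- by move=> e c' c i k; exact: edge_piece_term.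
Qed.

End Leibniz.

Section ColorprodBd.
Variables (F : fieldType) (O : cyclicOperad F) (V : vectType F) (m : nat).
Variables (W L : finType) (X : dgraph O V W L).
Variables (f : nat -> hgraph O V -> F^o).
Hypothesis nf : forall i, natural (f i).

Lemma colorprod_bd :
  gbd (fun Y : hgraph O V => colorprod m f Y) X =
  \sum_(c : coloring X m) (-1) ^+ crosspar c * \sum_(i < m) ((-1) ^+ below c i *
    (gbd (f i) (piece c i) * \prod_(j < m | j != i) f j (standard (piece c j)))).
Proof.
rewrite -(pieces_bd (pieceP (X := X)) (fun e => pieceP (X := contract e)) nf).
apply: eq_bigr => e _; rewrite (colorprod_standard _ _ nf) /colorprod scaler_sumr.
by [].
Qed.

End ColorprodBd.

(** * Disjoint unions *)

Section Dun.
Variables (F : fieldType) (O : cyclicOperad F) (V : vectType F).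
Variables (r : nat) (Y : 'I_r -> hgraph O V).

Definition dun : dgraph O V {i & 'I_(nv (Y i))} {i & 'I_(nl (Y i))} :=
  @DGraph F O V _ _ (dun_graph (fun i => Y i : graph _ _))
    (fun w => deco (Y (tag w)) (tagged w)) (fun l => lab (Y (tag l)) (tagged l)).

Lemma dun_standard : disjoint_union Y = standard dun.
Proof. by []. Qed.

Lemma dinj_injW (i : 'I_r) :
  injective (fun w : 'I_(nv (Y i)) => existT (fun i => 'I_(nv (Y i))) i w).
Proof. by move=> w v E; apply: eq_from_Tagged E. Qed.

Lemma dinj_injL (i : 'I_r) :
  injective (fun w : 'I_(nl (Y i)) => existT (fun i => 'I_(nl (Y i))) i w).
Proof. by move=> w v E; apply: eq_from_Tagged E. Qed.

Definition dinj_cemb (i : 'I_r) : cemb (Y i) dun :=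
  @Cemb _ _ _ _ _ _ _ (Y i) dun (fun w => existT (fun i => 'I_(nv (Y i))) i w)
    (fun _ => id) (@dinj_injW i)
    (fun w => @Bijective _ _ id id (frefl _) (frefl _))
    (fun w => esym (oact_id _)).

Lemma dinj_sum i z : sum_map (eslot (dinj_cemb i))
  (fun l => existT (fun i => 'I_(nl (Y i))) i l) z =
  dun_emb (G := fun i => Y i : graph _ _) z.
Proof. by case: z. Qed.

Lemma dinj_opp i (z : slot (Y i) + 'I_(nl (Y i))) :
  opp (sum_map (eslot (dinj_cemb i)) (fun l => existT (fun i => 'I_(nl (Y i))) i l) z) =
  sum_map (eslot (dinj_cemb i)) (fun l => existT (fun i => 'I_(nl (Y i))) i l) (opp z).
Proof. by rewrite !dinj_sum; exact: (dun_oppE (G := fun i => Y i : graph _ _)). Qed.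

Definition dinj (i : 'I_r) : emb (Y i) dun :=
  @Emb _ _ _ _ _ _ _ (Y i) dun (dinj_cemb i) _ (@dinj_injL i) (@dinj_opp i) (fun=> erefl).

Definition block (u : {i & 'I_(nv (Y i))} + {i & 'I_(nl (Y i))}) : 'I_r :=
  match u with inl w => tag w | inr l => tag l end.

Lemma block_piece i : is_piece block i (dinj i).
Proof.
split=> //.
- split=> [u v|[w h] //].
  have H := @rank_tagged (ordinal r) (fun i : ordinal r => ordinal (nv (Y i)) : finType) i u v.
  exact: H.
- by move=> [j w] /= ji; subst j; exists w.
- by move=> [j l] /= ji; subst j; exists l.
Qed.

Lemma block_closed (z : slot dun + {i & 'I_(nl (Y i))}) : block (vend (opp z)) = block (vend z).
Proof.
have [i [z' ->]] := dun_surj (G := fun i => Y i : graph _ _) z.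
rewrite -dinj_sum -[eslot _]/(eslot (dinj i)) (e_opp (dinj i)) !(vend_emb (dinj i)).
by case: (vend _); case: (vend _).
Qed.

Lemma dun_to_emb W L (X : dgraph O V W L) (c : W + L -> 'I_r)
    (pe : forall i, emb (Y i) X) : (forall i, is_piece c i (pe i)) ->
  exists g : emb dun X, surj_emb g.
Proof.
move=> HP; pose gW (w : {i & 'I_(nv (Y i))}) := eW (pe (tag w)) (tagged w).
pose gL (w : {i & 'I_(nl (Y i))}) := eL (pe (tag w)) (tagged w).
have gWi : injective gW.
  move=> [i w] [j v] E; have ij : i = j.
    by rewrite -(piece_col (HP i) w) -(piece_col (HP j) v) -[eW _ w]/(gW (existT _ i w)) E.
  by subst j; rewrite (@eW_inj _ _ _ _ _ _ _ _ _ (pe i) w v).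
have gLi : injective gL.
  move=> [i w] [j v] E; have ij : i = j.
    by rewrite -(piece_colL (HP i) w) -(piece_colL (HP j) v) -[eL _ w]/(gL (existT _ i w)) E.
  by subst j; rewrite (@eL_inj _ _ _ _ _ _ _ _ _ (pe i) w v).
pose gc : cemb dun X := @Cemb _ _ _ _ _ _ _ dun X gW
  (fun w => eS (pe (tag w)) (w := tagged w)) gWi (fun w => eS_bij (pe (tag w)) (tagged w))
  (fun w => eS_deco (pe (tag w)) (tagged w)).
have gE i (z : slot (Y i) + 'I_(nl (Y i))) :
  sum_map (eslot gc) gL (dun_emb (G := fun i => Y i : graph _ _) z) =
  sum_map (eslot (pe i)) (eL (pe i)) z by case: z.
have gopp (z : slot dun + {i & 'I_(nl (Y i))}) : opp (sum_map (eslot gc) gL z) =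
  sum_map (eslot gc) gL (opp z).
  have [i [z' ->]] := dun_surj (G := fun i => Y i : graph _ _) z.
  have -> : opp (g := dun) (dun_emb z') = dun_emb (opp z') by exact: dun_oppE.
  by rewrite !gE e_opp.
exists (@Emb _ _ _ _ _ _ _ dun X gc gL gLi gopp (fun l => e_lab (pe (tag l)) (tagged l))).
split=> w.
  by have [v <-] := piece_im (HP (c (inl w))) erefl; exists (existT (fun i => 'I_(nv (Y i))) _ v).
by have [v <-] := piece_imL (HP (c (inr w))) erefl; exists (existT (fun i => 'I_(nl (Y i))) _ v).
Qed.

End Dun.

(** * Connected components *)

Section Components.
Variables (F : fieldType) (O : cyclicOperad F) (V : vectType F).
Variables (W L : finType) (X : dgraph O V W L).

(** Extended by false outside the piece, a closed predicate on it becomes closed on [X], hence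
    constant on points joined by a path, such as those of one color here. *)
Lemma piece_connected (T : eqType) (c : W + L -> T) (i : T) WP LP (P : dgraph O V WP LP)
    (pe : emb P X) : is_piece c i pe -> closedp X (fun u => c u == i) ->
  (exists u, c u = i) -> (forall u v, c u = c v -> connect (adj X) u v) ->
  gconnected P.
Proof.
move=> [_ pc pcL pim pimL] cc [u0 u0i] cconn.
pose s := sum_map (eW pe) (eL pe).
have si : injective s.
  by move=> [a|a] [b|b] //= E; congr (_ _); [exact: eW_inj (inl_inj E)|exact: eL_inj (inr_inj E)].
have sc u : c (s u) = i by case: u => u; rewrite /s /= ?pc ?pcL.
have sim u : c u = i -> exists u', s u' = u.
  case: u => u ui.
    by have [u' <-] := pim _ ui; exists (inl u').
  by have [u' <-] := pimL _ ui; exists (inr u').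
apply/gconnectedP; split; first by have [u _] := sim _ u0i; exists u.
move=> a ca u v; pose a' x := [exists w, (s w == x) && a w].
have a'E w : a' (s w) = a w.
  apply/existsP/idP => [[w' /andP[/eqP/si ->]]//|aw].
  by exists w; rewrite eqxx.
have ca' : closedp X a'.
  move=> z; have [zi|zi] := eqVneq (c (vend z)) i; last first.
    have F0 x : c x != i -> a' x = false.
      by move=> xi; apply/existsP => -[w /andP[/eqP E _]]; rewrite -E sc eqxx in xi.
    by rewrite !F0 //; have := cc z => /= ->.
  have [z' z'E] : exists z', sum_map (eslot pe) (eL pe) z' = z.
    case: z zi => [h|l] /= zi.
      by have [h' <-] := eslot_surj (f := pe) (pim _ zi); exists (inl h').
    by have [l' <-] := pimL _ zi; exists (inr l').
  by rewrite -z'E e_opp !vend_emb !a'E ca.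
rewrite -!a'E; have := closed_connect ((closedp_adj _ _).1 ca') (cconn (s u) (s v) _).
by apply; rewrite !sc.
Qed.

Lemma components : exists r (c : coloring X r), (forall i, exists u, val c u = i) /\
  forall u v, val c u = val c v -> connect (adj X) u v.
Proof.
pose R := {x : W + L | roots (adj X) x}.
have rP u : roots (adj X) (fingraph.root (adj X) u) by exact: roots_root (@adj_connect_sym _ _ X) u.
pose c u : 'I_#|{: R}| := enum_rank (exist (fun x => roots (adj X) x) _ (rP u) : R).
have cP u v : (c u = c v) <-> connect (adj X) u v.
  rewrite -(root_connect (@adj_connect_sym _ _ X)); split=> [/enum_rank_inj[->]//|/eqP E].
  by congr enum_rank; apply: val_inj.
have [|c' c'E] := coloring_of (G := X) (c := c).
  move=> z; apply/cP; apply/connect1/existsP; exists (opp z).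
  by rewrite oppK !eqxx.
exists #|{: R}|, c'; split=> [i|u v]; last by rewrite !c'E => /cP.
exists (val (enum_val i)); rewrite c'E; apply: enum_val_inj; rewrite enum_rankK.
by apply: val_inj => /=; apply/eqP; exact: (valP (enum_val i)).
Qed.

Lemma decomposition : exists r (Y : 'I_r -> hgraph O V), (forall i, gconnected (Y i)) /\
  exists g : emb (dun Y) X, surj_emb g.
Proof.
have [r [c [csurj cconn]]] := components.
exists r, (fun i => standard (piece c i)); split=> [i|].
  rewrite gconnected_std; apply: (piece_connected (pieceP c i) (coloring_closed c i) _ cconn).
  exact: csurj.
apply: (dun_to_emb (c := val c) (pe := fun i =>
  emb_comp (std_emb (piece c i)) (piece_emb c i))) => i.
have [[pm pd] pc pcL pim pimL] := pieceP c i.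
have [sW sL] := @surj_std _ _ _ _ _ (piece c i).
have [sm sd] := @mono_std _ _ _ _ _ (piece c i).
split.
- split=> [u v|h hi]; first by rewrite pm sm.
  by rewrite eslot_comp pd ?isint_emb.
- by move=> w; exact: pc.
- by move=> l; exact: pcL.
- by move=> w /pim[v <-]; have [u <-] := sW v; exists u.
- by move=> l /pimL[v <-]; have [u <-] := sL v; exists u.
Qed.

End Components.

Lemma addb_sum_bool (I : finType) (P : pred I) (k : I -> nat) :
  odd (\sum_(i | P i) k i) = \big[addb/false]_(i | P i) odd (k i).
Proof. exact: (big_morph odd oddD erefl). Qed.

Lemma addb_const (I : finType) (b : bool) : \big[addb/false]_(i : I) b = odd #|I| && b.
Proof.
rewrite big_const; elim: #|I| => //= n ->.
by case: (odd n); case: b.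
Qed.

(** * Koszul signs from exchanging blocks of vertices *)

Section Blocks.
Variables (r : nat) (N : 'I_r -> nat).
Local Notation T := {i : 'I_r & 'I_(N i)}.

Lemma sum_blocks (H : 'I_r -> bool) :
  \big[addb/false]_(u : T) H (tag u) = \big[addb/false]_a (odd (N a) && H a).
Proof.
have := @sig_big_dep _ _ _ 'I_r (fun a => 'I_(N a)) xpredT (fun _ => xpredT)
  (fun a (_ : 'I_(N a)) => H a).
by move=> /= <-; apply: eq_bigr => a _; rewrite addb_const card_ord.
Qed.

(** Two blocks have as many mixed pairs as the product of their sizes, and the enumeration orders
    all of these alike. This is the exponent in the Koszul sign. *)
Lemma pairpar_blocks (E : rel 'I_r) : (forall a, E a a = false) ->
  pairpar (fun u v : T => E (tag u) (tag v)) =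
  pairpar (fun a b : 'I_r => odd (N a * N b) && E a b).
Proof.
move=> E0; rewrite /pairpar big_mkcond [RHS]big_mkcond /=.
rewrite -(pair_bigA _ (fun u v : T => if (rank u < rank v)%N then E (tag u) (tag v) else false)) /=.
rewrite -(pair_bigA _ (fun a b : 'I_r => if (rank a < rank b)%N
  then odd (N a * N b) && E a b else false)) /=.
pose G a b := if (rank a < rank b)%N then E a b else false.
rewrite (eq_bigr (fun u : T => \big[addb/false]_(v : T) G (tag u) (tag v))); last first.
  move=> u _; apply: eq_bigr => v _; rewrite /G.
  have [->|uv] := eqVneq (tag u) (tag v); first by rewrite E0 !if_same.
  by rewrite rank_tag.
rewrite (sum_blocks (fun a => \big[addb/false]_(v : T) G a (tag v))).
apply: eq_bigr => a _; rewrite (sum_blocks (G a)).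
rewrite (big_morph (andb (odd (N a))) (andb_addr _) (andbF _)); apply: eq_bigr => b _.
by rewrite /G oddM; case: ifP => _; rewrite ?andbF // andbA.
Qed.

End Blocks.

Section ColorprodDun.
Variables (F : fieldType) (O : cyclicOperad F) (V : vectType F) (m r : nat).
Variables (f : nat -> hgraph O V -> F^o) (Y : 'I_r -> hgraph O V).
Hypothesis nf : forall i, natural (f i).
Hypothesis f_disc : forall i (X : hgraph O V), ~~ gconnected X -> f i X = 0.
Hypothesis Yc : forall i, gconnected (Y i).

(** Each block is connected, hence has one color. Each piece is connected, hence contains at most
    one block, and nonempty, hence contains one. *)
Lemma connected_pieces (c : coloring (dun Y) m) (WP LP : 'I_m -> finType)
    (P : forall i, dgraph O V (WP i) (LP i)) (pe : forall i, emb (P i) (dun Y)) :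
  (forall i, is_piece (val c) i (pe i)) -> (forall i, gconnected (P i)) ->
  exists t : 'I_r -> 'I_m, bijective t /\ forall u, val c u = t (block u).
Proof.
move=> HP pcon.
have ex j : exists i : 'I_m, forall u, block u = j -> val c u = i.
  have /gconnectedP[[u0 _] H] := Yc j.
  pose s := sum_map (eW (dinj Y j)) (eL (dinj Y j)).
  exists (val c (s u0)) => u uj.
  have [v <-] : exists v, s v = u.
    case: u uj => u uj.
      by have [v <-] := piece_im (block_piece Y j) uj; exists (inl v).
    by have [v <-] := piece_imL (block_piece Y j) uj; exists (inr v).
  apply/eqP; rewrite (H (fun v => val c (s v) == val c (s u0)) _ v u0) ?eqxx // => z.
  by rewrite /s -!(vend_emb (dinj Y j)) -e_opp coloringP.
have [t tP] := choice ex; have tE u : val c u = t (block u) by exact: tP.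
exists t; split=> //.
have Yne j : exists u, block (Y := Y) u = j.
  have /gconnectedP[[u _] _] := Yc j.
  by case: u => u; [exists (inl (existT (fun i => 'I_(nv (Y i))) j u))|
    exists (inr (existT (fun i => 'I_(nl (Y i))) j u))].
pose s i := sum_map (eW (pe i)) (eL (pe i)).
have lift i u : val c u = i -> exists u', s i u' = u.
  case: u => u ui.
    by have [u' <-] := piece_im (HP i) ui; exists (inl u').
  by have [u' <-] := piece_imL (HP i) ui; exists (inr u').
have ti : injective t.
  move=> j j' jj'; have [u uj] := Yne j; have [u' uj'] := Yne j'.
  have [v vE] : exists v, s (t j) v = u by apply: lift; rewrite tE uj.
  have [v' vE'] : exists v, s (t j) v = u' by apply: lift; rewrite tE uj' jj'.
  have /gconnectedP[_ H] := pcon (t j).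
  have := H (fun w => block (s (t j) w) == j) _ v v'.
  rewrite vE vE' uj uj' eqxx => /(_ _)/esym/eqP->// z.
  by rewrite /s -!(vend_emb (pe (t j))) -e_opp block_closed.
have ts i : exists j, t j = i.
  have /gconnectedP[[u _] _] := pcon i.
  exists (block (s i u)).
  by rewrite -tE; case: u => u; [exact: piece_col (HP i) u|exact: piece_colL (HP i) u].
have [g gP] := choice ts.
by exists g => // j; apply: ti; rewrite gP.
Qed.

Lemma nonzero_coloring (c : coloring (dun Y) m) :
  \prod_(i < m) f i (standard (piece c i)) != 0 ->
  exists t : 'I_r -> 'I_m, bijective t /\ forall u, val c u = t (block u).
Proof.
move=> nz; apply: (connected_pieces (pieceP c)) => i.
rewrite -gconnected_std; apply: contraNT nz => dis.
rewrite (bigD1 i) //; apply/eqP; rewrite f_disc //; exact: mul0r.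
Qed.

Lemma colorprod_dun_neq : r <> m -> colorprod m f (dun Y) = 0.
Proof.
move=> rm; rewrite /colorprod big1 // => c _.
have [->|nz] := eqVneq (\prod_(i < m) f i (standard (piece c i))) 0; first by rewrite mulr0.
by have [t [/bij_eq_card tb _]] := nonzero_coloring nz; case: rm; rewrite !card_ord in tb.
Qed.

End ColorprodDun.

Section ColorprodKoszul.
Variables (F : fieldType) (O : cyclicOperad F) (V : vectType F) (m : nat).
Variables (f : nat -> hgraph O V -> F^o) (Y : 'I_m -> hgraph O V).
Hypothesis nf : forall i, natural (f i).
Hypothesis f_disc : forall i (X : hgraph O V), ~~ gconnected X -> f i X = 0.
Hypothesis Yc : forall i, gconnected (Y i).

(** The inverse appears because the [i]-th functional has to receive the graph [Y (s i)]: color [i]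
    goes to block [s i]. *)
Lemma perm_coloring_ex (s : 'S_m) : exists c : coloring (dun Y) m,
  forall u, val c u = (s^-1)%g (block u).
Proof.
apply: (coloring_of (c := fun u => (s^-1)%g (block u))) => z.
by rewrite block_closed.
Qed.

Definition perm_coloring (s : 'S_m) : coloring (dun Y) m := projT1 (cid (perm_coloring_ex s)).

Lemma perm_coloringE s u : val (perm_coloring s) u = (s^-1)%g (block u).
Proof. exact: projT2 (cid (perm_coloring_ex s)) u. Qed.

Lemma koszulE s : koszul Y s = (-1) ^+ crosspar (perm_coloring s) :> F.
Proof.
rewrite /koszul -signr_odd; congr (_ ^+ nat_of_bool _); rewrite /crosspar.
pose E (a b : 'I_m) := (a != b) && ((a < b)%N (+) ((s^-1)%g a < (s^-1)%g b)%N).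
rewrite (eq_pairpar (D' := fun u v => E (tag u) (tag v))); last first.
  move=> u v; rewrite !perm_coloringE /E /= (inj_eq perm_inj).
  by case: (eqVneq (tag u) (tag v)) => //= uv; rewrite rank_tag // !rank_ord.
rewrite pairpar_blocks; last by move=> a; rewrite /E eqxx.
have Esym : symmetric E.
  move=> a b; rewrite /E eq_sym; case: (eqVneq a b) => //= ab.
  have si : injective (fun a : 'I_m => (s^-1)%g a : nat) by move=> x y /val_inj/perm_inj.
  rewrite (@inj_ltnC _ _ a b si) // (@inj_ltnC _ (fun a : 'I_m => a : nat) a b val_inj) //.
  by rewrite addbN addNb negbK.
(* [koszul] sums over positions [i < j]; ordering the blocks by their position after the permutation
   turns the pairs into these. *)
rewrite (@pairpar_base _ _ (fun a => (s^-1)%g a)); last 2 first.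
- by move=> a b; rewrite mulnC Esym.
- by move=> x y /val_inj/perm_inj.
rewrite (reindex (fun p : 'I_m * 'I_m => (s p.1, s p.2))) /=; last first.
  exists (fun p => ((s^-1)%g p.1, (s^-1)%g p.2)) => -[a b] _ /=; rewrite ?permK //.
  by rewrite !permKV.
rewrite addb_sum_bool.
rewrite (eq_bigr (fun i : 'I_m => \big[addb/false]_(j < m | (i < j)%N && (s j < s i)%N)
  odd (nv (Y (s i)) * nv (Y (s j))))) => [|i _]; last by rewrite addb_sum_bool.
rewrite pair_big_dep /= big_mkcond [RHS]big_mkcond; apply: eq_bigr => -[i j] _ /=.
rewrite !permK; case: ifP => [/andP[ij sij]|]; rewrite /E !permK.
  rewrite ij /= ltnNge ltnW // andbT; case: eqP => [/perm_inj E'|_]; last by rewrite andbT.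
  by rewrite E' ltnn in ij.
case: ifP => // ij; rewrite /= => sij; case: eqP => [->|/eqP n]; first by rewrite ltnn andbF.
rewrite ltnNge leq_eqVlt sij orbF /= (inj_eq val_inj) eq_sym n.
by rewrite ?ij ?andbF.
Qed.

Lemma colorprod_dun :
  colorprod m f (dun Y) = \sum_(s : 'S_m) koszul Y s * \prod_(i < m) f i (Y (s i)).
Proof.
have T s : (-1) ^+ crosspar (perm_coloring s) *
    \prod_(i < m) f i (standard (piece (perm_coloring s) i)) =
    koszul Y s * \prod_(i < m) f i (Y (s i)) :> F.
  rewrite koszulE; congr (_ * _); apply: eq_bigr => i _.
  have P : is_piece (val (perm_coloring s)) i (dinj Y (s i)).
    have [pm pc pcL pim pimL] := block_piece Y (s i); split=> //.
    - by move=> w; rewrite perm_coloringE pc permK.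
    - by move=> w; rewrite perm_coloringE pcL permK.
    - by move=> w; rewrite perm_coloringE => wi; apply: pim; rewrite -wi permKV.
    - by move=> w; rewrite perm_coloringE => wi; apply: pimL; rewrite -wi permKV.
  have [g [sg gE]] := piece_iso (pieceP (perm_coloring s) i) P.
  by rewrite (natural_std (nf i) sg) gE scale1r natural_hgr.
rewrite -(eq_bigr _ (fun s _ => T s)) /colorprod.
pose nz (c : coloring (dun Y) m) := \prod_(i < m) f i (standard (piece c i)) != 0.
(* Only colorings with a nonzero product are known to come from permutations, so both sums are first
   cut down to nonzero terms. *)
rewrite (bigID nz) /= [X in _ + X]big1 ?addr0; last first.
  by move=> c; rewrite negbK => /eqP ->; rewrite mulr0.
rewrite [RHS](bigID (fun s => nz (perm_coloring s))) /= [X in _ = _ + X]big1 ?addr0; last first.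
  by move=> s; rewrite negbK => /eqP ->; rewrite mulr0.
have pinj : injective perm_coloring.
  move=> s s' E; apply: invg_inj; apply/permP => j.
  have /gconnectedP[[u _] _] := Yc j.
  have [v vj] : exists v, block (Y := Y) v = j.
    by case: u => u; [exists (inl (existT (fun i => 'I_(nv (Y i))) j u))|
      exists (inr (existT (fun i => 'I_(nl (Y i))) j u))].
  by have := perm_coloringE s v; rewrite E perm_coloringE vj.
pose h' c := [pick s | perm_coloring s == c].
have h'K s : h' (perm_coloring s) = Some s.
  by rewrite /h'; case: pickP => [s' /eqP/pinj->|/(_ s)]; rewrite ?eqxx.
rewrite (reindex_omap perm_coloring h') => [|c cn].
  by apply: eq_bigl => s; rewrite h'K eqxx andbT.
have [t [tb tE]] := nonzero_coloring f_disc Yc cn.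
have -> : c = perm_coloring (perm (bij_inj tb))^-1.
  by apply: coloring_eq => u; rewrite tE perm_coloringE invgK permE.
by rewrite h'K.
Qed.

End ColorprodKoszul.

(** * Cochains as functions on graphs *)

Section Subcomplex.
Variables (F : fieldType) (O : cyclicOperad F) (V : vectType F).
Variable P : pred (hgraph O V).

Lemma subval_linear : linear (@subval F _ (graph_span P)).
Proof. by move=> a x y; rewrite -[subval _]/(val _) linearP. Qed.

Lemma subval_sclass X : P X -> subval (sclass P X) = hclass X.
Proof. by move=> PX; rewrite -[subval _]/(val _) insubdK // graph_span_class. Qed.

Lemma subval_subrestrict (f : hairy O V -> hairy O V) (x : subcomplex P) :
  {homo f : x / x \in graph_span P} -> subval (subrestrict f x) = f (subval x).
Proof.
by move=> fP; rewrite -[LHS]/(val _) insubdK //; apply: fP; exact: (valP x).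
Qed.

End Subcomplex.

Section GraphCochains.
Variables (F : fieldType) (O : cyclicOperad F) (V : vectType F).
Local Notation PH := (@connected_graph F O V).
Implicit Type f : hgraph O V -> F^o.

Record gcochain f : Prop := GCochain {
  gc_respects : respects f;
  gc_disc : forall X : hgraph O V, ~~ gconnected X -> f X = 0;
  gc_degree : exists d, forall X : hgraph O V, (d <= gdegree X)%N -> f X = 0 }.

Record gcocycle (k : nat) f : Prop := GCocycle {
  gz_cochain : gcochain f;
  gz_support : forall X : hgraph O V, nv X != k -> f X = 0;
  gz_bd : forall X : hgraph O V, gbd f X = 0 }.

Lemma gbd_std f W L (X : dgraph O V W L) : natural f -> gbd f (standard X) = gbd f X.
Proof.
move=> nf; rewrite (gbd_emb nf (@surj_std _ _ _ _ _ X)).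
by rewrite (mono_sgn (@mono_std _ _ _ _ _ X)) scale1r.
Qed.

(** Extension by zero to disconnected graphs. It makes a functional on connected graphs compatible
    with all relations, connectedness being invariant under isomorphism and change of labels or
    decorations. *)
Definition graph_fun (z : subcomplex PH -> F^o) (X : hgraph O V) : F^o :=
  if gconnected X then z (sclass PH X) else 0.

Lemma sclass_respects : [/\ forall (X Y : hgraph O V) (phi : emb X Y), surj_emb phi ->
    gconnected X -> sclass PH X = (-1) ^+ sgn phi *: sclass PH Y,
   forall k l (G : graph 'I_k 'I_l) (d : forall w, O (ar G w))
    (i : 'I_l) a (b b1 b2 : 'I_l -> V), gconnected G ->
  b i = a *: b1 i + b2 i -> (forall j, j != i -> b1 j = b j /\ b2 j = b j) ->
  sclass PH (HGraph (DGraph d b)) =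
    a *: sclass PH (HGraph (DGraph d b1)) + sclass PH (HGraph (DGraph d b2)) &
   forall k l (G : graph 'I_k 'I_l) (b : 'I_l -> V)
    (i : 'I_k) a (d d1 d2 : forall w, O (ar G w)), gconnected G ->
  d i = a *: d1 i + d2 i -> (forall j, j != i -> d1 j = d j /\ d2 j = d j) ->
  sclass PH (HGraph (DGraph d b)) =
    a *: sclass PH (HGraph (DGraph d1 b)) + sclass PH (HGraph (DGraph d2 b))].
Proof.
have [nh lh dh] := @hclass_respects F O V.
have sl := @subval_linear F O V PH.
have lin a x y : subval (a *: x + y : subcomplex PH) = a *: subval x + subval y by exact: sl.
split.
- move=> X Y phi sphi cX; apply: val_inj; rewrite -[LHS]/(subval _) -[RHS]/(subval _).
  have cY : PH Y by rewrite /connected_graph -(gconnected_emb sphi).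
  rewrite subval_sclass // (nh _ _ _ sphi) -[_ *: sclass _ _]addr0 lin subval_sclass //.
  by rewrite (_ : subval 0 = 0) ?addr0.
- move=> k l G d i a b b1 b2 cG bi bj; apply: val_inj.
  rewrite -[LHS]/(subval _) -[RHS]/(subval _) lin !subval_sclass //.
  exact: (lh _ _ _ _ _ _ _ _ _ bi bj).
- move=> k l G b i a d d1 d2 cG di dj; apply: val_inj.
  rewrite -[LHS]/(subval _) -[RHS]/(subval _) lin !subval_sclass //.
  exact: (dh _ _ _ _ _ _ _ _ _ di dj).
Qed.

Lemma graph_fun_cochain K (z : subcomplex PH -> F^o) : is_cochain K z -> gcochain (graph_fun z).
Proof.
move=> [lz [d dz] _]; have [sn sl sd] := sclass_respects.
have z0 : z 0 = 0 by have := lz (-1) 0 0; rewrite scaler0 addr0 scaleN1r addNr.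
have zZ a x : z (a *: x) = a *: z x by have := lz a x 0; rewrite z0 !addr0.
split; first split.
- move=> X Y phi sphi; rewrite /graph_fun -(gconnected_emb sphi).
  by case: ifP => cX; rewrite ?scaler0 // (sn _ _ _ sphi cX) zZ.
- move=> k l G d' i a b b1 b2 bi bj; rewrite /graph_fun /=; case: ifP => cG.
    by rewrite (sl _ _ _ _ _ _ _ _ _ cG bi bj) lz.
  by rewrite scaler0 addr0.
- move=> k l G b i a d' d1 d2 di dj; rewrite /graph_fun /=; case: ifP => cG.
    by rewrite (sd _ _ _ _ _ _ _ _ _ cG di dj) lz.
  by rewrite scaler0 addr0.
- by move=> X /negPf cX; rewrite /graph_fun cX.
- by exists d => X dX; rewrite /graph_fun; case: ifP => // cX; exact: dz.
Qed.

(** Contractions preserve connectedness in both directions, so extension by zero commutes with the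
    coboundary. *)
Lemma gbd_graph_fun (z : subcomplex PH -> F^o) (X : hgraph O V) : linear z ->
  gbd (graph_fun z) X = graph_fun (fun x => z (subrestrict (@bd F O V) x)) X.
Proof.
move=> lz; rewrite /graph_fun; case: ifP => cX; last first.
  rewrite /gbd big1 // => e _; rewrite gconnected_std gconnected_contract cX.
  exact: scaler0.
have z0 : z 0 = 0 by have := lz (-1) 0 0; rewrite scaler0 addr0 scaleN1r addNr.
have sl := @subval_linear F O V PH.
have H (s : seq (nledge X)) :
   subval (\sum_(e <- s) (-1) ^+ econ e *: sclass PH (standard (contract e))) =
     \sum_(e <- s) (-1) ^+ econ e *: hclass (standard (contract e)) /\
   z (\sum_(e <- s) (-1) ^+ econ e *: sclass PH (standard (contract e))) =
     \sum_(e <- s) (-1) ^+ econ e *: graph_fun z (standard (contract e)).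
  elim: s => [|e s [IH1 IH2]]; first by rewrite !big_nil z0.
  have ce : gconnected (standard (contract e)) by rewrite gconnected_std gconnected_contract.
  by rewrite !big_cons lz sl IH1 IH2 subval_sclass // /graph_fun ce.
have [H1 H2] := H (index_enum (nledge X)).
rewrite /gbd -H2; apply: congr1; apply: val_inj; rewrite -[LHS]/(subval _) -[RHS]/(subval _) H1.
rewrite subval_subrestrict; last exact: bd_span_PH.
by rewrite subval_sclass // bd_hclass.
Qed.

Lemma graph_fun_cocycle k (z : cocycles PH (pred1 k)) : gcocycle k (graph_fun (subval z)).
Proof.
have /asboolP[cz bz] := valP z; split.
- exact: graph_fun_cochain cz.
- move=> X kX; rewrite /graph_fun; case: ifP => // cX.
  by case: cz => _ _; apply.
- move=> X; rewrite gbd_graph_fun; last by case: cz.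
  by rewrite /graph_fun bz if_same.
Qed.

(** [coboundaries] is defined as a span; a linear combination of primitives is a primitive of the
    combination. *)
Lemma coboundary_graph_fun k (z : cocycles PH (pred1 k)) : z \in coboundaries PH (pred1 k) ->
  exists2 g, gcochain g & forall X : hgraph O V, graph_fun (subval z) X = gbd g X.
Proof.
move=> zc; suff [g cg gE] : exists2 g, is_cochain predT g &
    forall x, subval z x = g (subrestrict (@bd F O V) x).
  exists (graph_fun g); first exact: graph_fun_cochain cg.
  move=> X; rewrite gbd_graph_fun; last by case: cg.
  by rewrite /graph_fun gE.
have /asboolP := zc; elim=> {z zc} [|c u v [g cg gE] _ [h ch hE]].
  exists (fun=> 0) => //; split=> //; last by exists 0%N.
  by move=> a x y; rewrite scaler0 addr0.
exists (c \*: g \+ h) => /=.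
  case: cg => lg [d dg] sg; case: ch => lh [d' dh] sh; split.
  - by move=> a x y /=; rewrite lg lh !scalerDr !scalerA mulrC addrACA.
  - exists (maxn d d') => X PX; rewrite geq_max => /andP[dX d'X] /=.
    by rewrite dg // dh // scaler0 addr0.
  - by [].
by move=> x /=; rewrite -gE -hE.
Qed.

End GraphCochains.

(** * Additivity of the degree and bounds for products *)

Section Degree.
Variables (F : fieldType) (O : cyclicOperad F) (V : vectType F).

Lemma ar_emb W L W' L' (X : dgraph O V W L) (Y : dgraph O V W' L') (f : cemb X Y) w :
  ar X w = ar Y (eW f w).
Proof. by have /bij_eq_card := eS_bij f w; rewrite !card_ord. Qed.

Lemma gdegree_std W L (X : dgraph O V W L) : gdegree (standard X) = gdegree X.
Proof.
rewrite /gdegree (reindex (fun i : 'I_#|W| => enum_val i)) //.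
exact/onW_bij/enum_val_bij.
Qed.

Lemma gdegree_piece (T : eqType) W L (X : dgraph O V W L) (c : W + L -> T) (i : T)
    WP LP (P : dgraph O V WP LP) (pe : emb P X) : is_piece c i pe ->
  gdegree P = (\sum_(w | c (inl w) == i) (ar X w - 2))%N.
Proof.
move=> [_ pc _ pim _]; rewrite /gdegree.
pose r w := [pick v | eW pe v == w].
rewrite [RHS](reindex_omap (eW pe) r) => [|w /eqP wi]; last first.
  have [v vE] := pim _ wi; rewrite /r; case: pickP => [v' /eqP /= ->//|/(_ v)].
  by rewrite vE eqxx.
apply: eq_big => [v|v _]; last by rewrite -ar_emb.
rewrite pc eqxx /r; case: pickP => [v' /eqP/eW_inj ->|/(_ v)]; by rewrite eqxx.
Qed.

Lemma nv_piece (T : eqType) W L (X : dgraph O V W L) (c : W + L -> T) (i : T)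
    WP LP (P : dgraph O V WP LP) (pe : emb P X) : is_piece c i pe ->
  nv (standard P) = #|[pred w | c (inl w) == i]|.
Proof.
move=> [_ pc _ pim _]; rewrite /= -(card_image (@eW_inj _ _ _ _ _ _ _ _ _ pe)).
apply: eq_card => w; rewrite !inE; apply/imageP/eqP => [[v _ ->//]|/pim[v <-]].
by exists v.
Qed.

Lemma sum_pieces m W L (X : dgraph O V W L) (c : coloring X m) (WP LP : 'I_m -> finType)
    (P : forall i, dgraph O V (WP i) (LP i)) (pe : forall i, emb (P i) X) :
  (forall i, is_piece (val c) i (pe i)) ->
  gdegree X = (\sum_(i < m) gdegree (P i))%N.
Proof.
move=> HP; rewrite /gdegree (partition_big (fun w => val c (inl w)) xpredT) //=.
by apply: eq_bigr => i _; rewrite -(gdegree_piece (HP i)).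
Qed.

Variables (m : nat) (f : nat -> hgraph O V -> F^o).

(** Pigeonhole: the degree is additive over the pieces, so if it exceeds the sum of the bounds, some
    piece reaches its own bound. *)
Lemma prod_eq0 W L (X : dgraph O V W L) (c : coloring X m) (WP LP : 'I_m -> finType)
    (P : forall i, dgraph O V (WP i) (LP i)) (pe : forall i, emb (P i) X) (d : 'I_m -> nat) :
  (forall i, is_piece (val c) i (pe i)) ->
  (forall (i : 'I_m) (Y : hgraph O V), (d i <= gdegree Y)%N -> f i Y = 0) ->
  (\sum_i d i < gdegree X)%N -> \prod_(i < m) f i (standard (P i)) = 0 :> F.
Proof.
move=> HP df lt; have [i di] : exists i, (d i <= gdegree (P i))%N.
  apply/existsP; apply: contraLR lt; rewrite negb_exists -leqNgt (sum_pieces HP) => /forallP no.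
  by apply: leq_sum => i _; have := no i; rewrite -ltnNge => /ltnW.
by rewrite (bigD1 i) //= df ?gdegree_std //; exact: mul0r.
Qed.

Lemma colorprod_degree : (forall i, gcochain (f i)) ->
  exists D, forall W L (X : dgraph O V W L), (D <= gdegree X)%N -> colorprod m f X = 0.
Proof.
move=> cf; have [d dP] := choice (fun i : 'I_m => gc_degree (cf i)).
(* The successor matters for [m = 0], where the product is nonzero on the empty graph, of degree
   0. *)
exists (\sum_i d i).+1 => W L X lt; rewrite /colorprod big1 // => c _.
by rewrite (prod_eq0 (pieceP c) dP lt) mulr0.
Qed.

End Degree.

(** * Contributions *)

Section ZProd.
Variables (F : fieldType) (O : cyclicOperad F) (V : vectType F) (m : nat).
Implicit Type f : nat -> hgraph O V -> F^o.

Definition zprod f : hairy O V -> F^o := hlift (fun X : hgraph O V => colorprod m f X).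

Lemma zprod_linear f : (forall i, gcochain (f i)) -> linear (zprod f).
Proof. by move=> cf; apply/hlift_linear/colorprod_respects => i; case: (cf i). Qed.

Lemma zprod_class f X : (forall i, gcochain (f i)) -> zprod f (hclass X) = colorprod m f X.
Proof. by move=> cf; apply/hliftE/colorprod_respects => i; case: (cf i). Qed.

Lemma zprod_standard f W L (X : dgraph O V W L) : (forall i, gcochain (f i)) ->
  zprod f (hclass (standard X)) = colorprod m f X.
Proof.
move=> cf; rewrite zprod_class // colorprod_standard // => i.
by case: (cf i) => -[].
Qed.

Lemma gcochain0 : gcochain (fun _ : hgraph O V => 0 : F^o).
Proof.
split=> //; last by exists 0%N.
split.
- by move=> X Y phi _; rewrite scaler0.
- by move=> *; rewrite scaler0 addr0.
- by move=> *; rewrite scaler0 addr0.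
Qed.

Variables (k : 'I_m -> nat).
Local Notation PH := (@connected_graph F O V).
Variable z : forall i, cocycles PH (pred1 (k i)).

(** Padded by zero beyond [m], so that hypotheses on the family hold for all indices. *)
Definition znat (j : nat) : hgraph O V -> F^o :=
  if insub j is Some i then graph_fun (subval (z i)) else fun=> 0.

Lemma znatE (i : 'I_m) : znat i = graph_fun (subval (z i)).
Proof. by rewrite /znat valK. Qed.

Lemma znat_cochain i : gcochain (znat i).
Proof.
rewrite /znat; case: insub => [j|]; last exact: gcochain0.
by case: (graph_fun_cocycle (z j)).
Qed.

Lemma scalar_linear (Z : hairy O V -> F) : scalar Z -> linear (Z : hairy O V -> F^o).
Proof. by []. Qed.

Lemma contribution_zprod : is_contribution z (zprod znat).
Proof.
have nat_z i : natural (znat i) by case: (znat_cochain i) => -[].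
have disc_z i (X : hgraph O V) : ~~ gconnected X -> znat i X = 0.
  by case: (znat_cochain i) => _ H _; exact: H.
split.
- exact: zprod_linear znat_cochain.
- move=> X cX; rewrite dun_standard zprod_standard; last exact: znat_cochain.
  rewrite (colorprod_dun nat_z disc_z cX); apply: eq_bigr => s _; congr (_ * _).
  by apply: eq_bigr => i _; rewrite znatE /graph_fun (cX (s i) : gconnected _).
- move=> r X rm cX; rewrite dun_standard zprod_standard; last exact: znat_cochain.
  by rewrite (colorprod_dun_neq disc_z cX) //; exact/eqP.
Qed.

(** By [decomposition] each graph is, up to sign, a disjoint union of connected graphs, where one of
    the two conditions fixes the value. *)
Lemma contribution_unique Z Z' : is_contribution z Z -> is_contribution z Z' -> Z = Z'.
Proof.
move=> [lZ pZ oZ] [lZ' pZ' oZ']; apply/funext.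
apply: (linear_hairy_eq (M := F^o) (scalar_linear lZ) (scalar_linear lZ')) => X.
have [r [Y [cY [g sg]]]] := decomposition X.
have [nh _ _] := @hclass_respects F O V.
have XE : hclass X = (-1) ^+ sgn g *: hclass (disjoint_union Y).
  rewrite dun_standard (natural_std nh sg) signrZK natural_hgr //.
have ZZ (U : hairy O V -> F) : scalar U -> forall a x, U (a *: x) = a * U x.
  move=> lU a x; have U0 : U 0 = 0 by have := lU (-1) 0 0; rewrite scaler0 addr0 mulN1r addNr.
  by have := lU a x 0; rewrite U0 !addr0.
rewrite XE ZZ // [RHS]ZZ //; congr (_ * _).
have [rm|rm] := eqVneq r m; last by rewrite oZ // oZ'.
by subst r; rewrite pZ // pZ'.
Qed.

End ZProd.

(** * Multilinearity and graded commutativity of products *)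

Lemma odd_card_addb (T : finType) (A : pred T) :
  odd #|A| = \big[addb/false]_(w : T) A w.
Proof.
rewrite -sum1_card addb_sum_bool big_mkcond; apply: eq_bigr => w _.
by rewrite -[w \in A]/(A w); case: (A w).
Qed.

Section ColorParity.
Variables (W : finType) (m : nat) (c : W -> 'I_m) (i j : 'I_m).
Hypothesis ij : j = i.+1 :> nat.

(** As the colors [i] and [j] are adjacent, exchanging them alters the comparison only for pairs
    consisting of one vertex of each. *)
Lemma cross_swap (c' : W -> 'I_m) : (forall u, c' u = tperm i j (c u)) ->
  cross c (+) cross c' = odd (#|[pred w | c w == i]| * #|[pred w | c w == j]|).
Proof.
move=> c'E; have nij : i != j by apply/eqP => E; move: ij; rewrite E => /n_Sn.
pose E (u v : W) := ((c u == i) && (c v == j)) || ((c u == j) && (c v == i)).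
have -> : cross c (+) cross c' = pairpar E.
  rewrite /cross -pairparD; apply: eq_pairpar => u v.
  rewrite !c'E (inj_eq perm_inj) /E.
  move: (c u) (c v) => a b; have [<-|ab] := eqVneq a b.
    by rewrite /=; have [->|] := eqVneq a i; rewrite ?(negPf nij) ?andbF //= andbF.
  rewrite /= addbACA addbb addFb.
  have tv (x : 'I_m) : tperm i j x = (if x == i :> nat then i.+1 else
      if x == i.+1 :> nat then i : nat else x) :> nat.
    rewrite -ij; have [->|xi] := eqVneq x i; first by rewrite tpermL eqxx.
    have [->|xj] := eqVneq x j; last first.
      have -> : tperm i j x = x by rewrite tpermD // eq_sym.
      by move: xi xj; rewrite -!val_eqE /= => /negPf-> /negPf->.
    by rewrite tpermR eqxx ij (gtn_eqF (ltnSn i)).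
  rewrite -!val_eqE !tv /= ij; move: ab; rewrite -val_eqE /=.
  move: (a : nat) (b : nat) (i : nat) => x y z xy.
  by case: (eqVneq x z); case: (eqVneq y z); case: (eqVneq x z.+1); case: (eqVneq y z.+1); lia.
rewrite oddM !odd_card_addb.
(* An ordering with all vertices of color [i] in front: a mixed pair is then listed with its vertex
   of color [i] first, and the pairs form a product of sets. *)
pose r u := if c u == i then rank u else (rank u + #|W|)%N.
have rlt (u : W) : (rank u < #|W|)%N by rewrite -rank_enum_rank ltn_ord.
have ri : injective r.
  move=> u v; rewrite /r; case: ifP => cu; case: ifP => cv.
  - exact: rank_inj.
  - by move=> E1; have := rlt u; rewrite E1 ltnNge leq_addl.
  - by move=> E1; have := rlt v; rewrite -E1 ltnNge leq_addl.
  - by move/addIn/rank_inj.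
rewrite (pairpar_base _ ri); last by move=> u v; rewrite /E orbC andbC [X in _ || X]andbC.
transitivity (\big[addb/false]_(p : W * W) ((c p.1 == i) && (c p.2 == j))).
  rewrite big_mkcond; apply: eq_bigr => -[u v] _ /=; rewrite /E /r.
  have [ui|ui] := eqVneq (c u) i; have [vi|vi] := eqVneq (c v) i;
    rewrite ?ui ?vi ?(negPf nij) /= ?andbF ?orbF.
  - by rewrite if_same.
  - by rewrite (leq_trans (rlt u)) ?leq_addl.
  - by rewrite ltnNge (ltnW (leq_trans (rlt v) (leq_addl _ _))).
  - by rewrite if_same.
rewrite -(pair_bigA _ (fun u v => (c u == i) && (c v == j))) /=.
set B := \big[addb/false]_(w : W) [pred w | c w == j] w.
have mB : {morph andb^~ B : x y / x (+) y} by move=> x y; exact: andb_addl.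
rewrite (big_morph _ mB (andFb B)); apply: eq_bigr => u _; rewrite /B /=.
have mu : {morph andb (c u == i) : x y / x (+) y} by move=> x y; exact: andb_addr.
by rewrite (big_morph _ mu (andbF _)).
Qed.

End ColorParity.

Section Multilinear.
Variables (F : fieldType) (O : cyclicOperad F) (V : vectType F) (m : nat).
Implicit Type f : nat -> hgraph O V -> F^o.

Lemma colorprod_ext f f' W L (X : dgraph O V W L) :
  (forall i, (i < m)%N -> f i =1 f' i) -> colorprod m f X = colorprod m f' X.
Proof.
move=> ff; rewrite /colorprod; apply: eq_bigr => c _; congr (_ * _).
by apply: eq_bigr => i _; exact: ff.
Qed.

Lemma colorprod_slot f f1 f2 (i : 'I_m) a W L (X : dgraph O V W L) :
  (forall Y, f i Y = a * f1 i Y + f2 i Y) ->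
  (forall j, j != i -> f1 j =1 f j /\ f2 j =1 f j) ->
  colorprod m f X = a * colorprod m f1 X + colorprod m f2 X.
Proof.
move=> fi fj; rewrite /colorprod mulr_sumr -big_split; apply: eq_bigr => c _ /=.
rewrite mulrCA -mulrDr; congr (_ * _).
rewrite (bigD1 i) //= [in X in _ = _ * X + _](bigD1 i) //= [in X in _ = _ + X](bigD1 i) //=.
rewrite fi mulrDl -mulrA; congr (_ * (_ * _) + _ * _); apply: eq_bigr => j ji;
  by have [E1 E2] := fj j ji; rewrite ?E1 ?E2.
Qed.

Lemma below_pieces W L (X : dgraph O V W L) (c : coloring X m) (i0 : 'I_m)
    (WP LP : 'I_m -> finType) (P : forall i, dgraph O V (WP i) (LP i))
    (pe : forall i, emb (P i) X) (k : nat -> nat) :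
  (forall i, is_piece (val c) i (pe i)) ->
  (forall j : 'I_m, j != i0 -> nv (standard (P j)) = k j) ->
  below c i0 = odd (\sum_(j < m | (j < i0)%N) k j).
Proof.
move=> HP kP; rewrite /below -(odd_card_addb (fun w => val c (inl w) < i0)%N).
rewrite -sum1_card (partition_big (fun w => val c (inl w)) (fun j : 'I_m => (j < i0)%N)) //=.
congr odd; apply: eq_bigr => j ji; have nj : j != i0 by rewrite -val_eqE neq_ltn ji.
rewrite -kP // (nv_piece (HP j)) sum1_card; apply: eq_card => w.
rewrite !unfold_in /=; case: eqP => [->|_]; last by rewrite andbF.
by rewrite ji.
Qed.

(** The sign [below] varies with the coloring. But either every other piece has the size prescribed
    by the degree of its functional, or a factor vanishes; so the sign can be taken constant. *)
Lemma cobound_term W L (X : dgraph O V W L) (c : coloring X m) (i0 : 'I_m)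
    (WP LP : 'I_m -> finType) (P : forall i, dgraph O V (WP i) (LP i))
    (pe : forall i, emb (P i) X) (k : nat -> nat) f (x : F) :
  (forall i, is_piece (val c) i (pe i)) ->
  (forall (j : 'I_m) (Y : hgraph O V), j != i0 -> nv Y != k j -> f j Y = 0) ->
  (-1) ^+ below c i0 * (x * \prod_(j < m | j != i0) f j (standard (P j))) =
  (-1) ^+ odd (\sum_(j < m | (j < i0)%N) k j) *
    (x * \prod_(j < m | j != i0) f j (standard (P j))) :> F.
Proof.
move=> HP fk; have [/forallP H|] :=
  boolP [forall j : 'I_m, (j != i0) ==> (nv (standard (P j)) == k j)].
  rewrite (below_pieces (k := k) HP) // => j ji.
  by have := H j; rewrite ji => /eqP.
rewrite negb_forall => /existsP[j]; rewrite negb_imply => /andP[ji kj].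
have -> : \prod_(j < m | j != i0) f j (standard (P j)) = 0 :> F.
  by rewrite (bigD1 j) //= fk //; exact: mul0r.
by rewrite !mulr0.
Qed.

(** By the Leibniz rule, where only the term at [i0] survives because the other factors are
    cocycles; its sign is constant by [cobound_term]. *)
Lemma colorprod_cobound f (k : nat -> nat) (g : hgraph O V -> F^o) (i0 : 'I_m) :
  (forall j : nat, natural (f j)) -> natural g ->
  (forall (j : 'I_m) (Y : hgraph O V), j != i0 -> nv Y != k j -> f j Y = 0) ->
  (forall (j : 'I_m) (Y : hgraph O V), j != i0 -> gbd (f j) Y = 0) ->
  (forall Y : hgraph O V, f i0 Y = gbd g Y) ->
  forall W L (X : dgraph O V W L),
  gbd (fun Y : hgraph O V => colorprod m (fun j => if j == i0 :> nat then g else f j) Y) X =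
  (-1) ^+ odd (\sum_(j < m | (j < i0)%N) k j) * colorprod m f X.
Proof.
move=> nf ng fk fb fg W L X; pose f' (j : nat) := if j == i0 :> nat then g else f j; rewrite -/f'.
have nf' j : natural (f' j) by rewrite /f'; case: eqP.
have f'0 : f' i0 = g by rewrite /f' eqxx.
have f'j (j : 'I_m) : j != i0 -> f' j = f j by move=> ji; rewrite /f' val_eqE (negPf ji).
rewrite (colorprod_bd m X nf') /colorprod mulr_sumr; apply: eq_bigr => c _.
rewrite mulrCA; congr (_ * _).
rewrite (big_only1 i0) //; last first.
  move=> j ji _; rewrite (f'j j ji) -(gbd_std _ (nf j)) fb // mul0r.
  exact: mulr0.
rewrite f'0 -(gbd_std _ ng) -fg (bigD1 i0 (P := xpredT)) //=.
rewrite (eq_bigr (fun j : 'I_m => f j (standard (piece c j)))) => [|j ji]; last by rewrite f'j.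
exact: (cobound_term _ (pieceP c) fk).
Qed.

Lemma colorprod_swap f f' (k : nat -> nat) (i j : 'I_m) : j = i.+1 :> nat ->
  (forall l, natural (f l)) ->
  (forall (l : 'I_m) (Y : hgraph O V), (l == i) || (l == j) -> nv Y != k l -> f l Y = 0) ->
  (forall l : 'I_m, f' (tperm i j l) =1 f l) ->
  forall W L (X : dgraph O V W L),
  colorprod m f X = (-1) ^+ (k i * k j) * colorprod m f' X.
Proof.
move=> ij nf fk ff W L X; rewrite /colorprod mulr_sumr; set t := tperm i j in ff *.
apply: (@sum_rel _ _ _ (fun (c c' : coloring X m) => forall u, val c' u = t (val c u))).
- move=> c; have [|c' E] := coloring_of (G := X) (c := fun u => t (val c u)).
    by move=> z; rewrite coloringP.
  by exists c'.
- move=> c; have [|c' E] := coloring_of (G := X) (c := fun u => t (val c u)).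
    by move=> z; rewrite coloringP.
  by exists c' => u; rewrite E tpermK.
- by move=> c c' c'' E1 E2; apply: coloring_eq => u; rewrite E1 E2.
- by move=> c c' c'' E1 E2; apply: coloring_eq => u; apply: (@perm_inj _ t); rewrite -E1 -E2.
move=> c c' cE.
have -> : \prod_(l < m) f' l (standard (piece c' l)) =
  \prod_(l < m) f l (standard (piece c l)) :> F.
  rewrite (reindex_inj (@perm_inj _ t)) /=; apply: eq_bigr => l _; rewrite ff.
  have P : is_piece (val c) l (piece_emb c' (t l)).
    have [pm pc pcL pim pimL] := pieceP c' (t l); split=> //.
    - by move=> w; apply: (@perm_inj _ t); rewrite -cE pc.
    - by move=> w; apply: (@perm_inj _ t); rewrite -cE pcL.
    - by move=> w wl; apply: pim; rewrite cE wl.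
    - by move=> w wl; apply: pimL; rewrite cE wl.
  have [g [sg gE]] := piece_iso P (pieceP c l).
  by rewrite (natural_std (nf l) sg) gE scale1r.
have [Hk|] :=
  boolP [forall l : 'I_m, ((l == i) || (l == j)) ==> (nv (standard (piece c l)) == k l)].
  rewrite mulrA; congr (_ * _); rewrite -[(-1) ^+ (k i * k j)]signr_odd -signr_addb.
  congr (_ ^+ nat_of_bool _).
  have ki : k i = #|[pred w | val c (inl w) == i]|.
    have H : (i == i) || (i == j) by rewrite eqxx.
    have /eqP <- := implyP (forallP Hk i) H; exact: nv_piece (pieceP c i).
  have kj : k j = #|[pred w | val c (inl w) == j]|.
    have H : (j == i) || (j == j) by rewrite eqxx orbT.
    have /eqP <- := implyP (forallP Hk j) H; exact: nv_piece (pieceP c j).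
  rewrite ki kj -(cross_swap ij (c' := fun w => val c' (inl w))) => [|u]; last exact: cE.
  by rewrite /crosspar /cross -addbA addbb addbF.
rewrite negb_forall => /existsP[l]; rewrite negb_imply => /andP[li kl].
have -> : \prod_(l < m) f l (standard (piece c l)) = 0 :> F.
  by rewrite (bigD1 l) // fk //; exact: mul0r.
by rewrite !mulr0.
Qed.

Lemma colorprod_act f f' (g : 'End(V)) :
  (forall (i : 'I_m) (Y : hgraph O V), f' i (HGraph (map_lab Y g)) = f i Y) ->
  forall X : hgraph O V, colorprod m f' (map_lab X g) = colorprod m f X.
Proof.
move=> ff X; rewrite /colorprod; apply: eq_bigr => c _; congr (_ * _).
by apply: eq_bigr => i _; rewrite -ff.
Qed.

End Multilinear.

(** * The assembly map *)

Section Assembly.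
Variables (F : fieldType) (O : cyclicOperad F) (V : vectType F).
Variables (n : nat) (p q : 'I_n -> V).
Local Notation PH := (@connected_graph F O V).
Local Notation PG := (@connected_hairless F O V).
Local Notation S := (@split_map F O V n p q).
Local Notation eS := (@exp_split F O V n p q).
Local Notation functional := (nat -> hgraph O V -> F^o).
Implicit Type (k : nat -> nat).

Definition asm m (f : functional) (x : subcomplex PG) : F^o := zprod m f (eS (subval x)).

(** The default 0 never matters for a family of cocycles, by [asmclsK]. *)
Definition asmcls m (f : functional) : cohomology PG predT :=
  cohclass (insubd (0 : cocycles PG predT) (asm m f)).

Lemma asm_ext m f f' : (forall i, (i < m)%N -> f i =1 f' i) -> asm m f = asm m f'.
Proof.
move=> ff; apply/funext => x; rewrite /asm /zprod; congr (hlift _ _).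
by apply/funext => X; exact: colorprod_ext.
Qed.

Lemma gcochain_lin a (f f' : hgraph O V -> F^o) : gcochain f -> gcochain f' ->
  gcochain (fun X => a * f X + f' X).
Proof.
move=> [[nf lf df] cf [d fd]] [[nf' lf' df'] cf' [d' fd']]; split; first split.
- move=> X Y phi sp; rewrite (nf _ _ _ sp) (nf' _ _ _ sp).
  by rewrite /GRing.scale /= mulrDr mulrCA.
- move=> j l G de i b b0 b1 b2 bi bj; rewrite (lf _ _ _ _ _ _ _ _ _ bi bj)
    (lf' _ _ _ _ _ _ _ _ _ bi bj).
  by rewrite /GRing.scale /= !mulrDr addrACA [a * (_ * _)]mulrCA.
- move=> j l G b i c e e1 e2 bi bj; rewrite (df _ _ _ _ _ _ _ _ _ bi bj)
    (df' _ _ _ _ _ _ _ _ _ bi bj).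
  by rewrite /GRing.scale /= !mulrDr addrACA [a * (_ * _)]mulrCA.
- by move=> X cX; rewrite cf // cf' // mulr0 addr0.
- exists (maxn d d') => X; rewrite geq_max => /andP[dX d'X].
  by rewrite fd // fd' // mulr0 addr0.
Qed.

(** Cutting an edge changes no valence, so S keeps the degree and a bound for the product remains
    valid after any power of S. *)
Lemma zprod_iter_degree m f D j : (forall i, gcochain (f i)) ->
  (forall W L (X : dgraph O V W L), (D <= gdegree X)%N -> colorprod m f X = 0) ->
  forall W L (X : dgraph O V W L), (D <= gdegree X)%N ->
  zprod m f (iter j S (hclass (standard X))) = 0.
Proof.
move=> cf H; pose Z : {linear hairy O V -> F^o} :=
  HB.pack (zprod m f) (GRing.isLinear.Build _ _ _ _ _ (zprod_linear m cf)).
elim: j => [|j IH] W L X DX; first by rewrite zprod_standard // H.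
pose J : {linear hairy O V -> F^o} := Z \o iter j S.
rewrite iterSr split_standard /gsplit -[LHS]/(J _) linearZ.
suff -> : J (\sum_(i < n) (gcut (@hclass F O V) X (p i) (q i) + gcut (@hclass F O V) X (q i)
  (- p i))) = 0.
  exact: scaler0.
rewrite linear_sum big1 // => i _; rewrite linearD.
have J0 x y : J (gcut (@hclass F O V) X x y) = 0.
  by rewrite /gcut linear_sum big1 // => e _; exact: IH.
by rewrite !J0 addr0.
Qed.

Lemma asm_cochain m f : (forall i, gcochain (f i)) -> is_cochain predT (asm m f).
Proof.
move=> cf; have lz := zprod_linear m cf; split=> //.
- by move=> a x y; rewrite /asm subval_linear linearP lz.
- have [D DP] := colorprod_degree m cf; exists D => X PX DX.
  rewrite /asm subval_sclass // exp_hclass /gexp.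
  pose Z : {linear hairy O V -> F^o} := HB.pack (zprod m f) (GRing.isLinear.Build _ _ _ _ _ lz).
  rewrite -[LHS]/(Z _) linear_sum big1 // => j _; rewrite linearZ /=.
  have [nh _ _] := @hclass_respects F O V; rewrite -(natural_hgr X nh).
  by rewrite (zprod_iter_degree j cf DP) // scaler0.
Qed.

Lemma zprod_bd m f y : (forall i, gcochain (f i)) ->
  zprod m f (bd y) = hlift (fun X : hgraph O V => gbd (fun Y : hgraph O V => colorprod m f Y) X) y.
Proof.
move=> cf; have lz := zprod_linear m cf.
pose Z : {linear hairy O V -> F^o} := HB.pack (zprod m f) (GRing.isLinear.Build _ _ _ _ _ lz).
have rc : respects (fun X : hgraph O V => colorprod m f X).
  by apply: colorprod_respects => i; case: (cf i).
have rg := gbd_respects rc.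
rewrite -[LHS]/((Z \o @bd F O V) y).
apply: (linear_hairy_eq (M := F^o)); [exact: linearP|exact: hlift_linear rg|].
move=> X; rewrite hliftE // -[LHS]/(Z (bd _)) bd_hclass /gbd linear_sum.
by apply: eq_bigr => e _; rewrite linearZ /= zprod_class.
Qed.

Lemma asm_cocycle m f k : (forall i, gcocycle (k i) (f i)) -> is_cocycle predT (asm m f).
Proof.
move=> zf; have cf i : gcochain (f i) by case: (zf i).
split; first exact: asm_cochain.
move=> x; rewrite /asm subval_subrestrict; last exact: bd_span_PG.
rewrite exp_bd zprod_bd //.
rewrite (_ : (fun X : hgraph O V => _) = (fun=> 0 : F^o)).
  apply: (linear_hairy_eq (M := F^o) (f := hlift (fun=> 0 : F^o)) (g := fun=> 0)).
  - by apply: hlift_linear; case: (gcochain0 O V).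
  - by move=> a u v; rewrite scaler0 addr0.
  - by move=> X; rewrite hliftE //; case: (gcochain0 O V).
apply/funext => X; rewrite colorprod_bd; last by move=> i; case: (cf i) => -[].
rewrite big1 // => c _; rewrite big1 ?mulr0 // => i _.
rewrite -gbd_std; last by case: (cf i) => -[].
have [_ _ ->] := zf i; rewrite mul0r; exact: mulr0.
Qed.

Lemma asmclsK m f k : (forall i, gcocycle (k i) (f i)) ->
  subval (insubd (0 : cocycles PG predT) (asm m f)) = asm m f.
Proof.
move=> zf; rewrite -[LHS]/(val _) insubdK //; apply/asboolP.
exact: asm_cocycle zf.
Qed.

Lemma cohclass_eq (z z' : cocycles PG predT) (h : subcomplex PG -> F^o) :
  is_cochain predT h ->
  (forall x, subval z x - subval z' x = h (subrestrict (@bd F O V) x)) ->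
  cohclass z = cohclass z'.
Proof.
move=> ch E; apply/eqP; rewrite /cohclass qproj_eq; apply: in_lspan.
by exists h => // x; rewrite -E.
Qed.

(** Covers linearity in one factor and independence of its representative at once. The product is
    multilinear, and its term with [gbd g] has, up to a constant sign, the product with [g] as
    primitive. *)
Lemma asmcls_slot m (i0 : 'I_m) k f f1 f2 (a : F) (g : hgraph O V -> F^o) :
  (forall i, gcocycle (k i) (f i)) -> (forall i, gcocycle (k i) (f1 i)) ->
  (forall i, gcocycle (k i) (f2 i)) -> gcochain g ->
  (forall j : nat, j != i0 -> f1 j =1 f j /\ f2 j =1 f j) ->
  (forall X, f i0 X = a * f1 i0 X + f2 i0 X + gbd g X) ->
  asmcls m f = a *: asmcls m f1 + asmcls m f2.
Proof.
move=> zf zf1 zf2 cg fj fi.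
have cf i : gcochain (f i) by case: (zf i).
have cf1 i : gcochain (f1 i) by case: (zf1 i).
have cf2 i : gcochain (f2 i) by case: (zf2 i).
pose gb (X : hgraph O V) : F^o := gbd g X.
(* Being a combination of the given cochains, [gbd g] is one too, without a study of how
   contractions affect degrees. *)
have cgb : gcochain gb.
  have -> : gb = fun X => (-1) * (a * f1 i0 X + f2 i0 X) + f i0 X.
    by apply/funext => X; rewrite fi mulN1r addrC addrAC subrr add0r.
  exact/gcochain_lin/cf/gcochain_lin.
pose h (j : nat) := if j == i0 then gb else f j.
pose f' (j : nat) := if j == i0 then g else f j.
have ch j : gcochain (h j) by rewrite /h; case: eqP.
have cf' j : gcochain (f' j) by rewrite /f'; case: eqP.
have nat_of (u : functional) : (forall j, gcochain (u j)) -> forall j, natural (u j).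
  by move=> cu j; case: (cu j) => -[].
pose f3 (j : nat) := if j == i0 then fun X => a * f1 i0 X + f2 i0 X else f j.
have E W L (X : dgraph O V W L) : colorprod m f X =
    a * colorprod m f1 X + colorprod m f2 X + colorprod m h X.
  rewrite (@colorprod_slot _ _ _ m f f3 h i0 1) => [|Y|j ji]; last 2 first.
  - by rewrite /f3 /h eqxx mul1r fi.
  - by rewrite /f3 /h val_eqE (negPf ji).
  rewrite mul1r (@colorprod_slot _ _ _ m f3 f1 f2 i0 a) => [//|Y|j ji].
  - by rewrite /f3 eqxx.
  - by rewrite /f3 val_eqE (negPf ji); exact: fj.
pose b := odd (\sum_(j < m | (j < i0)%N) k j).
have B W L (X : dgraph O V W L) : gbd (fun Y : hgraph O V => colorprod m f' Y) X =
    (-1) ^+ b * colorprod m h X.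
  have := @colorprod_cobound _ _ _ m h k g i0 (nat_of h ch) (nat_of (fun=> g)
    (fun=> cg) 0%N) _ _ _ W L X.
  have -> : (fun j : nat => if j == i0 then g else h j) = f'.
    by apply/funext => j; rewrite /f' /h; case: eqP.
  apply.
  - move=> j Y ji; rewrite /h val_eqE (negPf ji) => kj.
    by have [_ H _] := zf j; exact: H.
  - move=> j Y ji; rewrite /h val_eqE (negPf ji).
    by have [_ _ H] := zf j; exact: H.
  - by move=> Y; rewrite /h eqxx.
have rc u : (forall j, gcochain (u j)) -> respects (fun X : hgraph O V => colorprod m u X).
  by move=> cu; apply: colorprod_respects => i; case: (cu i).
(* The identity on the whole hairy complex. Evaluated at e^S of a graph without hairs, its last term
   is a coboundary since e^S is a chain map. *)
have ZE y : zprod m f y = a * zprod m f1 y + zprod m f2 y + (-1) ^+ b * zprod m f' (bd y).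
  have l1 := zprod_linear m cf1; have l2 := zprod_linear m cf2.
  have l3 := zprod_linear m cf'.
  apply: (linear_hairy_eq (M := F^o)
    (g := fun y => a * zprod m f1 y + zprod m f2 y + (-1) ^+ b * zprod m f' (bd y))).
  - exact: zprod_linear.
  - move=> c u v; rewrite l1 l2 linearP l3.
    rewrite /GRing.scale /= !mulrDr !(mulrCA _ c).
    by rewrite [X in X + _ = _]addrACA [LHS]addrACA.
  - move=> X; rewrite !zprod_class // E zprod_bd // hliftE; last exact/gbd_respects/rc.
    by rewrite B mulrA -signr_addb addbb mul1r.
rewrite /asmcls /cohclass -linearP; apply: (cohclass_eq (h := (-1) ^+ b \*: asm m f')).
  have [lf' [d df'] sf'] := asm_cochain m cf'; split=> //.
  - by move=> c x y; rewrite /= lf' scalerDr !scalerA mulrC.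
  - by exists d => X PX dX; rewrite /= df' // scaler0.
move=> x; rewrite -[subval (_ *: _ + _)]/(val _) linearP /=.
rewrite (asmclsK m zf) (asmclsK m zf1) (asmclsK m zf2) /asm.
rewrite ZE subval_subrestrict; last exact: bd_span_PG.
by rewrite exp_bd /GRing.scale /= mulrN -opprD addrAC subrr add0r.
Qed.

End Assembly.

(** * Descent to the cohomology algebra *)

Section AssemblyMap.
Variables (F : fieldType) (O : cyclicOperad F) (V : vectType F).
Variables (n : nat) (p q : 'I_n -> V).
Local Notation PH := (@connected_graph F O V).
Local Notation PG := (@connected_hairless F O V).
Local Notation S := (@split_map F O V n p q).
Local Notation eS := (@exp_split F O V n p q).
Local Notation functional := (nat -> hgraph O V -> F^o).
Local Notation asm := (@asm F O V n p q).
Local Notation asmcls := (@asmcls F O V n p q).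

Lemma asmcls_ext m (f f' : functional) :
  (forall i, (i < m)%N -> f i =1 f' i) -> asmcls m f = asmcls m f'.
Proof. by move=> ff; rewrite /asmcls (asm_ext p q ff). Qed.

Lemma asmcls_cohom m (k : nat -> nat) (f f' : functional) :
  (forall i, gcocycle (k i) (f i)) -> (forall i, gcocycle (k i) (f' i)) ->
  (forall i, (i < m)%N -> exists2 g : hgraph O V -> F^o, gcochain g &
     forall X, f i X = f' i X + gbd g X) ->
  asmcls m f = asmcls m f'.
Proof.
(* The functionals are exchanged one at a time; [mix r] has the first [r] replaced. *)
move=> zf zf' ff'; pose mix r (j : nat) := if (j < r)%N then f' j else f j.
have zmix r j : gcocycle (k j) (mix r j) by rewrite /mix; case: ifP.
suff H r : (r <= m)%N -> asmcls m f = asmcls m (mix r).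
  rewrite (H m) //; apply: asmcls_ext => i im; by rewrite /mix im.
elim: r => [|r IH] rm; first exact: asmcls_ext.
have [g cg gE] := ff' r rm.
(* With coefficient 0, the slot lemma reduces to changing one factor by a coboundary. *)
rewrite IH ?(ltnW rm) // (@asmcls_slot _ _ _ _ _ _ m (Ordinal rm) k (mix r) (mix r.+1)
  (mix r.+1) 0 g) //.
- by rewrite scale0r add0r.
- by move=> j jr; rewrite /mix ltnS leq_eqVlt (negPf jr).
- by move=> X; rewrite /mix ltnSn ltnn gE mul0r add0r.
Qed.

Lemma asmcls_swap m (i j : 'I_m) (k k' : nat -> nat) (f f' : functional) : j = i.+1 :> nat ->
  (forall l, gcocycle (k l) (f l)) -> (forall l, gcocycle (k' l) (f' l)) ->
  (forall l : 'I_m, f' (tperm i j l) =1 f l) ->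
  asmcls m f = (-1) ^+ (k i * k j) *: asmcls m f'.
Proof.
move=> ij zf zf' ff; rewrite /asmcls /cohclass -linearZ; congr (qproj _ _).
apply: val_inj; rewrite linearZ /= (asmclsK p q m zf) (asmclsK p q m zf').
apply/funext => x; rewrite /asm; set y := eS _.
have cf l : gcochain (f l) by case: (zf l).
have cf' l : gcochain (f' l) by case: (zf' l).
apply: (linear_hairy_eq (M := F^o) (g := fun y => (-1) ^+ (k i * k j) * zprod m f' y)).
- exact: zprod_linear.
- move=> c u v; rewrite (zprod_linear m cf') mulrDr; congr (_ + _).
  exact: mulrCA.
- move=> X; rewrite !zprod_class //.
  apply: (colorprod_swap ij) => // [l|l Y _ kl]; first by case: (cf l) => -[].
  by case: (zf l) => _ H _; exact: H.
Qed.

Section Words.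

Local Notation H k := (cohomology PH (pred1 k)).
Local Notation word := (word (fun k => H k : lmodType F)).
Local Notation lett := {k : nat & H k}.

Definition crepr k (c : H k) : cocycles PH (pred1 k) := repr c.

(** The zero class in degree 0: beyond the end of a word [wfun] is still a cocycle, so its cocycle
    property needs no bound on the index. *)
Definition lett0 : lett := existT (fun k => H k) 0%N 0.

Definition wdeg (w : word) (j : nat) : nat := tag (nth lett0 w j).
Definition wfun (w : word) (j : nat) : hgraph O V -> F^o :=
  graph_fun (subval (crepr (tagged (nth lett0 w j)))).

Lemma wfun_cocycle w j : gcocycle (wdeg w j) (wfun w j).
Proof. exact: graph_fun_cocycle. Qed.

Lemma nth_mid (T : Type) (x0 a : T) s t j :
  nth x0 (s ++ a :: t) j = if j == size s then a else nth x0 (s ++ x0 :: t) j.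
Proof.
rewrite !nth_cat; case: ltngtP => [//|lt|->]; last by rewrite subnn.
by case E: (j - size s)%N => [|d] //=; move: lt; rewrite -subn_gt0 E.
Qed.

Definition wasm (w : word) : cohomology PG predT := asmcls (size w) (wfun w).

Lemma cohclass_repr_eq k (z : cocycles PH (pred1 k)) :
  exists2 g : hgraph O V -> F^o, gcochain g &
    forall X, graph_fun (subval (crepr (cohclass z))) X = graph_fun (subval z) X + gbd g X.
Proof.
have : crepr (cohclass z) - z \in coboundaries PH (pred1 k).
  by rewrite -qproj_eq /crepr qprojK.
move=> /coboundary_graph_fun[g cg gE]; exists g => // X; rewrite -gE /graph_fun.
by case: ifP => _; rewrite ?addr0 // addrC -[subval (_ - _)]/(val _) linearB /= !fctE subrK.
Qed.

(** The choice of representatives is not linear, but its defect is a coboundary, which [asmcls_slot]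
    absorbs. *)
Lemma wasm_linear (s t : word) k a (u v : H k) :
  wasm (s ++ letter (a *: u + v) :: t) =
    a *: wasm (s ++ letter u :: t) + wasm (s ++ letter v :: t).
Proof.
have im : (size s < size (s ++ letter (a *: u + v) :: t))%N.
  by rewrite size_cat /= addnS ltnS leq_addr.
have : crepr (a *: u + v) - (a *: crepr u + crepr v) \in coboundaries PH (pred1 k).
  by rewrite -qproj_eq linearP /= /crepr !qprojK.
move=> /coboundary_graph_fun[g cg gE].
have degE (c d : H k) j : wdeg (s ++ letter c :: t) j = wdeg (s ++ letter d :: t) j.
  by rewrite /wdeg nth_mid [in RHS]nth_mid; case: eqP.
have zw (c : H k) j : gcocycle (wdeg (s ++ letter u :: t) j) (wfun (s ++ letter c :: t) j).
  by rewrite (degE u c); exact: wfun_cocycle.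
have fj (c d : H k) j : j != size s -> wfun (s ++ letter c :: t) j =1 wfun (s ++ letter d :: t) j.
  by move=> /negPf js X; rewrite /wfun nth_mid [in RHS]nth_mid js.
have fs (c : H k) : wfun (s ++ letter c :: t) (size s) = graph_fun (subval (crepr c)).
  by rewrite /wfun nth_mid eqxx.
have sz (c : H k) : size (s ++ letter (a *: u + v) :: t) = size (s ++ letter c :: t).
  by rewrite !size_cat.
rewrite /wasm -(sz u) -(sz v).
apply: (@asmcls_slot _ _ _ _ _ _ _ (Ordinal im) _ _ _ _ _ g (zw _) (zw _) (zw _) cg).
- by move=> j js; split; apply: fj.
- move=> X; rewrite /= !fs -gE /graph_fun; case: ifP => _; last by rewrite mulr0 !addr0.
  rewrite -[subval (_ - _)]/(val _) linearB linearP /= !fctE /= /GRing.scale /= mulrN -opprD.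
  by rewrite [RHS]addrC subrK.
Qed.

Lemma wasm_comm (s t : word) k l (u : H k) (v : H l) :
  wasm (s ++ [:: letter u, letter v & t]) =
    (-1) ^+ (k * l) *: wasm (s ++ [:: letter v, letter u & t]).
Proof.
set w := s ++ _; set w' := s ++ [:: letter v, letter u & t].
have sz : size w' = size w by rewrite !size_cat.
have im : (size s < size w)%N by rewrite size_cat /= !addnS ltnS -addnS leq_addr.
have jm : ((size s).+1 < size w)%N by rewrite size_cat /= !addnS !ltnS leq_addr.
have n0 (c d : lett) : nth lett0 (s ++ [:: c, d & t]) (size s) = c.
  by rewrite nth_cat ltnn subnn.
have n1 (c d : lett) : nth lett0 (s ++ [:: c, d & t]) (size s).+1 = d.
  by rewrite nth_cat ltnNge leqnSn subSnn.
have kE : (k * l)%N = (wdeg w (Ordinal im) * wdeg w (Ordinal jm))%N.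
  by rewrite /wdeg /= n0 n1.
rewrite kE /wasm sz.
apply: asmcls_swap (wfun_cocycle w) (wfun_cocycle w') _ => // x X.
have [->|xi] := eqVneq x (Ordinal im); first by rewrite tpermL /wfun /= n0 n1.
have [->|xj] := eqVneq x (Ordinal jm); first by rewrite tpermR /wfun /= n0 n1.
rewrite tpermD 1?eq_sym // /wfun; suff -> : nth lett0 w' x = nth lett0 w x by [].
move: xi xj; rewrite -!val_eqE /= => xi xj.
rewrite !nth_cat; case: ltnP => // sx.
case E: (x - size s)%N => [|[|d]] //=.
- by move: xi; rewrite eqn_leq sx -subn_eq0 E.
- by move: xj; rewrite -(subnK sx) E add1n eqxx.
Qed.

Lemma wasm_gcrel x : x \in lspan (@gcrel F (fun k => H k : lmodType F)) ->
  fglift wasm x = 0 :> cohomology PG predT.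
Proof.
apply: lspan_eq0 => _ [s t k a u v|s t k l u v]; rewrite linearB.
- by rewrite linearP /= !fgliftU wasm_linear subrr.
- by rewrite linearZ /= !fgliftU wasm_comm subrr.
Qed.

Definition algasm : @cohomology_algebra F V O -> cohomology PG predT :=
  qlift (fglift wasm).

Lemma algasm_linear : linear algasm.
Proof. exact: qlift_linear wasm_gcrel. Qed.

HB.instance Definition _ := GRing.isLinear.Build F _ _ *:%R algasm algasm_linear.

Lemma znat_cocycle m (k : 'I_m -> nat) (z : forall i, cocycles PH (pred1 (k i))) (k' : nat -> nat) :
  (forall i : 'I_m, k' i = k i) -> forall j, gcocycle (k' j) (znat z j).
Proof.
move=> kk j; rewrite /znat; case: insubP => [i _ <-|_]; first by rewrite kk;
  exact: graph_fun_cocycle.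
split=> //; first exact: gcochain0.
by move=> X; rewrite /gbd big1 // => e _; exact: scaler0.
Qed.

Lemma znat_gcocycle m (k : 'I_m -> nat) (z : forall i, cocycles PH (pred1 (k i))) j :
  gcocycle (if insub j is Some i then k i else 0%N) (znat z j).
Proof. exact: (@znat_cocycle _ _ z (fun j => if insub j is Some i then k i else 0%N) (fun i =>
  congr1 (oapp k 0%N) (valK i))). Qed.

(** The map on words uses chosen representatives; [asmcls_cohom] replaces them by the given
    cocycles. *)
Lemma algasm_classprod m (k : 'I_m -> nat) (z : forall i, cocycles PH (pred1 (k i))) :
  algasm (classprod z) = asmcls m (znat z).
Proof.
rewrite /algasm /classprod /gcprod qliftE; last exact: wasm_gcrel.
rewrite /= fgliftU /wasm; set w := map _ _.
have sz : size w = m by rewrite size_map size_enum_ord.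
have nthw (i : 'I_m) : nth lett0 w i = letter (cohclass (z i)).
  by rewrite (nth_map i) ?size_enum_ord // nth_ord_enum.
rewrite sz; apply: (asmcls_cohom (wfun_cocycle w)) => [|j jm].
  by apply: znat_cocycle => i; rewrite /wdeg nthw.
rewrite -[j]/(val (Ordinal jm)) znatE /wfun nthw; exact: cohclass_repr_eq.
Qed.

End Words.

End AssemblyMap.

Section Equivariance.
Variables (F : fieldType) (O : cyclicOperad F) (V : vectType F).
Variables (omega : {skew_symmetric V}) (n : nat) (p q : 'I_n -> V).
Hypothesis Hpq : symplectic_basis omega p q.
Local Notation PH := (@connected_graph F O V).
Local Notation PG := (@connected_hairless F O V).
Local Notation algasm := (@algasm F O V n p q).

Lemma zprod_act (g : 'End(V)) m (k : 'I_m -> nat) (z gz : forall i, cocycles PH (pred1 (k i))) :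
  (forall i x, subval (gz i) (subrestrict (hact g) x) = subval (z i) x) ->
  forall x, zprod m (znat gz) (hact g x) = zprod m (znat z) x.
Proof.
move=> gzE; have [c1 c2] := (znat_cochain z, znat_cochain gz).
apply: (linear_hairy_eq (M := F^o) (f := fun x => zprod m (znat gz) (hact g x))).
- by move=> a x y; rewrite linearP (zprod_linear m c2).
- exact: zprod_linear c1.
- move=> X; rewrite act_hclass !zprod_class //.
  rewrite -[LHS]/(colorprod m (znat gz) (map_lab X g)); apply: colorprod_act => i Y.
  rewrite !znatE /graph_fun -[gconnected (HGraph _)]/(gconnected Y); case: ifP => // cY;
    rewrite -gzE.
  apply: congr1; apply: val_inj; rewrite -[LHS]/(subval _) -[RHS]/(subval _).
  rewrite subval_subrestrict; last exact: act_span_PH.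
  by rewrite !subval_sclass ?act_hclass // /connected_graph gconnected_map_lab.
Qed.

(** Transforming all factors by [g] amounts to evaluating at a translated argument, and e^S of a
    hairless graph is invariant. So already the cocycles agree, not just their classes. *)
Lemma algasm_coinv x : x \in lspan (@coinv_rel F V omega O) -> algasm x = 0.
Proof.
apply: lspan_eq0 => _ [g m k z gz gS gzE].
rewrite linearB /= !algasm_classprod; apply/eqP; rewrite subr_eq0; apply/eqP.
suff E : asm p q m (znat gz) = asm p q m (znat z) by rewrite /asmcls E.
apply/funext => y; rewrite /asm -(zprod_act gzE); congr zprod.
by rewrite (exp_invariant Hpq gS) //; exact: (valP y).
Qed.

Definition coinvasm : coinvariants omega O -> cohomology PG predT := qlift algasm.

Lemma coinvasm_linear : linear coinvasm.
Proof. exact: qlift_linear algasm_coinv. Qed.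

Lemma coinvasm_classprod m (k : 'I_m -> nat) (z : forall i, cocycles PH (pred1 (k i)))
    (zeta : cocycles PG predT) :
  (forall x, subval zeta x = zprod m (znat z) (exp_split p q (subval x))) ->
  coinvasm (qproj _ (classprod z)) = cohclass zeta.
Proof.
move=> zE; rewrite /coinvasm qliftE; last exact: algasm_coinv.
rewrite /= algasm_classprod /asmcls; congr cohclass; apply: val_inj.
rewrite -[LHS]/(subval _) (asmclsK p q m (znat_gcocycle z)).
by apply/funext => x; rewrite -[RHS]/(subval zeta x) zE.
Qed.

End Equivariance.

Theorem mainTheorem9 (F : fieldType) (charF : [pchar F] =i pred0)
    (V : vectType F) (omega : {skew_symmetric V}) (Homega : is_psymplectic omega)
    (n : nat) (n_gt0 : (0 < n)%N) (p q : 'I_n -> V)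
    (Hpq : symplectic_basis omega p q) (O : cyclicOperad F) :
  let PH := @connected_graph F O V in
  let PG := @connected_hairless F O V in
  let S : hairy O V -> hairy O V := split_map p q in
  let eS : hairy O V -> hairy O V := exp_split p q in
  ([/\ descends (hrelations O V) (@formal_bd F O V),
       descends (hrelations O V) (formal_split p q),
       descends (hrelations O V) (formal_exp_split p q) &
       forall g, in_Sp omega g ->
         descends (hrelations O V) (formal_act g)] /\
   [/\ {homo @bd F O V : x / x \in graph_span PH},
       {homo @bd F O V : x / x \in graph_span PG} &
       forall g, in_Sp omega g ->
         {homo @hact F O V g : x / x \in graph_span PH}]) /\
  [/\ forall x, S (bd x) = bd (S x),
      forall x, eS (bd x) = bd (eS x) &
      forall x, x \in graph_span PG -> sp_invariant omega (eS x)] /\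
  (forall m (k : 'I_m -> nat) (z : forall i, cocycles PH (pred1 (k i))),
     exists! Z : hairy O V -> F, is_contribution z Z) /\
  (forall m (k : 'I_m -> nat) (z : forall i, cocycles PH (pred1 (k i))) Z,
     is_contribution z Z ->
     is_cocycle predT (fun x : subcomplex PG => Z (eS (subval x)))) /\
  exists A : {linear coinvariants omega O -> cohomology PG predT},
    forall m (k : 'I_m -> nat) (z : forall i, cocycles PH (pred1 (k i))) Z
           (zeta : cocycles PG predT),
      is_contribution z Z ->
      (forall x, subval zeta x = Z (eS (subval x))) ->
      A (qproj _ (classprod z)) = cohclass zeta.
Proof.
move=> PH PG S eS; split; [split|].
- split=> [|||g _].
  + exact: bd_descends.
  + exact: split_descends.
  + exact: exp_descends.
  + exact: act_descends.
- split=> [||g _].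
  + exact: bd_span_PH.
  + exact: bd_span_PG.
  + exact: act_span_PH.
split; first split=> [x|x|x xG g gS].
- exact: split_bd.
- exact: exp_bd.
- exact: (exp_invariant Hpq gS xG).
split.
  move=> m k z; exists (zprod m (znat z)); split; first exact: contribution_zprod.
  by move=> Z /(contribution_unique (contribution_zprod z)).
split.
  move=> m k z Z cZ; rewrite (contribution_unique cZ (contribution_zprod z)).
  exact: (asm_cocycle p q m (znat_gcocycle z)).
pose A : {linear coinvariants omega O -> cohomology PG predT} :=
  HB.pack (@coinvasm F O V omega n p q) (GRing.isLinear.Build _ _ _ _ _ (coinvasm_linear
    (O := O) Hpq)).
(* By uniqueness, the arbitrary contribution [Z] is the product [zprod] from which [A] was built. *)
exists A => m k z Z zeta cZ zE.
apply: (coinvasm_classprod Hpq) => x.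
by rewrite zE (contribution_unique cZ (contribution_zprod z)).
Qed.
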